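(* Let $n\in\mathbb{N}$, $n\ge 1$, and let $U_{\mathbf{O}}$ be a completely non-unitary contraction with deficiency indices $(n,n)$ on a separable complex Hilbert space $\mathcal{H}$, with defect spaces $\mathcal{D},\mathcal{D}_*$ and characteristic operator function $\Theta(z):\mathcal{D}\to\mathcal{D}_*$, normalized so that $\Theta(0)=0$. Let $A:\mathcal{D}\to\mathcal{D}_*$ be unitary, let $U_A$ be the unitary operator on $\mathcal{H}$ given by $U_A f = U_{\mathbf{O}} f$ for $f\in\mathcal{D}^\perp$ and $U_A f = Af$ for $f\in\mathcal{D}$, and let $\mu_A$ be a scalar-valued spectral measure of $U_A$. Then the following are equivalent: (i) $\mu_A$ is singular with respect to Lebesgue measure $m$ on $\mathbb{T}$; (ii) $\dim\mathcal{X}(\xi)=0$ for $m$-a.e. $\xi\in\mathbb{T}$, where $\mathcal{X}(\xi)=\mathcal{D}\ominus\ker\bigtriangleup(\xi)$ and $\bigtriangleup(\xi)=(\mathbf{I}_{\mathcal{D}}-\Theta(\xi)^*\Theta(\xi))^{1/2}$; (iii) $\Theta$ is inner.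
   Context: $\mathbb{D}$ is the open unit disc, $\mathbb{T}$ the unit circle, $m$ Lebesgue measure on $\mathbb{T}$. A contraction is completely non-unitary (cnu) if it has no nonzero invariant subspace on which it is unitary. For a contraction $U_{\mathbf{O}}$ on $\mathcal{H}$, the defect operators are $D=(\mathbf{I}-U_{\mathbf{O}}^*U_{\mathbf{O}})^{1/2}$ and $D_*=(\mathbf{I}-U_{\mathbf{O}}U_{\mathbf{O}}^* )^{1/2}$; the defect spaces are $\mathcal{D}=\operatorname{clos}D\mathcal{H}$ and $\mathcal{D}_*=\operatorname{clos}D_*\mathcal{H}$; the deficiency indices are $(\dim\mathcal{D},\dim\mathcal{D}_* )$. Write $\mathcal{D}^\perp=\mathcal{H}\ominus\mathcal{D}$ and $\mathcal{D}_*^\perp=\mathcal{H}\ominus\mathcal{D}_*$; $U_{\mathbf{O}}$ maps $\mathcal{D}^\perp$ isometrically onto $\mathcal{D}_*^\perp$. The characteristic operator function of $U_{\mathbf{O}}$ is $$\Theta(z)=\left(-U_{\mathbf{O}}+zD_*(\mathbf{I}-zU_{\mathbf{O}}^* )^{-1}D\right)\big|_{\mathcal{D}}:\mathcal{D}\to\mathcal{D}_*,\qquad z\in\mathbb{D},$$ a bounded analytic operator-valued function with $\|\Theta(z)\|\le1$; for $m$-a.e. $\xi\in\mathbb{T}$, $\Theta(\xi)$ denotes its non-tangential boundary limit in operator norm. (The normalization $\Theta(0)=0$ means $U_{\mathbf{O}}|_{\mathcal{D}}=0$.) $\Theta$ is inner if $\Theta(\xi)$ is a unitary operator for $m$-a.e.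 $\xi\in\mathbb{T}$. A scalar-valued spectral measure $\mu_A$ of $U_A$ is a finite non-negative Borel measure on $\mathbb{T}$ such that $U_A$ is unitarily equivalent to multiplication by $\xi$ on a direct integral $\int_{\mathbb{T}}^{\oplus}\mathcal{H}(\xi)\,d\mu_A(\xi)$ with $\mathcal{H}(\xi)\ne\{0\}$ for $\mu_A$-a.e. $\xi$ (equivalently, $\mu_A$ is mutually absolutely continuous with the projection-valued spectral measure of $U_A$). *)

(* Defs.v *)
From HB Require Import structures.
From mathcomp Require Import all_boot all_order all_algebra.
From mathcomp Require Import complex.
From mathcomp Require Import all_classical all_reals all_analysis.

Set Implicit Arguments.
Unset Strict Implicit.
Unset Printing Implicit Defensive.

Import Order.TTheory GRing.Theory Num.Theory.
Import numFieldNormedType.Exports.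

Local Open Scope classical_set_scope.
Local Open Scope ring_scope.

(* [{dot V for conj}] is linear in its first argument and conjugate-linear in
   its second one. *)
HB.mixin Record isHilbert (R : realType) V of CompleteNormedModule R[i] V := {
  inner : {dot V for @Num.conj R[i]};
  inner_norm : forall x : V, inner x x = `|x| ^+ 2
}.

#[short(type="hilbertType")]
HB.structure Definition Hilbert (R : realType) :=
  {V of isHilbert R V & CompleteNormedModule R[i] V}.

Definition separable (T : topologicalType) : Prop :=
  exists S : set T, countable S /\ dense S.

Section operators.
Context {R : realType} {H : hilbertType R}.
Local Notation C := R[i].
Implicit Types (M N : set H) (T S : H -> H).

Definition subspace_of M : Prop :=
  M 0 /\ forall (a : C) x y, M x -> M y -> M (a *: x + y).

Definition orthogonal_in M N : set H :=
  [set x | M x /\ forall y, N y -> inner x y = 0].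

Definition has_dim M (n : nat) : Prop :=
  exists e : 'I_n -> H,
    (forall c : 'I_n -> C, \sum_i c i *: e i = 0 -> forall i, c i = 0) /\
    M = range (fun c : 'I_n -> C => \sum_i c i *: e i).

(* An operator between subspaces M and N of H is represented by a function on
   H whose values outside M are irrelevant. *)
Definition operator_on M N T : Prop :=
  [/\ forall x, M x -> N (T x),
      forall (a : C) x y, M x -> M y -> T (a *: x + y) = a *: T x + T y &
      exists k : C, forall x, M x -> `|T x| <= k * `|x| ].

Definition unitary_on M N T : Prop :=
  [/\ operator_on M N T,
      forall x y, M x -> M y -> inner (T x) (T y) = inner x y &
      forall y, N y -> exists2 x, M x & T x = y ].

Definition adjoint_on M N T : H -> H :=
  xget (fun=> 0) [set S | operator_on N M S /\
    forall x y, M x -> N y -> inner (T x) y = inner x (S y)].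

(* In R[i], [0 <= z] says that z is a nonnegative real number, so that S below
   is a positive (in particular self-adjoint) operator. *)
Definition sqrt_on M T : H -> H :=
  xget (fun=> 0) [set S | [/\ operator_on M M S,
    forall x, M x -> 0 <= inner (S x) x &
    forall x, M x -> S (S x) = T x]].

Definition inv_op T : H -> H := 'pinv_(fun=> 0) setT T.

Definition contraction_op T : Prop := forall x, `|T x| <= `|x|.

Definition completely_non_unitary T : Prop :=
  forall M, subspace_of M -> closed M -> (forall x, M x -> M (T x)) ->
    unitary_on M M T -> M = [set 0].

Section characteristic_function.
Variable U : H -> H.

Definition adj : H -> H := adjoint_on setT setT U.
Definition defect_op : H -> H := sqrt_on setT (fun x => x - adj (U x)).
Definition defect_op_star : H -> H := sqrt_on setT (fun x => x - U (adj x)).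
Definition defect : set H := closure (range defect_op).
Definition defect_star : set H := closure (range defect_op_star).

Definition Theta (z : C) (x : H) : H :=
  - U x
  + z *: defect_op_star (inv_op (fun y => y - z *: adj y) (defect_op x)).

End characteristic_function.

(* The approach regions are the Stolz angles |z - xi| < K (1 - |z|), K > 0. *)
Definition nontangential_limit M (F : C -> H -> H) (xi : C) T : Prop :=
  forall K eps : C, 0 < K -> 0 < eps -> exists2 delta : C, 0 < delta &
    forall z : C, `|z| < 1 -> `|z - xi| < K * (1 - `|z|) ->
      `|z - xi| < delta ->
      forall x, M x -> `|F z x - T x| <= eps * `|x|.

Definition boundary_value M N (F : C -> H -> H) (xi : C) : H -> H :=
  xget (fun=> 0) [set T | operator_on M N T /\ nontangential_limit M F xi T].

End operators.

Section circle.
Variable R : realType.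

Definition circle_set : set (R[i])^o := [set z | `|z : R[i]| = 1].
Definition circle : Type := set_type circle_set.
HB.instance Definition _ := Topological.on circle.

Lemma expi_subproof (t : R) : (cos t +i* sin t)%C \in circle_set.
Proof.
by apply/mem_set; rewrite /circle_set /= normc_def /= cos2Dsin2 sqrtr1.
Qed.

Definition circle_expi (t : R) : circle :=
  exist (fun z => z \in circle_set) _ (expi_subproof t).

HB.instance Definition _ := isPointed.Build circle (circle_expi 0).

Definition borel_circle : Type := g_sigma_algebraType (@open circle).
HB.instance Definition _ := Measurable.on borel_circle.

Definition circle_val (xi : borel_circle) : R[i] := \val (xi : circle).

Definition expi (t : R) : borel_circle := circle_expi t.

Lemma continuous_expi : continuous circle_expi.
Proof.
apply/continuousP => _ [A oA <-]; rewrite -comp_preimage.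
move: A oA; apply/continuousP => t; apply/cvgrPdist_lt => e e0.
have [r r0 ->] : exists2 r : R, 0 < r & e = r%:C%C.
  by case: e e0 => a b; rewrite ltcE /= => /andP[/eqP -> a0]; exists a.
have r20 : 0 < r / 2 by rewrite divr_gt0.
near=> u; rewrite /= set_valE /=.
suff : `|cos t - cos u| + `|sin t - sin u| < r.
  move=> h; rewrite [`|_|](normc_def (_ +i* _)%C) ltcR; apply: le_lt_trans h.
  rewrite /= -[leRHS]ger0_norm ?addr_ge0// -sqrtr_sqr ler_sqrt ?sqr_ge0//.
  by rewrite [leRHS]sqrrD !real_normK ?num_real// lerD2r lerDl mulrn_wge0
    ?mulr_ge0.
rewrite (splitr r) ltrD//; near: u.
- by move: (@continuous_cos R t) => /cvgrPdist_lt; exact.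
- by move: (@continuous_sin R t) => /cvgrPdist_lt; exact.
Unshelve. all: by end_near. Qed.

Lemma measurable_expi : measurable_fun [set: R] expi.
Proof.
apply: (@measurability _ _ (measurableTypeR R) borel_circle setT expi
  (@open circle)) => [//|_ [A oA <-]].
rewrite setTI; apply: measurable_realfun.open_measurable.
by move/continuousP : continuous_expi; exact.
Qed.

Lemma measurable_itv02pi : measurable (`[0, 2 * pi[%classic : set R).
Proof. exact: measurable_itv. Qed.

(* Arc length: the image under t |-> e^(it) of Lebesgue measure on [0, 2pi[. *)
Definition circle_lebesgue : set borel_circle -> \bar R :=
  pushforward (mrestr (@lebesgue_measure R) measurable_itv02pi) expi.

Let circle_lebesgue0 : circle_lebesgue set0 = 0%E.
Proof. by apply: measure0; exact: measurable_expi. Qed.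

Let circle_lebesgue_ge0 A : (0 <= circle_lebesgue A)%E.
Proof. by apply: measure_ge0; exact: measurable_expi. Qed.

Let circle_lebesgue_sigma_additive : semi_sigma_additive circle_lebesgue.
Proof.
by apply: measure_semi_sigma_additive; exact: measurable_expi.
Qed.

HB.instance Definition _ := isMeasure.Build _ _ _ circle_lebesgue
  circle_lebesgue0 circle_lebesgue_ge0 circle_lebesgue_sigma_additive.

Definition mutually_singular (mu nu : set borel_circle -> \bar R) : Prop :=
  exists A : set borel_circle,
    [/\ measurable A, mu A = 0%E & nu (~` A) = 0%E].

Definition measurable_complex (f : borel_circle -> R[i]) : Prop :=
  measurable_fun setT (fun xi => complex.Re (f xi)) /\
  measurable_fun setT (fun xi => complex.Im (f xi)).

End circle.

Section direct_integral.
Context {R : realType}.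
Local Notation T := (borel_circle R).
Variable E : T -> hilbertType R.
Variable e : nat -> forall xi, E xi.

(* e is a fundamental sequence of sections: it turns E into a measurable field
   of Hilbert spaces. *)
Definition fundamental_sequence : Prop :=
  (forall j k, measurable_complex (fun xi => inner (e j xi) (e k xi))) /\
  forall xi, dense [set x : E xi | exists n (c : nat -> R[i]),
    x = \sum_(k < n) c k *: e k xi].

Definition measurable_section (f : forall xi, E xi) : Prop :=
  forall k, measurable_complex (fun xi => inner (f xi) (e k xi)).

Definition sqnorm (mu : set T -> \bar R) (f : forall xi, E xi) : \bar R :=
  (\int[mu]_xi (complex.Re (`|f xi| ^+ 2))%:E)%E.

(* The elements of the direct integral are the classes of such sections modulo
   equality mu-almost everywhere. *)
Definition L2_section (mu : set T -> \bar R) (f : forall xi, E xi) : Prop :=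
  measurable_section f /\ (sqnorm mu f < +oo)%E.

End direct_integral.

Section spectral_measure.
Context {R : realType} {H : hilbertType R}.

(* V sends each vector of H to a representative of its image. *)
Definition direct_integral_unitary (mu : set (borel_circle R) -> \bar R)
    (E : borel_circle R -> hilbertType R) (e : nat -> forall xi, E xi)
    (V : H -> forall xi, E xi) : Prop :=
  [/\ forall x, L2_section e mu (V x),
      forall (a : R[i]) x y,
        {ae mu, forall xi, V (a *: x + y) xi = a *: V x xi + V y xi},
      forall x, sqnorm mu (V x) = (complex.Re (`|x| ^+ 2))%:E &
      forall f, L2_section e mu f ->
        exists x, {ae mu, forall xi, V x xi = f xi}].

Definition scalar_spectral_measure (W : H -> H)
    (mu : set (borel_circle R) -> \bar R) : Prop :=
  exists (E : borel_circle R -> hilbertType R) (e : nat -> forall xi, E xi)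
         (V : H -> forall xi, E xi),
    [/\ fundamental_sequence e,
        {ae mu, forall xi, exists x : E xi, x <> 0},
        direct_integral_unitary mu e V &
        forall x, {ae mu, forall xi, V (W x) xi = circle_val xi *: V x xi}].

End spectral_measure.

Section boundary.
Context {R : realType} {H : hilbertType R}.
Variable U : H -> H.

Definition Theta_bd (xi : borel_circle R) : H -> H :=
  boundary_value (defect U) (defect_star U) (Theta U) (circle_val xi).

Definition Delta (xi : borel_circle R) : H -> H :=
  sqrt_on (defect U) (fun x =>
    x - adjoint_on (defect U) (defect_star U) (Theta_bd xi) (Theta_bd xi x)).

Definition Xspace (xi : borel_circle R) : set H :=
  orthogonal_in (defect U) [set x | defect U x /\ Delta xi x = 0].

Definition Theta_inner : Prop :=
  {ae @circle_lebesgue R,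
    forall xi, unitary_on (defect U) (defect_star U) (Theta_bd xi)}.

End boundary.

(* Main.v *)
(* Write W for U_A and D for the orthogonal projection onto the defect space.
   Then U = W (1 - D), adj U = (1 - D) W^-1, and Theta(z) d is a power series
   with coefficients h_0 = 0 and h_{k+1} = W D W^-1 (adj U)^k d, so that
   sum_k |h_k|^2 = |d|^2 - lim_k |(adj U)^k d|^2. Nontangential limits of such a
   square summable series exist almost everywhere by the Hardy-Littlewood
   maximal inequality applied to its blocks.

   (i) => (ii). With w the pointwise squared norm of an orthonormal basis of the
   defect space in the spectral representation, |d|^2 - |Theta(z) d|^2 is at most
   a multiple of the Poisson integral of w mu at z. For singular mu its radial
   lower limit vanishes almost everywhere, so the limits Theta(xi) are isometric.

   (ii) => (iii). X(xi) = 0 forces 1 - Theta(xi)^* Theta(xi) = 0, and an isometry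
   between spaces of the same finite dimension is onto.

   (iii) => (i). For inner Theta, Parseval gives (adj U)^k d -> 0 on the defect
   space. If mu is not singular, then mu <= k m on a set of positive mu-measure,
   and a vector x supported there satisfies sum_k |D W^-k x|^2 < oo by Bessel's
   inequality. Expanding <W^-N x, v> along the orbit of v under adj U shows that
   x is orthogonal to all W^j d, j in Z, d in the defect space, so x = 0 since U
   is completely non-unitary. *)

Require Import Defs.
From HB Require Import structures.
From mathcomp Require Import all_boot all_order all_algebra.
From mathcomp Require Import complex.
From mathcomp Require Import all_classical all_reals all_analysis.
From mathcomp Require Import measurable_realfun.
From mathcomp Require Import ring lra.

Set Implicit Arguments.
Unset Strict Implicit.
Unset Printing Implicit Defensive.

Import Order.TTheory GRing.Theory Num.Theory.
Import numFieldNormedType.Exports.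

Local Open Scope classical_set_scope.
Local Open Scope ring_scope.

(** The adjoint, the defect operators, the resolvent inside [Theta], the boundary values and [Delta]
    are all picked by choice and are zero when nothing fits, so each must be shown to meet its
    specification. This needs no general theory of adjoints or square roots: [Theta(0) = 0] makes
    [I - U^* U] idempotent, so its positive root is a projection, positive dimension excludes the
    zero defaults of the defect operators, and on the boundary everything happens in finite
    dimension. Poisson integrals are needed only up to constants and in one direction. The Poisson
    formula is therefore replaced by exact Parseval identities for polynomials times truncated
    Cauchy kernels, which is where [2 / pi] and [8 * pi] come from. In (i) => (ii) a lower limit is
    enough because the limit of [Theta] is already known to exist; this avoids a maximal theorem for
    singular measures. In (iii) => (i) the spectral representation is given only as a norm identity,
    so inner products enter through polarization and Bessel's inequality through a weighted Young
    inequality. *)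

Local Notation Re := complex.Re.
Local Notation Im := complex.Im.

(** * Real inner products *)

Section complex_numbers.
Context {R : realType}.
Implicit Types a b : R[i].

Lemma realc_ge0 (r : R) : (0 <= r%:C%C) = (0 <= r).
Proof. exact: (lecR 0 r). Qed.

(** Squared modulus with values in [R]: the norm on [R[i]] is complex valued, out of reach of [lra]
    and of real integration. *)
Definition csq a : R := Re a ^+ 2 + Im a ^+ 2.

Lemma csq_ge0 a : 0 <= csq a. Proof. by rewrite addr_ge0 ?sqr_ge0. Qed.

Lemma csqE a : (csq a)%:C%C = `|a| ^+ 2. Proof. exact: add_Re2_Im2. Qed.

Lemma csqM a b : csq (a * b) = csq a * csq b.
Proof. by case: a b => [a1 a2] [b1 b2]; rewrite /csq /=; ring. Qed.

Lemma csqX a n : csq (a ^+ n) = csq a ^+ n.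
Proof.
elim: n => [|n IH]; last by rewrite !exprS csqM IH.
by rewrite /csq /= expr0n expr1n addr0.
Qed.

Lemma csqJ a : csq a^*%C = csq a.
Proof. by case: a => a1 a2; rewrite /csq /= sqrrN. Qed.

Lemma csqN a : csq (- a) = csq a.
Proof. by case: a => a1 a2; rewrite /csq /= !sqrrN. Qed.

Lemma csq_real (x : R) : csq x%:C%C = x ^+ 2.
Proof. by rewrite /csq /= expr0n addr0. Qed.

Lemma csq_eq0 a : (csq a == 0) = (a == 0).
Proof.
by rewrite -(inj_eq (@complexI R)) csqE sqrf_eq0 normr_eq0.
Qed.

Lemma ler_normc a (r : R) : 0 <= r -> (`|a| <= r%:C%C) = (csq a <= r ^+ 2).
Proof.
move=> r0; rewrite -lecR csqE rmorphXn /=.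
by rewrite ler_sqr ?nnegrE ?normr_ge0 // realc_ge0.
Qed.

End complex_numbers.

Section real_inner_product.
Context {R : realType} {H : hilbertType R}.
Local Notation C := R[i].
Implicit Types (x y u v : H) (a : C) (s : R).

(** The underlying real inner product. Orthogonality and isometry can be tested on it, because the
    imaginary part is recovered by rotating one argument. *)
Definition rip x y : R := Re (inner x y).
Definition sqn x : R := rip x x.

Lemma innerJ x y : inner x y = (inner y x)^*%C.
Proof. by rewrite [LHS]hermC expr0 mul1r. Qed.

Lemma innerDl x y u : inner (x + y) u = inner x u + inner y u.
Proof. exact: linearDl. Qed.
Lemma innerDr x y u : inner u (x + y) = inner u x + inner u y.
Proof. exact: linearDr. Qed.
Lemma innerZl a x y : inner (a *: x) y = a * inner x y.
Proof. exact: linearZl_LR. Qed.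
Lemma innerZr a x y : inner x (a *: y) = a^*%C * inner x y.
Proof. exact: (linearZr_LR (@inner R H) x a y). Qed.
Lemma inner0l y : inner 0 y = 0. Proof. exact: linear0l. Qed.
Lemma inner0r y : inner y 0 = 0. Proof. exact: linear0r. Qed.

Lemma ripC x y : rip x y = rip y x.
Proof. by rewrite /rip innerJ; case: (inner y x). Qed.

Lemma ripDl x y u : rip (x + y) u = rip x u + rip y u.
Proof. by rewrite /rip innerDl raddfD. Qed.

Lemma ripDr x y u : rip u (x + y) = rip u x + rip u y.
Proof. by rewrite ripC ripDl !(ripC u). Qed.

Lemma ripNl x y : rip (- x) y = - rip x y.
Proof. by rewrite -scaleN1r /rip innerZl mulN1r raddfN. Qed.

Lemma ripNr x y : rip x (- y) = - rip x y.
Proof. by rewrite ripC ripNl ripC. Qed.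

Lemma rip0l y : rip 0 y = 0. Proof. by rewrite /rip inner0l. Qed.
Lemma rip0r y : rip y 0 = 0. Proof. by rewrite ripC rip0l. Qed.

Lemma ripZl s x y : rip (s%:C%C *: x) y = s * rip x y.
Proof. by rewrite /rip innerZl; case: (inner x y) => p q /=; rewrite mul0r subr0. Qed.

Lemma ripZr s x y : rip x (s%:C%C *: y) = s * rip x y.
Proof. by rewrite ripC ripZl ripC. Qed.

Lemma rip_suml (I : Type) (r : seq I) (P : pred I) (F : I -> H) y :
  rip (\sum_(i <- r | P i) F i) y = \sum_(i <- r | P i) rip (F i) y.
Proof.
by rewrite (big_morph (rip^~ y) (fun u v => ripDl u v y) (rip0l y)).
Qed.

(** Conjugate-linearity in the second argument gives [inner x (i y) = - i (inner x y)], whose real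
    part is the imaginary part of [inner x y]. *)
Lemma inner_rip x y : inner x y = Complex (rip x y) (rip x ('i%C *: y)).
Proof.
by rewrite {2}/rip innerZr /rip; case: (inner x y) => p q /=; congr Complex; ring.
Qed.

Lemma sqnE x : (sqn x)%:C%C = `|x| ^+ 2.
Proof.
rewrite -inner_norm /sqn /rip [RHS]complexE.
have -> : Im (inner x x) = 0.
  by have := congr1 (@Im R) (innerJ x x); case: (inner x x) => p q /= h; lra.
by rewrite mulr0 addr0.
Qed.

Lemma inner_sqn x : inner x x = (sqn x)%:C%C.
Proof. by rewrite sqnE inner_norm. Qed.

Lemma sqn_ge0 x : 0 <= sqn x.
Proof. by rewrite -lecR sqnE exprn_ge0. Qed.

Lemma sqn_eq0 x : (sqn x == 0) = (x == 0).
Proof. by rewrite -(inj_eq (@complexI R)) sqnE sqrf_eq0 normr_eq0. Qed.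

Lemma sqn0_eq x : sqn x <= 0 -> x = 0.
Proof. by move=> h; apply/eqP; rewrite -sqn_eq0 eq_le h sqn_ge0. Qed.

Lemma sqnN x : sqn (- x) = sqn x.
Proof. by rewrite /sqn ripNl ripNr opprK. Qed.

Lemma sqn0 : sqn 0 = 0. Proof. exact: rip0l. Qed.

Lemma sqnD x y : sqn (x + y) = sqn x + 2 * rip x y + sqn y.
Proof. by rewrite /sqn ripDl !ripDr (ripC y x); ring. Qed.

Lemma sqnB x y : sqn (x - y) = sqn x - 2 * rip x y + sqn y.
Proof. by rewrite sqnD sqnN ripNr; ring. Qed.

Lemma sqnZ a x : sqn (a *: x) = csq a * sqn x.
Proof.
by apply: complexI; rewrite sqnE normrZ exprMn -csqE -sqnE rmorphM.
Qed.

Lemma norm_sqn x : `|x| = (Num.sqrt (sqn x))%:C%C.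
Proof.
apply/eqP; rewrite -(@eqrXn2 _ 2) //; first by rewrite -sqnE -rmorphXn /= sqr_sqrtr ?sqn_ge0.
by rewrite realc_ge0 sqrtr_ge0.
Qed.

Lemma ler_norm_sqn x y : (`|x| <= `|y|) = (sqn x <= sqn y).
Proof. by rewrite -lecR !sqnE ler_sqr ?nnegrE. Qed.

Lemma ler_norm_real x (r : R) : 0 <= r -> (`|x| <= r%:C%C) = (sqn x <= r ^+ 2).
Proof.
move=> r0; rewrite -lecR sqnE rmorphXn /=.
by rewrite ler_sqr ?nnegrE ?normr_ge0 // realc_ge0.
Qed.

(** Weighted Young inequality: expand [|s x - y|^2 >= 0] and divide by [s]. The free weight is what
    later allows terms to be absorbed. *)
Lemma rip_le x y s : 0 < s -> 2 * rip x y <= s * sqn x + sqn y / s.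
Proof.
move=> s0; have := sqn_ge0 (s%:C%C *: x - y).
rewrite sqnB sqnZ ripZl csq_real => h.
rewrite -(ler_pM2l s0) mulrDr mulrCA [X in _ + X]mulrC mulfVK ?gt_eqF //.
by rewrite [s * (s * _)]mulrA -expr2; lra.
Qed.

Lemma rip_sqr_le x y : rip x y ^+ 2 <= sqn x * sqn y.
Proof.
have [y0|y0] := eqVneq y 0; first by rewrite y0 rip0r sqn0 mulr0 expr0n.
have ny : 0 < sqn y by rewrite lt_neqAle sqn_ge0 eq_sym sqn_eq0 y0.
have := sqn_ge0 (x - (rip x y / sqn y)%:C%C *: y).
rewrite sqnB sqnZ ripZr csq_real => h.
rewrite -subr_ge0 -(pmulr_lge0 _ (_ : 0 < (sqn y)^-1)) ?invr_gt0 //.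
by rewrite [leRHS](_ : _ = sqn x - 2 * (rip x y / sqn y * rip x y) + (rip x y / sqn y) ^+ 2 * sqn y) //; field; rewrite gt_eqF.
Qed.

Lemma csq_inner_le x y : csq (inner x y) <= sqn x * sqn y.
Proof.
have [->|nz] := eqVneq (inner x y) 0.
  by rewrite /csq /= expr0n addr0 mulr_ge0 ?sqn_ge0.
(* After this rotation the inner product is the real number [csq (inner x y)], and one factor of it
   cancels. *)
have := rip_sqr_le ((inner x y)^*%C *: x) y.
rewrite sqnZ csqJ {1}/rip innerZl.
have -> : Re ((inner x y)^*%C * inner x y) = csq (inner x y).
  by rewrite /csq; case: (inner x y) => p q /=; ring.
rewrite expr2 -mulrA ler_pM2l // lt_neqAle csq_ge0 eq_sym csq_eq0 nz //.
Qed.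

Lemma sqnD_le x y : sqn (x + y) <= 2 * sqn x + 2 * sqn y.
Proof. by have := rip_le x y ltr01; rewrite sqnD divr1 mul1r; lra. Qed.

Lemma sqn_lincomb_le n (a : 'I_n -> C) (x : 'I_n -> H) :
  sqn (\sum_(i < n) a i *: x i) <=
  (\sum_(i < n) csq (a i)) * \sum_(i < n) sqn (x i).
Proof.
elim: n a x => [|n IH] a x; first by rewrite !big_ord0 sqn0 mulr0.
rewrite !big_ord_recr /=.
set S := \sum_(i < n) _; set A := \sum_(i < n) csq _; set B := \sum_(i < n) sqn _.
have {IH} IH : sqn S <= A * B by exact: IH.
have A0 : 0 <= A by apply: sumr_ge0 => i _; exact: csq_ge0.
have B0 : 0 <= B by apply: sumr_ge0 => i _; exact: sqn_ge0.
set al := csq (a ord_max); set be := sqn (x ord_max).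
have al0 : 0 <= al by exact: csq_ge0.
have be0 : 0 <= be by exact: sqn_ge0.
have h : 2 * rip S (a ord_max *: x ord_max) <= A * be + al * B.
  have p0 : 0 <= A * be + al * B by rewrite addr_ge0 ?mulr_ge0.
  have [n0|n0] := leP (rip S (a ord_max *: x ord_max)) 0; first by lra.
  rewrite -ler_sqr ?nnegrE // ?mulr_ge0 ?(ltW n0) //.
  have h1 := rip_sqr_le S (a ord_max *: x ord_max).
  rewrite sqnZ -/al -/be in h1.
  have h2 : sqn S * (al * be) <= A * B * (al * be) by rewrite ler_wpM2r ?mulr_ge0.
  (* The cross term is controlled by the arithmetic-geometric mean inequality for [A * be] and
     [al * B]. *)
  have h3 := sqr_ge0 (A * be - al * B).
  have -> : (2 * rip S (a ord_max *: x ord_max)) ^+ 2 = 4 * rip S (a ord_max *: x ord_max) ^+ 2 by ring.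
  have e1 : (A * be - al * B) ^+ 2 = (A * be) ^+ 2 + (al * B) ^+ 2 - 2 * (A * B * (al * be)) by ring.
  have e2 : (A * be + al * B) ^+ 2 = (A * be) ^+ 2 + (al * B) ^+ 2 + 2 * (A * B * (al * be)) by ring.
  by rewrite e1 in h3; rewrite e2; lra.
rewrite sqnD sqnZ -/al -/be mulrDl !mulrDr; lra.
Qed.

Lemma sqn_sum_le (n : nat) (F : 'I_n -> H) :
  sqn (\sum_(i < n) F i) <= n%:R * \sum_(i < n) sqn (F i).
Proof.
have := sqn_lincomb_le (fun=> 1) F; under eq_bigr do rewrite scale1r.
by rewrite sumr_const card_ord -(rmorph1 (real_complex R)) csq_real expr1n.
Qed.

End real_inner_product.

Section geometric_convergence.
Context {R : realType} {H : hilbertType R}.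

Lemma geometric_small (c q e : R) : 0 <= q < 1 -> 0 < e ->
  exists N, forall n, (N <= n)%N -> c * q ^+ n < e.
Proof.
move=> /andP[q0 q1] e0; have : (fun n => c * q ^+ n) @ \oo --> c * 0.
  by apply: cvgMr; apply: cvg_expr; rewrite ger0_norm.
rewrite mulr0 => /cvgrPdist_lt /(_ _ e0) [N _ hN]; exists N => n /hN /=.
by rewrite sub0r normrN; apply: le_lt_trans; exact: ler_norm.
Qed.

(** The explicit rate matters as much as the limit: it is used uniformly in a parameter on which [u]
    depends. *)
Lemma geometric_cvg (u : nat -> H) (c q : R) : 0 <= c -> 0 <= q < 1 ->
  (forall n, `|u n.+1 - u n| <= (c * q ^+ n)%:C%C) ->
  exists l, forall n, `|l - u n| <= (c * q ^+ n / (1 - q))%:C%C.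
Proof.
move=> c0 q01 hu; have /andP[q0 q1] := q01.
have q1' : 0 < 1 - q by rewrite subr_gt0.
have cauchy n k : `|u (n + k)%N - u n| <= (c * q ^+ n / (1 - q))%:C%C.
  suff : `|u (n + k)%N - u n| <= (c * q ^+ n / (1 - q) * (1 - q ^+ k))%:C%C.
    move=> /le_trans; apply; rewrite lecR ler_piMr //.
      by rewrite divr_ge0 ?mulr_ge0 ?exprn_ge0 // ltW.
    by rewrite gerBl exprn_ge0.
  elim: k => [|k IH]; first by rewrite addn0 subrr normr0 expr0 subrr mulr0.
  have -> : u (n + k.+1)%N - u n = (u (n + k).+1 - u (n + k)%N) + (u (n + k)%N - u n).
    by rewrite addnS addrA subrK.
  apply: (le_trans (ler_normD _ _)); apply: (le_trans (lerD (hu _) IH)).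
  rewrite -rmorphD lecR exprD exprS le_eqVlt; apply/orP; left; apply/eqP.
  by field; rewrite gt_eqF.
have uc : cvgn u.
  apply/cauchy_cvgP/cauchy_ballP => e e0.
  have [r r0 re] : exists2 r : R, 0 < r & e = r%:C%C.
    by case: e e0 => a b; rewrite ltcE /= => /andP[/eqP -> a0]; exists a.
  have [|N hN] := @geometric_small (c / (1 - q)) q (r / 2) q01; first by rewrite divr_gt0.
  have hb n : (N <= n)%N -> `|u n - u N| < (r / 2)%:C%C.
    move=> Nn; rewrite -(subnKC Nn); apply: le_lt_trans (cauchy _ _) _.
    by rewrite ltcR mulrAC hN.
  exists (u @` [set k | (N <= k)%N], u @` [set k | (N <= k)%N]) => /=.
    by split; exists N => // k Nk /=; exists k.
  move=> [_ _] /= [[n Nn <-] [m Nm <-]].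
  rewrite -ball_normE /= re (splitr r) rmorphD /=.
  rewrite -(subrK (u N) (u n)) -addrA.
  by apply: le_lt_trans (ler_normD _ _) _; rewrite ltrD ?hb // distrC hb.
exists (limn u) => n.
apply/ler_addgt0Pr => e e0.
have /cvgrPdist_lt /(_ _ e0) [N _ hN] := uc.
have := hN (n + N)%N (leq_addl _ _) => /= h.
rewrite -(subrK (u (n + N)%N) (limn u)) -addrA addrC.
apply: (le_trans (ler_normD _ _)); apply: lerD (cauchy _ _) (ltW h).
Qed.

End geometric_convergence.

(** * The contraction as a perturbation of a unitary operator *)

Section operators_lemmas.
Context {R : realType} {H : hilbertType R}.
Local Notation C := R[i].
Implicit Types (x y : H) (M : set H).

Lemma linear_pack (f : H -> H) :
  (forall (a : C) x y, f (a *: x + y) = a *: f x + f y) ->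
  exists g : {linear H -> H}, f = g.
Proof.
move=> lf; pose m := GRing.isLinear.Build _ _ _ _ f lf.
by exists (HB.pack f m : {linear H -> H}).
Qed.

(** Polarization: the quadratic form is real at [x], [y], [x + y] and [i x + y], which fixes both
    the real and the imaginary part. *)
Lemma positive_symmetric M (S : H -> H) : subspace_of M ->
  (forall (a : C) x y, M x -> M y -> S (a *: x + y) = a *: S x + S y) ->
  (forall x, M x -> 0 <= inner (S x) x) ->
  forall x y, M x -> M y -> inner (S x) y = inner x (S y).
Proof.
move=> [M0 Mlin] lS pS x y Mx My.
have im0 u : M u -> Im (inner (S u) u) = 0 by move=> /pS /ger0_Im.
have hx := im0 _ Mx; have hy := im0 _ My.
have h1 := im0 _ (Mlin 1 x y Mx My).
have h2 := im0 _ (Mlin 'i%C x y Mx My).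
move: h1 h2; rewrite !lS // !innerDl !innerDr !innerZl !innerZr.
rewrite (innerJ x (S y)); move: hx hy.
case: (inner (S x) x) => a1 a2; case: (inner (S y) y) => b1 b2.
case: (inner (S x) y) => c1 c2; case: (inner (S y) x) => d1 d2.
rewrite /= => -> -> h1 h2.
have -> : c1 = d1 by move: h2; rewrite !(mul0r, mulr0, mul1r, mulr1); lra.
by have -> : c2 = - d2 by move: h1; rewrite !(mul0r, mulr0, mul1r, mulr1); lra.
Qed.

Lemma subspace_setT : subspace_of [set: H]. Proof. by split. Qed.

(** Symmetry turns [S^4 = S^2] into [S^3 = S]. Then [y = S x - S^2 x] satisfies [S y = - y], and
    positivity forces [y = 0]. *)
Lemma idempotent_of_positive (S : {linear H -> H}) :
  (forall x, 0 <= inner (S x) x) ->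
  (forall x, S (S (S (S x))) = S (S x)) -> forall x, S (S x) = S x.
Proof.
move=> pS S4 x.
have sS u v : rip (S u) v = rip u (S v).
  rewrite /rip (positive_symmetric subspace_setT) //.
  by move=> a z w _ _; rewrite linearP.
have S3 u : S (S (S u)) = S u.
  apply/eqP; rewrite -subr_eq0; apply/eqP; apply: sqn0_eq.
  rewrite -!linearB /= /sqn sS linearB /= linearB /= S4 subrr.
  by rewrite rip0r.
pose y := S x - S (S x).
have Sy : S y = - y by rewrite /y linearB /= S3 opprB.
have := pS y; rewrite Sy => h.
have {}h : 0 <= - sqn y by rewrite /sqn -ripNl /rip; move: h; rewrite lecE => /andP[].
have /sqn0_eq : sqn y <= 0 by lra.
by move=> /eqP; rewrite subr_eq0 => /eqP.
Qed.

Lemma closure_range_idempotent (P : {linear H -> H}) :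
  (forall x, P (P x) = P x) -> (forall x, sqn (P x) <= sqn x) ->
  closure (range P) = [set x | P x = x].
Proof.
move=> PP cP; apply/seteqP; split=> x /=; last first.
  by move=> Px; apply: subset_closure; exists x.
move=> clx; apply/eqP; rewrite -subr_eq0 -normr_le0; apply/ler_addgt0Pr => e e0.
rewrite add0r.
have [] := clx (ball x (e / 2)); first by apply: nbhsx_ballx; rewrite divr_gt0.
move=> _ [[z _ <-]]; rewrite -ball_normE /= => xz.
rewrite -(subrK (P z) (P x)) -addrA (splitr e).
apply: (le_trans (ler_normD _ _)); apply: lerD; last by rewrite distrC ltW.
apply: le_trans (ltW xz); rewrite -{1}(PP z) -linearB.
by rewrite ler_norm_sqn cP.
Qed.

Lemma closure_set0 : closure [set (0 : H)] = [set 0].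
Proof.
apply/esym/closure_id; apply: accessible_closed_set1.
exact/hausdorff_accessible/norm_hausdorff.
Qed.

Lemma has_dim_neq0 M n : (0 < n)%N -> has_dim M n -> exists2 x, M x & x != 0.
Proof.
case: n => // n _ [e [free ->]]; exists (e ord0).
  exists (fun i => (i == ord0)%:R) => //.
  rewrite (bigD1 ord0) //= scale1r big1 ?addr0 // => i /negPf ->.
  by rewrite scale0r.
apply/eqP => e0; have := free (fun i => (i == ord0)%:R) _ ord0.
rewrite eqxx => /(_ _)/eqP; rewrite oner_eq0 => h.
suff : false by []; apply: h.
rewrite (bigD1 ord0) //= e0 scaler0 big1 ?addr0 // => i /negPf ->.
by rewrite scale0r.
Qed.

(** A chosen operator meets its specification, or it is the default and nothing meets the
    specification. All the operators of the statement are analysed through this dichotomy. *)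
Lemma xgetVP (f0 : H -> H) (P : set (H -> H)) :
  P (xget f0 P) \/ xget f0 P = f0 /\ forall f, ~ P f.
Proof.
have [[S PS]|nP] := pselect (exists S, P S).
  by left; exact: (xgetPex _ (ex_intro _ S PS)).
right; split=> [|S PS]; last by apply: nP; exists S.
by apply: xgetPN => S PS; apply: nP; exists S.
Qed.

Lemma sqrt_onP M (T : H -> H) :
  [/\ operator_on M M (sqrt_on M T),
    forall x, M x -> 0 <= inner (sqrt_on M T x) x &
    forall x, M x -> sqrt_on M T (sqrt_on M T x) = T x] \/
  sqrt_on M T = fun=> 0.
Proof.
by rewrite /sqrt_on; set P := [set S | _]; have [h|[h _]] := xgetVP (fun=> 0) P; [left|right].
Qed.

Lemma adjoint_onP M N (T : H -> H) :
  (operator_on N M (adjoint_on M N T) /\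
   forall x y, M x -> N y -> inner (T x) y = inner x (adjoint_on M N T y)) \/
  (adjoint_on M N T = (fun=> 0) /\
   forall S, operator_on N M S ->
     ~ forall x y, M x -> N y -> inner (T x) y = inner x (S y)).
Proof.
rewrite /adjoint_on; set P := [set S | _]; have [h|[-> nP]] := xgetVP (fun=> 0) P; first by left.
by right; split => // S oS hS; apply: (nP S).
Qed.

End operators_lemmas.

Section unitary_perturbation.
Context {R : realType} {H : hilbertType R}.
Local Notation C := R[i].

(* [U] is the contraction [W (1 - D)], where [W] is unitary with inverse [Wi]
   and [D] is the orthogonal projection on the defect space. *)
Definition perturbation_of (U W D Wi : H -> H) : Prop :=
  [/\ (forall x, D (D x) = D x) /\ (forall x y, inner (D x) y = inner x (D y)),
      cancel W Wi /\ cancel Wi W, (forall x, sqn (W x) = sqn x) &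
      [/\ defect U = [set x | D x = x],
          defect_star U = [set x | W (D (Wi x)) = x],
          (forall x, U x = W (x - D x)) /\ (forall x, adj U x = Wi x - D (Wi x)),
          (forall x, defect_op U x = D x) &
          (forall x, defect_op_star U x = W (D (Wi x)))]].

Variables (n : nat) (U : {linear H -> H}) (A : H -> H) (UA : {linear H -> H}).
Hypotheses (n_gt0 : (0 < n)%N)
    (dim_defect : has_dim (defect U) n)
    (dim_defect_star : has_dim (defect_star U) n)
    (Theta0 : forall x, defect U x -> Theta U 0 x = 0)
    (A_unitary : unitary_on (defect U) (defect_star U) A)
    (UA_orthogonal : forall f, orthogonal_in setT (defect U) f -> UA f = U f)
    (UA_defect : forall f, defect U f -> UA f = A f).

Lemma U_defect x : defect U x -> U x = 0.
Proof.
move=> /Theta0; rewrite /Theta scale0r addr0 => /eqP.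
by rewrite oppr_eq0 => /eqP.
Qed.

(** The default root would have range [{0}], against the positive dimension of the closure of its
    range. *)
Lemma sqrt_on_dim (T : H -> H) : has_dim (closure (range (sqrt_on setT T))) n ->
  exists S : {linear H -> H}, [/\ sqrt_on setT T = S,
    forall x, 0 <= inner (S x) x & forall x, S (S x) = T x].
Proof.
move=> dS; have [[[_ lS _] pS SS]|S0] := sqrt_onP setT T.
  have [S SE] := linear_pack (fun a x y => lS a x y I I).
  by exists S; split => // x; [have := pS x I|have := SS x I]; rewrite !SE.
have [x] := has_dim_neq0 n_gt0 dS.
rewrite S0 (_ : range _ = [set 0]) ?closure_set0 => [/= ->|].
  by rewrite eqxx.
by apply/seteqP; split=> z /= => [[? _ <-]|->] //; exists 0.
Qed.

(** Since [U] vanishes on the defect space, both defect operators are orthogonal projections, and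
    [UA = U + A D] acts by pieces with orthogonal domains and orthogonal ranges. *)
Lemma perturbation_exists :
  exists D Wi : {linear H -> H}, perturbation_of U UA D Wi.
Proof.
have [D [DE pD DD]] := sqrt_on_dim dim_defect.
have [S [SE pS SS]] := sqrt_on_dim dim_defect_star.
have DUE : defect_op U = D by [].
have SUE : defect_op_star U = S by [].
have defD x : defect U (D x) by apply: subset_closure; exists x => //; rewrite DUE.
have [B [BE adjB]] : exists B : {linear H -> H}, adj U = B /\
    forall x y, inner (U x) y = inner x (B y).
  rewrite /adj; have [[[_ lB _] hB]|[B0 nB]] := adjoint_onP setT setT U.
    have [B BE] := linear_pack (fun a x y => lB a x y I I).
    by exists B; split => // x y; rewrite -BE hB.
  (* With the default adjoint the defect operator would square to the identity, so [U] would vanish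
     everywhere and the zero map would be its adjoint. *)
  exfalso; apply: (nB (fun=> 0)) => [|x y _ _].
    by split => // [a x y _ _|]; [rewrite scaler0 addr0|exists 0 => x _; rewrite normr0 mul0r].
  have Dx : D (D x) = x by rewrite DD /adj B0 subr0.
  by rewrite -Dx U_defect // inner0l inner0r.
have DD' x : D (D x) = x - B (U x) by rewrite DD BE.
have SS' x : S (S x) = x - U (B x) by rewrite SS BE.
(* [U] kills the range of [D], so [D^2 = I - B U] is idempotent, that is [D^4 = D^2]. *)
have Didem : forall x, D (D x) = D x.
  apply: idempotent_of_positive => // x.
  by rewrite DD' U_defect // linear0 subr0.
have symD x y : inner (D x) y = inner x (D y).
  rewrite (positive_symmetric subspace_setT) //.
  by move=> a z w _ _; rewrite linearP.
have symS x y : inner (S x) y = inner x (S y).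
  rewrite (positive_symmetric subspace_setT) //.
  by move=> a z w _ _; rewrite linearP.
have UD x : U (D x) = 0 by rewrite U_defect.
have BU x : B (U x) = x - D x by rewrite -(Didem x) DD' opprB addrC subrK.
have DB y : D (B y) = 0.
  by apply/eqP; rewrite -sqn_eq0 /sqn /rip symD innerJ -adjB Didem UD inner0l.
(* From [B U = I - D] and [D B = 0] follows [B U B = B], hence [I - U B] is idempotent. *)
have Sidem : forall x, S (S x) = S x.
  apply: idempotent_of_positive => // x.
  rewrite SS' (SS' x) linearB /= linearB /= BU DB subr0 subrr subr0 //.
have SU x : S (U x) = 0 by rewrite -Sidem SS' BU linearB /= UD subr0 subrr.
have contr (P : {linear H -> H}) : (forall x, P (P x) = P x) ->
    (forall x y, inner (P x) y = inner x (P y)) -> forall x, sqn (P x) <= sqn x.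
  move=> PP sP x; have := sqn_ge0 (x - P x).
  have e : rip x (P x) = sqn (P x) by rewrite /sqn {2}/rip sP PP.
  by rewrite sqnB e; lra.
have defE : defect U = [set x | D x = x].
  by rewrite /defect DUE closure_range_idempotent //; exact: contr.
have defsE : defect_star U = [set x | S x = x].
  by rewrite /defect_star SUE closure_range_idempotent //; exact: contr.
have UAE f : UA f = U f + A (D f).
  rewrite -{1}(subrK (D f) f) linearD /= UA_orthogonal ?UA_defect //.
    by rewrite linearB /= UD subr0.
  by split => // y; rewrite defE /= => yE; rewrite linearBl /= symD yE subrr.
have [[A_def _ _] A_iso A_surj] := A_unitary.
(* [U f] lies in the kernel of [S] and [A (D f)] in its range; their squared norms are
   [|f|^2 - |D f|^2] and [|D f|^2]. *)
have UA_iso f : sqn (UA f) = sqn f.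
  have oA : rip (U f) (A (D f)) = 0.
    have : defect_star U (A (D f)) by exact: A_def.
    by rewrite defsE /= /rip => <-; rewrite -symS SU inner0l.
  rewrite UAE sqnD oA mulr0 addr0 {2}/sqn /rip A_iso //.
  rewrite {1}/sqn {1}/rip adjB BU -/(rip _ _) ripDr ripNr.
  have -> : rip f (D f) = sqn (D f) by rewrite /sqn {2}/rip symD Didem.
  by rewrite -/(rip _ _) -/(sqn _) subrK.
(* [UA] sends [B y] to [y - S y]; the missing [S y] is the image under [A] of a defect vector. *)
have surj y : exists x, UA (B y + x) = y /\ D x = x.
  have [x dx Ax] : exists2 x, defect U x & A x = S y.
    by apply: A_surj; rewrite defsE /= Sidem.
  exists x; split; last by move: dx; rewrite defE.
  have Dx : D x = x by move: dx; rewrite defE.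
  rewrite UAE linearD /= (U_defect dx) addr0 linearD /= DB add0r Dx Ax.
  by rewrite -(Sidem y) SS' addrC subrK.
have [g gP] := choice surj.
pose Wi0 y := B y + g y.
have UAK : cancel Wi0 UA by move=> y; have [] := gP y.
have UAI : injective UA.
  move=> x y /eqP; rewrite -subr_eq0 -linearB -sqn_eq0 UA_iso sqn_eq0 subr_eq0.
  by move=> /eqP.
have A0 : A 0 = 0.
  by rewrite -UA_defect ?linear0 //; rewrite -(linear0 D); exact: defD.
have [Wi WiE] : exists Wi : {linear H -> H}, Wi0 = Wi.
  by apply: linear_pack => a x y; apply: UAI; rewrite linearP !UAK.
have DWi y : D (Wi y) = g y.
  by rewrite -WiE /Wi0 linearD /= DB add0r; have [] := gP y.
have SW y : S y = UA (D (Wi y)).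
  rewrite DWi -Sidem SS'; have [+ _] := gP y; rewrite linearD /= UAE DB A0 addr0.
  by move=> {1}<-; rewrite addrAC subrr add0r.
exists D, Wi; split => //.
- by split=> x; [apply: UAI; rewrite -WiE UAK|rewrite -WiE UAK].
- split => //.
  + by rewrite defsE; apply/seteqP; split=> x /=; rewrite SW.
  + split=> x; first by rewrite UAE !linearB /= UD Didem subrr A0 subr0 addr0.
    by rewrite BE DWi -WiE /Wi0 addrK.
  + by move=> x; rewrite DUE.
  + by move=> x; rewrite SUE SW.
Qed.

End unitary_perturbation.

(** * Resolvent, norm identity and Taylor series of the characteristic function *)

Section perturbation_theory.
Context {R : realType} {H : hilbertType R}.
Local Notation C := R[i].
Implicit Types (x y u v d : H) (z : C).

Lemma geometric_eq0 x (c q : R) : 0 <= q < 1 ->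
  (forall n, `|x| <= (c * q ^+ n)%:C%C) -> x = 0.
Proof.
move=> q01 hx; apply: sqn0_eq; rewrite -sqrtr_eq0 eq_le sqrtr_ge0.
rewrite andbT; apply/ler_addgt0Pr => e e0; rewrite add0r.
have [N /(_ N (leqnn N)) h] := geometric_small c q01 e0.
by rewrite -lecR -norm_sqn; apply: (le_trans (hx N)); rewrite lecR ltW.
Qed.

Lemma sqrt_csq_lt1 z : csq z < 1 -> 0 <= Num.sqrt (csq z) < 1.
Proof. by move=> h; rewrite sqrtr_ge0 -sqrtr1 ltr_sqrt. Qed.

Variables U W D Wi : {linear H -> H}.
Hypothesis UW : perturbation_of U W D Wi.

Lemma proj_idem x : D (D x) = D x. Proof. by case: UW => [[-> _]]. Qed.
Lemma proj_sym x y : rip (D x) y = rip x (D y).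
Proof. by case: UW => [[_ h] _ _ _]; rewrite /rip h. Qed.
Lemma WiK : cancel W Wi. Proof. by case: UW => _ []. Qed.
Lemma WK : cancel Wi W. Proof. by case: UW => _ []. Qed.
Lemma sqnW x : sqn (W x) = sqn x. Proof. by case: UW. Qed.
Lemma sqnWi x : sqn (Wi x) = sqn x. Proof. by rewrite -sqnW WK. Qed.
Lemma adjE x : adj U x = Wi x - D (Wi x).
Proof. by case: UW => _ _ _ [_ _ []]. Qed.
Lemma UE x : U x = W (x - D x). Proof. by case: UW => _ _ _ [_ _ []]. Qed.
Lemma defectE x : defect U x = (D x = x).
Proof. by case: UW => _ _ _ [-> _ _ _]. Qed.
Lemma defect_starE x : defect_star U x = (W (D (Wi x)) = x).
Proof. by case: UW => _ _ _ [_ -> _ _]. Qed.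
Lemma ripW x y : rip (W x) (W y) = rip x y.
Proof.
have := sqnW (x + y); rewrite linearD /= !sqnD !sqnW; lra.
Qed.

Lemma ripWi x y : rip (Wi x) (Wi y) = rip x y.
Proof. by rewrite -ripW !WK. Qed.

Lemma rip_proj_sqn x : rip x (D x) = sqn (D x).
Proof. by rewrite /sqn proj_sym proj_idem. Qed.

Lemma sqn_projC x : sqn (x - D x) = sqn x - sqn (D x).
Proof. by rewrite sqnB rip_proj_sqn; ring. Qed.

Lemma sqn_proj_le x : sqn (D x) <= sqn x.
Proof. by have := sqn_ge0 (x - D x); rewrite sqn_projC subr_ge0. Qed.

Lemma proj_adj x : D (adj U x) = 0.
Proof. by rewrite adjE linearB /= proj_idem subrr. Qed.

Lemma sqn_adj x : sqn (adj U x) = sqn x - sqn (D (Wi x)).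
Proof. by rewrite adjE sqn_projC sqnWi. Qed.

Lemma sqn_adj_le x : sqn (adj U x) <= sqn x.
Proof. by rewrite sqn_adj gerBl sqn_ge0. Qed.

Lemma adj_linear (a : C) x y : adj U (a *: x + y) = a *: adj U x + adj U y.
Proof. by rewrite !adjE linearP /= linearP /= scalerBr opprD addrACA. Qed.

Lemma iter_adj_linear k (a : C) x y :
  iter k (adj U) (a *: x + y) = a *: iter k (adj U) x + iter k (adj U) y.
Proof. by elim: k => //= k ->; rewrite adj_linear. Qed.

Lemma sqn_iter_adj_le k x : sqn (iter k (adj U) x) <= sqn x.
Proof. by elim: k => //= k; apply: le_trans; exact: sqn_adj_le. Qed.

(** Fixed-point iteration of [x |-> d + z adj x], a contraction of ratio [|z|] because [adj] does
    not increase norms. *)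
Lemma resolvent_exists z d : csq z < 1 -> exists u, u - z *: adj U u = d.
Proof.
move=> z1; have q01 := sqrt_csq_lt1 z1; set q := Num.sqrt _ in q01.
have /andP[q0 q1] := q01; have q1' : 0 < 1 - q by rewrite subr_gt0.
have cB := sqn_adj_le; have [B BE] := linear_pack adj_linear; rewrite BE in cB *.
pose s n := iter n (fun x => d + z *: B x) 0.
have cz x : `|z *: B x| <= q%:C%C * `|x|.
  have zq : `|z| = q%:C%C by exact: normc_def.
  rewrite normrZ zq ler_wpM2l ?realc_ge0 //.
  by rewrite ler_norm_sqn cB.
have [n|l hl] := @geometric_cvg _ _ s (Num.sqrt (sqn d)) q (sqrtr_ge0 _) q01.
  elim: n => [|n IH]; first by rewrite /s /= linear0 scaler0 addr0 subr0 expr0 mulr1 -norm_sqn.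
  have -> : s n.+2 - s n.+1 = z *: B (s n.+1 - s n).
    by rewrite linearB scalerBr /s /= opprD addrACA subrr add0r.
  apply: le_trans (cz _) _.
  rewrite exprS mulrCA rmorphM /= ler_wpM2l ?realc_ge0 //.
exists l; apply/eqP; rewrite -subr_eq0; apply/eqP.
apply: (@geometric_eq0 _ (2 * (Num.sqrt (sqn d) / (1 - q))) q) => // n.
(* Continuity of [B] is not invoked: the residual of the limit is bounded by the two distances to
   consecutive iterates, for every [n]. *)
have -> : l - z *: B l - d = (l - s n.+1) - z *: B (l - s n).
  rewrite linearB scalerBr /s /=; set a := z *: B l; set b := z *: B _.
  by rewrite opprB opprD !addrA subrK addrAC.
apply: (le_trans (ler_normB _ _)).
have hb : `|z *: B (l - s n)| <= `|l - s n|.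
  by apply: le_trans (cz _) _; rewrite ler_piMl // -(rmorph1 (real_complex R)) lecR ltW.
apply: le_trans (lerD (hl n.+1) (le_trans hb (hl n))) _.
rewrite -rmorphD lecR exprS.
have w0 : 0 <= Num.sqrt (sqn d) * q ^+ n / (1 - q).
  by rewrite divr_ge0 ?mulr_ge0 ?exprn_ge0 ?sqrtr_ge0 // ltW.
set c := Num.sqrt _ in w0 *.
have -> : c * (q * q ^+ n) / (1 - q) = q * (c * q ^+ n / (1 - q)) by ring.
have -> : 2 * (c / (1 - q)) * q ^+ n = 2 * (c * q ^+ n / (1 - q)) by ring.
have := ler_piMl w0 (ltW q1); lra.
Qed.

(** Pythagoras for [u = d + z adj u]: the first term is in the range of [D], the second in its
    kernel. *)
Lemma resolvent_sqn z d u : D d = d -> u - z *: adj U u = d ->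
  (1 - csq z) * sqn u = sqn d - csq z * sqn (D (Wi u)).
Proof.
move=> dd ud; have ue : u = d + z *: adj U u by rewrite -ud subrK.
have o : rip d (z *: adj U u) = 0.
  by rewrite -dd proj_sym linearZ /= proj_adj scaler0 rip0r.
have := congr1 sqn ue; rewrite sqnD o mulr0 addr0 sqnZ sqn_adj => h.
by rewrite mulrBl mul1r {1}h; ring.
Qed.

Lemma resolvent_unique z u v : csq z < 1 ->
  u - z *: adj U u = v - z *: adj U v -> u = v.
Proof.
move=> z1 h; have [B BE] := linear_pack adj_linear.
have h0 : (u - v) - z *: adj U (u - v) = 0.
  move: h; rewrite BE linearB scalerBr /= => h.
  by rewrite opprD addrACA -opprD h subrr.
have D0 : D 0 = 0 by rewrite linear0.
have := resolvent_sqn D0 h0; rewrite sqn0 sub0r => h2.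
have z1' : 0 < 1 - csq z by rewrite subr_gt0.
apply/eqP; rewrite -subr_eq0; apply/eqP; apply: sqn0_eq.
rewrite -(pmulr_rle0 _ z1') h2 oppr_le0 mulr_ge0 ?csq_ge0 ?sqn_ge0 //.
Qed.

Lemma ThetaP z d : csq z < 1 -> D d = d ->
  exists2 u, u - z *: adj U u = d & Theta U z d = z *: W (D (Wi u)).
Proof.
move=> z1 dd; exists (inv_op (fun y => y - z *: adj U y) d).
  have [u ud] := resolvent_exists d z1.
  rewrite /inv_op; set f := fun y => y - z *: adj U y.
  have := @pinvK _ _ (fun=> 0) setT f d; by apply; apply/mem_set; exists u.
rewrite /Theta; case: UW => _ _ _ [_ _ _ -> ->]; rewrite dd UE dd subrr linear0.
by rewrite oppr0 add0r.
Qed.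

Lemma Theta_linear z (a : C) x y : csq z < 1 -> D x = x -> D y = y ->
  Theta U z (a *: x + y) = a *: Theta U z x + Theta U z y.
Proof.
move=> z1 dx dy; have [u ux ->] := ThetaP z1 dx; have [v vy ->] := ThetaP z1 dy.
have [|w wxy ->] := @ThetaP z (a *: x + y) z1; first by rewrite linearP dx dy.
have -> : w = a *: u + v.
  apply: (@resolvent_unique z) => //; rewrite wxy -ux -vy adj_linear.
  by rewrite scalerBr scalerDr opprD addrACA !scalerA (mulrC a).
by do 3 rewrite linearP /=; rewrite scalerDr !scalerA mulrC.
Qed.

(** This trades the resolvent of the contraction for that of the unitary [W]: adding back the [D]
    part of [Wi u] gives [u = (1 - z W^-1)^-1 c] with [c] still a defect vector. In the spectral
    representation the right-hand side becomes a Poisson integral. *)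
Lemma sqn_Theta z d : csq z < 1 -> D d = d -> exists u c,
  [/\ D c = c, sqn c <= 4 * sqn d, u - z *: Wi u = c &
      sqn d - sqn (Theta U z d) = (1 - csq z) * sqn u].
Proof.
move=> z1 dd; have [u ud ->] := ThetaP z1 dd.
exists u, (d - z *: D (Wi u)).
have hs := resolvent_sqn dd ud.
have h0 : 0 <= (1 - csq z) * sqn u by rewrite mulr_ge0 ?sqn_ge0 // subr_ge0 ltW.
split.
- by rewrite linearB linearZ /= proj_idem dd.
- have := sqnD_le d (- (z *: D (Wi u))); rewrite sqnN sqnZ => h; lra.
- by rewrite -ud adjE scalerBr opprB addrA addrAC addrK.
- by rewrite sqnZ sqnW hs.
Qed.

Lemma sqn_Theta_le z d : csq z < 1 -> D d = d -> sqn (Theta U z d) <= sqn d.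
Proof.
move=> z1 dd; have [u [c [_ _ _ h]]] := sqn_Theta z1 dd.
by rewrite -subr_ge0 h mulr_ge0 ?sqn_ge0 // subr_ge0 ltW.
Qed.

Lemma Theta_defect_star z d : csq z < 1 -> D d = d -> defect_star U (Theta U z d).
Proof.
move=> z1 dd; have [u _ ->] := ThetaP z1 dd; rewrite defect_starE.
by rewrite !linearZ /= WiK proj_idem.
Qed.

Definition Theta_coef d k : H :=
  if k is k'.+1 then W (D (Wi (iter k' (adj U) d))) else 0.

Lemma sum_sqn_Theta_coef d N :
  \sum_(k < N.+1) sqn (Theta_coef d k) = sqn d - sqn (iter N (adj U) d).
Proof.
rewrite big_ord_recl /= sqn0 add0r.
elim: N => [|N IH]; first by rewrite big_ord0 /= subrr.
by rewrite big_ord_recr /= IH sqnW sqn_adj; lra.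
Qed.

Lemma sum_sqn_Theta_coef_le d N : \sum_(k < N) sqn (Theta_coef d k) <= sqn d.
Proof.
case: N => [|N]; first by rewrite big_ord0 sqn_ge0.
by rewrite sum_sqn_Theta_coef gerBl sqn_ge0.
Qed.

(** Expanding the resolvent [N] times leaves the exact remainder [z^(N+1) W D Wi adj^N u], and
    [(1 - |z|^2) |u|^2 <= |d|^2] by [resolvent_sqn]. *)
Lemma Theta_series z d N : csq z < 1 -> D d = d ->
  sqn (Theta U z d - \sum_(k < N.+1) z ^+ k *: Theta_coef d k)
    <= csq z ^+ N.+1 / (1 - csq z) * sqn d.
Proof.
move=> z1 dd; have [u ud ->] := ThetaP z1 dd.
have uN : u = \sum_(k < N) z ^+ k *: iter k (adj U) d + z ^+ N *: iter N (adj U) u.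
  elim: N => [|N IH]; first by rewrite big_ord0 add0r expr0 scale1r.
  rewrite big_ord_recr /= {1}IH -addrA; congr (_ + _).
  set v := iter N (adj U) u.
  have {1}-> : v = iter N (adj U) d + z *: adj U v.
    have := iter_adj_linear N z (adj U u) d.
    have -> : z *: adj U u + d = u by rewrite -ud addrC subrK.
    by move=> h; rewrite {1}/v h addrC -iterSr.
  by rewrite scalerDr scalerA exprSr.
have -> : z *: W (D (Wi u)) - \sum_(k < N.+1) z ^+ k *: Theta_coef d k =
    z ^+ N.+1 *: W (D (Wi (iter N (adj U) u))).
  have [L LE] : exists L : {linear H -> H}, (fun x => W (D (Wi x))) = L.
    by apply: linear_pack => a x y; do 3 rewrite linearP /=.
  have {LE} LE x : W (D (Wi x)) = L x by rewrite -LE.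
  rewrite big_ord_recl /= scaler0 add0r.
  rewrite (eq_bigr (fun k : 'I_N => z *: L (z ^+ k *: iter k (adj U) d))); last first.
    by move=> k _; rewrite linearZ /= scalerA -exprS LE.
  rewrite -scaler_sumr -linear_sum !LE -scalerBr -linearB {1}uN addrAC subrr add0r.
  by rewrite linearZ /= scalerA exprS.
rewrite sqnZ sqnW csqX -mulrA ler_wpM2l ?exprn_ge0 ?csq_ge0 //.
apply: (le_trans (sqn_proj_le _)); rewrite sqnWi (le_trans (sqn_iter_adj_le _ _)) //.
rewrite mulrC ler_pdivlMr ?subr_gt0 // mulrC (resolvent_sqn dd ud).
by rewrite gerBl mulr_ge0 ?csq_ge0 ?sqn_ge0.
Qed.

Lemma Theta_series_cvg d (rho e : R) : 0 <= rho < 1 -> 0 < e -> D d = d ->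
  exists N, forall n z, (N <= n)%N -> csq z = rho ->
    `|Theta U z d - \sum_(k < n.+1) z ^+ k *: Theta_coef d k| <= e%:C%C.
Proof.
move=> rho01 e0 dd; have e20 : 0 < e ^+ 2 by rewrite exprn_gt0.
have [N hN] := geometric_small (sqn d / (1 - rho)) rho01 e20.
exists N => n z Nn zr; have z1 : csq z < 1 by rewrite zr; case/andP: rho01.
rewrite ler_norm_real ?(ltW e0) //; apply: le_trans (Theta_series n z1 dd) _.
by rewrite zr mulrAC -mulrA mulrC ltW // hN // leqW.
Qed.

End perturbation_theory.

(** * Vector-valued trigonometric polynomials and Poisson kernels *)

Section trigonometric_polynomials.
Context {R : realType}.
Local Notation C := R[i].
Local Notation mu := (@lebesgue_measure R).
Implicit Types (t a : R) (f : R -> R).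

Definition cis t : C := Complex (cos t) (sin t).

Lemma csq_cis t : csq (cis t) = 1. Proof. by rewrite /csq /= cos2Dsin2. Qed.

Lemma cisD t a : cis (t + a) = cis t * cis a.
Proof. by apply/eqP; rewrite eq_complex /= cosD sinD addrC eqxx /= addrC (mulrC (sin t)) (mulrC (cos t)) eqxx. Qed.

Lemma cisX t m : cis t ^+ m = cis (m%:R * t).
Proof.
elim: m => [|m IH]; last by rewrite exprSr IH -cisD -natr1 mulrDl mul1r.
by rewrite mul0r expr0 /cis cos0 sin0.
Qed.

Lemma cis_periodic t : cis (t + 2 * pi) = cis t.
Proof.
rewrite cisD; have -> : cis (2 * pi) = 1; last by rewrite mulr1.
by rewrite /cis mulr2n mulrDl mul1r -mulr2n cos2pi sin2pi.
Qed.

(** Says that [f] has integral [c] over every period, through a primitive. This form is stable under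
    finite sums and needs integration only once, by the fundamental theorem of calculus. *)
Definition periodic_primitive f (c : R) : Prop :=
  continuous f /\ exists F : R -> R,
    (forall t, is_derive t (1 : R) F (f t)) /\ forall t, F (t + 2 * pi) - F t = c.

Lemma periodic_primitive_cst (c : R) : periodic_primitive (cst c) (2 * pi * c).
Proof.
split; first by move=> t; exact: cvg_cst.
exists (fun t => t * c); split=> [t|t]; last by rewrite mulrDl; ring.
have -> : (fun t => t * c) = c \*: (@id R).
  by apply/funext => s; rewrite /= mulrC.
by apply: is_derive_eq; rewrite /= /GRing.scale /= mulr1.
Qed.

Lemma periodic_primitiveD f g (c d : R) : periodic_primitive f c ->
  periodic_primitive g d -> periodic_primitive (fun t => f t + g t) (c + d).
Proof.
move=> [cf [F [dF pF]]] [cg [G [dG pG]]]; split.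
  by move=> t; apply: cvgD; [exact: cf|exact: cg].
exists (F \+ G); split=> t; first exact: is_deriveD.
by rewrite -(pF t) -(pG t) /=; ring.
Qed.

Lemma periodic_primitive_sum (I : Type) (s : seq I) (f : I -> R -> R) (c : I -> R) :
  (forall i, periodic_primitive (f i) (c i)) ->
  periodic_primitive (fun t => \sum_(i <- s) f i t) (\sum_(i <- s) c i).
Proof.
move=> h; elim: s => [|i s IH].
  rewrite big_nil (_ : (fun t => _) = cst 0).
    by have := periodic_primitive_cst (0 : R); rewrite mulr0.
  by apply/funext => t; rewrite big_nil.
rewrite big_cons (_ : (fun t => _) = fun t => f i t + \sum_(j <- s) f j t).
  exact: periodic_primitiveD.
by apply/funext => t; rewrite big_cons.
Qed.

Lemma periodic_primitive_cos (p q : R) m : (0 < m)%N ->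
  periodic_primitive (fun t => p * cos (m%:R * t) + q * sin (m%:R * t)) 0.
Proof.
move=> m0; have mR : (m%:R : R) != 0 by rewrite pnatr_eq0 -lt0n.
have dm t : is_derive t (1 : R) (fun s => m%:R * s : R) m%:R.
  have -> : (fun s => m%:R * s) = m%:R \*: (@id R) by [].
  by apply: is_derive_eq; rewrite /= /GRing.scale /= mulr1.
have dc t : is_derive t (1 : R) (fun s => cos (m%:R * s)) (- sin (m%:R * t) * m%:R).
  exact: (is_derive1_comp (is_derive_cos _) (dm t)).
have ds t : is_derive t (1 : R) (fun s => sin (m%:R * s)) (cos (m%:R * t) * m%:R).
  exact: (is_derive1_comp (is_derive_sin _) (dm t)).
have cc : continuous (fun s : R => cos (m%:R * s) : R).
  by move=> t; apply: differentiable_continuous; apply/derivable1_diffP; case: (dc t).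
have cs : continuous (fun s : R => sin (m%:R * s) : R).
  by move=> t; apply: differentiable_continuous; apply/derivable1_diffP; case: (ds t).
split.
  move=> t; apply: cvgD; apply: cvgM; try exact: cvg_cst; [exact: cc|exact: cs].
exists ((p / m%:R) \*: (fun s => sin (m%:R * s)) \+ (- (q / m%:R)) \*: (fun s => cos (m%:R * s))).
split=> t.
  by apply: is_derive_eq; rewrite /= /GRing.scale /=; field.
have := congr1 (@Im R) (cisX (t + 2 * pi) m); have := congr1 (@Re R) (cisX (t + 2 * pi) m).
by rewrite cis_periodic cisX /= => -> ->; rewrite subrr.
Qed.

Lemma integral_periodic_primitive f (c a : R) : periodic_primitive f c ->
  (\int[mu]_(t in `[a, (a + 2 * pi)%R]) (f t)%:E)%E = c%:E.
Proof.
move=> [cf [F [dF pF]]].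
have cF : continuous F.
  by move=> t; apply: differentiable_continuous; apply/derivable1_diffP; case: (dF t).
rewrite (@continuous_FTC2 _ f F).
- by rewrite -EFinB pF.
- by rewrite ltrDl mulr_gt0 // pi_gt0.
- exact: continuous_subspaceT.
- split; first by move=> x _; case: (dF x).
  + by apply: cvg_at_right_filter; exact: cF.
  + by apply: cvg_at_left_filter; exact: cF.
- by move=> x _; rewrite derive1E; exact: derive_val.
Qed.

End trigonometric_polynomials.

Section parseval.
Context {R : realType} {H : hilbertType R}.
Local Notation C := R[i].
Local Notation mu := (@lebesgue_measure R).
Implicit Types (h : nat -> H) (t a : R) (z : C).

Definition hpoly h N z : H := \sum_(k < N) z ^+ k *: h k.

Lemma rip_cis (x y : H) t j m :
  rip (cis t ^+ j *: x) (cis t ^+ (j + m) *: y) =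
  Re (inner x y) * cos (m%:R * t) + Im (inner x y) * sin (m%:R * t).
Proof.
rewrite /rip innerZl innerZr exprD rmorphM /= mulrA.
rewrite [X in X * _](_ : _ = (cis t ^+ m)^*%C); last first.
  rewrite mulrA -[RHS]mul1r; congr (_ * _).
  by rewrite -sqr_normc -csqE csqX csq_cis expr1n.
by rewrite cisX; case: (inner x y) => p q /=; ring.
Qed.

(** Parseval before integration: expanding the square, the only terms of zero frequency are the
    [sqn (h k)]. *)
Lemma periodic_primitive_hpoly h N :
  periodic_primitive (fun t => sqn (hpoly h N (cis t)))
    (2 * pi * \sum_(k < N) sqn (h k)).
Proof.
elim: N => [|N IH].
  rewrite big_ord0 (_ : (fun t => _) = cst 0).
    exact: periodic_primitive_cst.
  by apply/funext => t; rewrite /hpoly big_ord0 sqn0.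
(* For [k < N] the frequency is positive and the mean vanishes. The other branch, where truncated
   subtraction gives frequency 0, only makes the claim hold for every natural [k]. *)
have hN k : periodic_primitive (fun t => 2 * Re (inner (h k) (h N)) * cos ((N - k)%:R * t) +
    2 * Im (inner (h k) (h N)) * sin ((N - k)%:R * t)) (if (k < N)%N then 0 else 2 * pi * (2 * Re (inner (h k) (h N)))).
  case: ifPn => kN; first by apply: periodic_primitive_cos; rewrite subn_gt0.
  rewrite -leqNgt -subn_eq0 in kN; rewrite (eqP kN).
  rewrite (_ : (fun t => _) = cst (2 * Re (inner (h k) (h N)))); first exact: periodic_primitive_cst.
  by apply/funext => t; rewrite mul0r cos0 sin0 mulr1 mulr0 addr0.
have hs := periodic_primitive_sum (index_enum 'I_N) (fun k : 'I_N => hN k).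
have := periodic_primitiveD (periodic_primitiveD IH hs) (periodic_primitive_cst (sqn (h N))).
rewrite (_ : (fun t => _) = fun t => sqn (hpoly h N.+1 (cis t))).
  rewrite [X in _ + X + _]big1 => [|k _]; last by rewrite ltn_ord.
  by rewrite addr0 -mulrDr [in X in _ -> X]big_ord_recr.
apply/funext => t; rewrite /hpoly big_ord_recr /= sqnD sqnZ csqX csq_cis expr1n mul1r.
congr (_ + _ + _); rewrite rip_suml mulr_sumr; apply: eq_bigr => k _.
by have := rip_cis (h k) (h N) t k (N - k); rewrite subnKC ?(ltnW (ltn_ord k)) // => ->; ring.
Qed.

Lemma continuous_sqn_hpoly h N : continuous (fun t => sqn (hpoly h N (cis t))).
Proof. by case: (periodic_primitive_hpoly h N). Qed.

Lemma parseval h N a :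
  (\int[mu]_(t in `[a, (a + 2 * pi)%R]) (sqn (hpoly h N (cis t)))%:E)%E =
  (2 * pi * \sum_(k < N) sqn (h k))%:E.
Proof. exact/integral_periodic_primitive/periodic_primitive_hpoly. Qed.

End parseval.

Section real_integrals.
Context d (T : measurableType d) {R : realType}.
Variable m : {measure set T -> \bar R}.
Implicit Types (f g : T -> R) (D : set T).

Lemma ge0_le_integral_fin D f g : measurable D -> measurable_fun D f ->
  measurable_fun D g -> (forall x, D x -> 0 <= f x <= g x) ->
  (\int[m]_(x in D) (f x)%:E <= \int[m]_(x in D) (g x)%:E)%E.
Proof.
move=> mD mf mg fg; apply: ge0_le_integral => //.
- by move=> x /fg /andP[]; rewrite lee_fin.
- exact/measurable_EFinP.
- exact/measurable_EFinP.
- by move=> x /fg /andP[]; rewrite lee_fin.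
Qed.

Lemma ge0_integralZ_fin D f (k : R) : measurable D -> measurable_fun D f ->
  (forall x, D x -> 0 <= f x) -> 0 <= k ->
  (\int[m]_(x in D) (k * f x)%:E = k%:E * \int[m]_(x in D) (f x)%:E)%E.
Proof.
move=> mD mf f0 k0; under eq_integral do rewrite EFinM.
by rewrite ge0_integralZl_EFin //; exact/measurable_EFinP.
Qed.

End real_integrals.

(** * Poisson kernel bounds from truncated Cauchy kernels *)

Section poisson.
Context {R : realType} {H : hilbertType R}.
Local Notation C := R[i].
Local Notation mu := (@lebesgue_measure R).
Implicit Types (h c : nat -> H) (t a : R) (z w : C).

Definition is_hpoly (f : C -> H) : Prop := exists c L, forall z, f z = hpoly c L z.

Lemma is_hpoly_ext f g : f =1 g -> is_hpoly f -> is_hpoly g.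
Proof. by move=> fg [c [L h]]; exists c, L => z; rewrite -fg h. Qed.

Lemma is_hpolyX f : is_hpoly f -> is_hpoly (fun z => z *: f z).
Proof.
move=> [c [L h]]; exists (fun k => if k is k'.+1 then c k' else 0), L.+1 => z.
rewrite h /hpoly big_ord_recl scaler0 add0r scaler_sumr.
by apply: eq_bigr => k _; rewrite scalerA -exprS.
Qed.

Lemma is_hpolyZ f w : is_hpoly f -> is_hpoly (fun z => w *: f z).
Proof.
move=> [c [L h]]; exists (fun k => w *: c k), L => z.
by rewrite h /hpoly scaler_sumr; apply: eq_bigr => k _; rewrite !scalerA mulrC.
Qed.

Lemma hpoly_pad c L n z : hpoly (fun k => if (k < L)%N then c k else 0) (L + n) z = hpoly c L z.
Proof.
rewrite /hpoly big_split_ord /= [X in _ + X]big1 ?addr0.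
  by apply: eq_bigr => k _; rewrite ltn_ord.
by move=> k _; rewrite ltnNge leq_addr scaler0.
Qed.

Lemma is_hpolyD f g : is_hpoly f -> is_hpoly g -> is_hpoly (fun z => f z + g z).
Proof.
move=> [c [L h]] [c' [L' h']].
exists (fun k => (if (k < L)%N then c k else 0) + (if (k < L')%N then c' k else 0)), (L + L')%N.
move=> z; rewrite h h' -(hpoly_pad c L L') -(hpoly_pad c' L' L) (addnC L' L).
by rewrite /hpoly -big_split; apply: eq_bigr => k _; rewrite scalerDr.
Qed.

(** A finite geometric sum keeps the product polynomial, so Parseval applies without infinite
    series. The induction uses [S_(M+1) = 1 + (w z) S_M]. *)
Lemma is_hpoly_cauchy_kernel c L w M :
  is_hpoly (fun z => (\sum_(j < M) (w * z) ^+ j) *: hpoly c L z).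
Proof.
elim: M => [|M IH].
  by exists c, 0%N => z; rewrite big_ord0 scale0r /hpoly big_ord0.
have h : is_hpoly (hpoly c L) by exists c, L.
apply: is_hpoly_ext (is_hpolyD h (is_hpolyZ w (is_hpolyX IH))) => z.
rewrite !scalerA -{1}(scale1r (hpoly c L z)) -scalerDl; congr (_ *: _).
rewrite big_ord_recl expr0 mulr_sumr; congr (_ + _).
by apply: eq_bigr => k _; rewrite exprS.
Qed.

Lemma sum_geometric_mul (F : fieldType) (x : F) M :
  (1 - x) * \sum_(j < M) x ^+ j = 1 - x ^+ M.
Proof. by rewrite -[1 - x ^+ M]opprB subrX1 -mulNr opprB. Qed.

Lemma sum_geometric_le (rho : R) M : 0 <= rho < 1 ->
  \sum_(j < M) rho ^+ j <= (1 - rho)^-1.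
Proof.
move=> /andP[r0 r1]; rewrite -[leRHS]mul1r ler_pdivlMr ?subr_gt0 //.
by rewrite mulrC sum_geometric_mul gerBl exprn_ge0.
Qed.

(** [|z| <= 1/2] puts [|1 - z|] between [1/2] and [3/2]. It is applied to [z = (w xi)^M], the
    numerator of the truncated kernel. *)
Lemma csq_1B_bounds z : csq z <= 4^-1 -> 4^-1 <= csq (1 - z) <= 9 / 4.
Proof.
case: z => x y; rewrite /csq /= sub0r sqrrN => h.
have y0 := sqr_ge0 y.
have x2 : x ^+ 2 <= (2^-1) ^+ 2.
  have -> : (2^-1 : R) ^+ 2 = 4^-1 by field.
  lra.
have : `|x| <= 2^-1 by rewrite -ler_sqr ?nnegrE ?normr_ge0 ?invr_ge0 // real_normK ?num_real.
rewrite ler_norml => /andP[xl xu].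
have e : (1 - x) ^+ 2 = 1 - 2 * x + x ^+ 2 by ring.
apply/andP; split; last by rewrite e; lra.
have : 0 <= (2^-1 - x) * (3 / 2 - x) by rewrite mulr_ge0; lra.
have -> : (2^-1 - x) * (3 / 2 - x) = (1 - x) ^+ 2 - 4^-1 by field.
lra.
Qed.

Lemma csq_expr_small z : csq z < 1 -> exists2 M, (0 < M)%N & csq z ^+ M <= 4^-1.
Proof.
move=> z1.
have z01 : 0 <= csq z < 1 by rewrite csq_ge0.
have [|M /(_ M.+1 (leqnSn M))] := @geometric_small R 1 (csq z) 4^-1 z01; first by rewrite invr_gt0.
by rewrite mul1r => /ltW h; exists M.+1.
Qed.

Definition poisson z t : R := (1 - csq z) / csq (cis t - z).

Lemma csq_cisB_gt0 z t : csq z < 1 -> 0 < csq (cis t - z).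
Proof.
move=> z1; rewrite lt_neqAle csq_ge0 eq_sym csq_eq0 subr_eq0 andbT.
by apply: contraTneq z1 => <-; rewrite csq_cis ltxx.
Qed.

(** On the circle the denominators of the Cauchy and Poisson kernels have the same modulus. *)
Lemma csq_cis_conj z t : csq (1 - z^*%C * cis t) = csq (cis t - z).
Proof.
rewrite -[LHS]mul1r -{1}(csq_cis t) -csqJ -csqM mulrBr mulr1 -[RHS]csqJ.
rewrite rmorphB /=; congr (csq (_ - _)).
by rewrite mulrCA -(mulrC (cis t)) -sqr_normc -csqE csq_cis mulr1.
Qed.

Lemma poisson_ge0 z t : csq z < 1 -> 0 <= poisson z t.
Proof. by move=> z1; rewrite divr_ge0 ?csq_ge0 // subr_ge0 ltW. Qed.

Lemma continuous_csq_cisB z : continuous (fun t : R => csq (cis t - z)).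
Proof.
have -> : (fun t : R => csq (cis t - z)) = fun t => (cos t - Re z) * (cos t - Re z) +
    (sin t - Im z) * (sin t - Im z).
  by apply/funext => s; case: z => p q; rewrite /csq /= !expr2.
have cc : continuous (fun t : R => cos t - Re z).
  by move=> t; apply: cvgB; [exact: continuous_cos|exact: cvg_cst].
have cs : continuous (fun t : R => sin t - Im z).
  by move=> t; apply: cvgB; [exact: continuous_sin|exact: cvg_cst].
by move=> t; apply: cvgD; apply: cvgM; solve [exact: cc|exact: cs].
Qed.

Lemma continuous_poisson z : csq z < 1 -> continuous (poisson z).
Proof.
move=> z1 t; apply: cvgM; first exact: cvg_cst.
apply: cvgV; last exact: continuous_csq_cisB.
by rewrite gt_eqF // csq_cisB_gt0.
Qed.

Lemma measurable_poisson z D : csq z < 1 -> measurable_fun D (poisson z).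
Proof.
move=> z1; apply: measurable_funTS; apply: continuous_measurable_fun.
exact: continuous_poisson.
Qed.

Lemma measurable_sqn_hpoly h N D :
  measurable_fun D (fun t => sqn (hpoly h N (cis t))).
Proof.
apply: measurable_funTS; apply: continuous_measurable_fun.
exact: continuous_sqn_hpoly.
Qed.

(* Parseval for [(1 - w^M xi^M) / (1 - w xi) q(xi)], with [w] the conjugate of
   [z]: the truncated Cauchy kernel reproduces [q(z)] up to a bounded factor. *)
Lemma sqn_hpoly_poisson h N z a : csq z < 1 ->
  ((sqn (hpoly h N z))%:E <= (2 / pi)%:E *
    \int[mu]_(t in `[a, (a + 2 * pi)%R]) (poisson z t * sqn (hpoly h N (cis t)))%:E)%E.
Proof.
move=> z1; have [M M0 hM] := csq_expr_small z1.
set w := z^*%C; have [c [L hc]] := is_hpoly_cauchy_kernel h N w M.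
set rho := csq z in z1 hM *.
have r0 : 0 <= rho by exact: csq_ge0.
have r1 : 0 < 1 - rho by rewrite subr_gt0.
have wz : w * z = rho%:C%C by rewrite mulrC -sqr_normc -csqE.
have cwX xi : csq xi = 1 -> csq ((w * xi) ^+ M) <= 4^-1.
  by move=> x1; rewrite csqX csqM x1 mulr1 csqJ.
have gE xi : csq (1 - w * xi) * csq (\sum_(j < M) (w * xi) ^+ j) = csq (1 - (w * xi) ^+ M).
  by rewrite -csqM sum_geometric_mul.
have up t : sqn (hpoly c L (cis t)) <= (9 / 4) / (1 - rho) * (poisson z t * sqn (hpoly h N (cis t))).
  rewrite -hc sqnZ mulrA ler_wpM2r ?sqn_ge0 // /poisson -/rho.
  rewrite mulrA mulfVK ?gt_eqF //.
  rewrite ler_pdivlMr ?csq_cisB_gt0 // mulrC -csq_cis_conj gE.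
  by have /andP[] := csq_1B_bounds (cwX _ (csq_cis t)).
(* At [z] the kernel equals [(1 - rho^M) / (1 - rho)] with [1 - rho^M >= 3/4]; Cauchy-Schwarz bounds
   the value of the product polynomial by its coefficients and the sum of the [rho^i]. *)
have low : (9 / 16) * sqn (hpoly h N z) <= (1 - rho) * \sum_(k < L) sqn (c k).
  have := sqn_lincomb_le (fun k : 'I_L => z ^+ k) (fun k => c k).
  rewrite -/(hpoly c L z) -hc sqnZ wz => hcs.
  have g2 : csq (\sum_(j < M) rho%:C%C ^+ j) * (1 - rho) ^+ 2 = (1 - rho ^+ M) ^+ 2.
    by rewrite -(csq_real (1 - rho)) mulrC -csqM rmorphB /= sum_geometric_mul -rmorphXn -rmorphB csq_real.
  have r2 : \sum_(i < L) csq (z ^+ i) <= (1 - rho)^-1.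
    rewrite (eq_bigr (fun i : 'I_L => rho ^+ i)) => [|i _]; last by rewrite csqX.
    by apply: sum_geometric_le; rewrite r0 -subr_gt0.
  set S := \sum_(k < L) sqn (c k) in hcs *.
  have S0 : 0 <= S by apply: sumr_ge0 => i _; exact: sqn_ge0.
  have : csq (\sum_(j < M) rho%:C%C ^+ j) * sqn (hpoly h N z) * (1 - rho) ^+ 2 <= (1 - rho)^-1 * S * (1 - rho) ^+ 2.
    by rewrite ler_wpM2r ?sqr_ge0 // (le_trans hcs) // ler_wpM2r.
  have -> : (1 - rho)^-1 * S * (1 - rho) ^+ 2 = (1 - rho) * S by field; rewrite gt_eqF.
  rewrite mulrAC g2.
  apply: le_trans; rewrite ler_wpM2r ?sqn_ge0 //.
  have rM : 0 <= rho ^+ M by rewrite exprn_ge0.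
  have : 0 <= (4^-1 - rho ^+ M) * (7 / 4 - rho ^+ M) by rewrite mulr_ge0; lra.
  have -> : (4^-1 - rho ^+ M) * (7 / 4 - rho ^+ M) = (1 - rho ^+ M) ^+ 2 - 9 / 16 by field.
  lra.
have pi0 : (0 : R) < pi by exact: pi_gt0.
have mP : measurable_fun `[a, a + 2 * pi] (fun t => poisson z t * sqn (hpoly h N (cis t))).
  by apply: measurable_funM; [exact: measurable_poisson|exact: measurable_sqn_hpoly].
have P0 t : 0 <= poisson z t * sqn (hpoly h N (cis t)).
  by rewrite mulr_ge0 ?sqn_ge0 ?poisson_ge0.
have k0 : 0 <= 9 / 4 / (1 - rho) by rewrite divr_ge0 ?(ltW r1) //; lra.
have hI : (\int[mu]_(t in `[a, (a + 2 * pi)%R]) (sqn (hpoly c L (cis t)))%:E <=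
    \int[mu]_(t in `[a, (a + 2 * pi)%R])
      (9 / 4 / (1 - rho) * (poisson z t * sqn (hpoly h N (cis t))))%:E)%E.
  apply: ge0_le_integral_fin => //; first exact: measurable_sqn_hpoly.
    exact: measurable_funM.
  by move=> t _; rewrite sqn_ge0 up.
rewrite parseval ge0_integralZ_fin // in hI.
have rn : 1 - rho != 0 by rewrite gt_eqF.
have pn : (pi : R) != 0 by rewrite gt_eqF.
have e0 : 0 <= 16 / 9 * (1 - rho) / (2 * pi) by rewrite divr_ge0 ?mulr_ge0 ?(ltW r1) ?(ltW pi0) //; lra.
(* This factor undoes [9/16] from [low] and [2 * pi] from Parseval; with the [9/4] of [up] it leaves
   [2 / pi]. *)
have := lee_wpmul2l (_ : (0 <= (16 / 9 * (1 - rho) / (2 * pi))%:E)%E) hI.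
rewrite lee_fin muleA -!EFinM => /(_ e0).
have -> : 16 / 9 * (1 - rho) / (2 * pi) * (9 / 4 / (1 - rho)) = 2 / pi.
  by move: rn pn; move: (1 - rho) (pi : R) => X p X0 p0; field; rewrite X0 p0.
apply: le_trans; rewrite lee_fin.
have -> : 16 / 9 * (1 - rho) / (2 * pi) * (2 * pi * \sum_(k < L) sqn (c k)) =
   16 / 9 * ((1 - rho) * \sum_(k < L) sqn (c k)).
  by move: pn; move: (1 - rho) (pi : R) (\sum_(k < L) _) => X p S p0; field.
lra.
Qed.

(** The kernel is at most [4 (1 - rho)] times the squared modulus of a truncated Cauchy kernel. The
    vector [v] carries this scalar polynomial into [H], where Parseval is available. *)
Lemma integral_poisson_le z a (v : H) : v != 0 -> csq z < 1 ->
  (\int[mu]_(t in `[a, (a + 2 * pi)%R]) (poisson z t)%:E <= (8 * pi)%:E)%E.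
Proof.
move=> v0 z1; have [M M0 hM] := csq_expr_small z1.
have nv : 0 < sqn v by rewrite lt_neqAle sqn_ge0 eq_sym sqn_eq0 v0.
have pi0 : (0 : R) < pi by exact: pi_gt0.
set w := z^*%C; set rho := csq z in z1 hM *.
have r0 : 0 <= rho by exact: csq_ge0.
have r1 : 0 < 1 - rho by rewrite subr_gt0.
pose c (k : nat) := w ^+ k *: v.
have cE xi : hpoly c M xi = (\sum_(j < M) (w * xi) ^+ j) *: v.
  rewrite /hpoly scaler_suml; apply: eq_bigr => k _.
  by rewrite scalerA mulrC exprMn.
have up t : poisson z t <= 4 * (1 - rho) / sqn v * sqn (hpoly c M (cis t)).
  have -> : 4 * (1 - rho) / sqn v * sqn (hpoly c M (cis t)) =
     4 * (1 - rho) * csq (\sum_(j < M) (w * cis t) ^+ j).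
    by rewrite cE sqnZ (mulrC (csq _)) mulrA mulfVK ?gt_eqF.
  rewrite ler_pdivrMr ?csq_cisB_gt0 // -csq_cis_conj -/w -(mulrA (4 * (1 - rho))) -csqM.
  rewrite (mulrC (\sum_(_ | _) _)) sum_geometric_mul mulrAC ler_peMl ?(ltW r1) //.
  have /csq_1B_bounds /andP[h _] : csq ((w * cis t) ^+ M) <= 4^-1.
    by rewrite csqX csqM csq_cis mulr1 csqJ.
  lra.
have : (\int[mu]_(t in `[a, (a + 2 * pi)%R]) (poisson z t)%:E <=
    \int[mu]_(t in `[a, (a + 2 * pi)%R])
      (4 * (1 - rho) / sqn v * sqn (hpoly c M (cis t)))%:E)%E.
  apply: ge0_le_integral_fin => //; first exact: measurable_poisson.
    by apply: measurable_funM => //; exact: measurable_sqn_hpoly.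
  by move=> t _; rewrite poisson_ge0 // up.
rewrite [leRHS]ge0_integralZ_fin //; first last.
- by rewrite divr_ge0 ?(ltW nv) // mulr_ge0 ?(ltW r1).
- by move=> t _; exact: sqn_ge0.
- exact: measurable_sqn_hpoly.
rewrite parseval -EFinM => /le_trans; apply; rewrite lee_fin.
rewrite (eq_bigr (fun k : 'I_M => rho ^+ k * sqn v)) => [|k _]; last first.
  by rewrite /c sqnZ csqX csqJ.
rewrite -mulr_suml.
have -> : 4 * (1 - rho) / sqn v * (2 * pi * ((\sum_(i < M) rho ^+ i) * sqn v)) =
   8 * pi * ((1 - rho) * \sum_(i < M) rho ^+ i).
  by move: nv; move: (1 - rho) (pi : R) (\sum_(k < M) _) (sqn v) => X p S x x0; field; rewrite gt_eqF.
rewrite sum_geometric_mul ler_piMr ?mulr_ge0 ?(ltW pi0) //.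
by rewrite gerBl exprn_ge0.
Qed.

End poisson.

(** * Nontangential limits of square summable power series *)

Section complex_modulus.
Context {R : realType}.
Implicit Types z w : R[i].

Definition cabs z : R := Num.sqrt (csq z).

Lemma cabs_ge0 z : 0 <= cabs z. Proof. exact: sqrtr_ge0. Qed.

Lemma sqr_cabs z : cabs z ^+ 2 = csq z.
Proof. by rewrite sqr_sqrtr ?csq_ge0. Qed.

Lemma cabsE z : `|z| = (cabs z)%:C%C. Proof. exact: normc_def. Qed.

Lemma cabsD z w : cabs (z + w) <= cabs z + cabs w.
Proof. by rewrite -lecR rmorphD /= -!cabsE ler_normD. Qed.

Lemma cabsBC z w : cabs (z - w) = cabs (w - z).
Proof. by rewrite /cabs -csqN opprB. Qed.

Lemma cabs_cis t : cabs (cis t : R[i]) = 1.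
Proof. by rewrite /cabs csq_cis sqrtr1. Qed.

Lemma cabs_lt1 z : (cabs z < 1) = (csq z < 1).
Proof. by rewrite -sqr_cabs expr_lt1 ?cabs_ge0. Qed.

End complex_modulus.

Section sine_bound.
Context {R : realType}.
Implicit Types x : R.

Lemma sin_le_id x : 0 <= x -> sin x <= x.
Proof.
move=> x0.
have [|c _] := @MVT_segment R sin cos 0 x x0 (fun y _ => is_derive_sin y).
  by apply: continuous_subspaceT => y; exact: continuous_sin.
by rewrite sin0 !subr0 => ->; rewrite ler_piMl // cos_le1.
Qed.

Lemma cos_half x : cos x = 2 * cos (x / 2) ^+ 2 - 1.
Proof.
have {1}-> : x = (x / 2) *+ 2 by rewrite -mulr_natr mulfVK.
by rewrite cos_mulr2n mulr_natl.
Qed.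

(** On [[0, 1]] the mean value theorem with [cos >= 1/2] gives [sin x >= x / 2]. Beyond 1,
    monotonicity gives [sin x >= 1/2], while [x / 4 < 1/2] since [pi / 2 < 2]. *)
Lemma sin_lower x : 0 <= x <= pi / 2 -> x / 4 <= sin x.
Proof.
move=> /andP[x0 xpi]; have p2 := @pihalf_lt2 R.
have small (y : R) : 0 <= y <= 1 -> y / 2 <= sin y.
  move=> /andP[y0 y1].
  have [|c] := @MVT_segment R sin cos 0 y y0 (fun y _ => is_derive_sin y).
    by apply: continuous_subspaceT => u; exact: continuous_sin.
  rewrite in_itv /= sin0 !subr0 => /andP[c0 cy] ->; rewrite mulrC ler_wpM2r //.
  rewrite cos_half; have h := cos2Dsin2 (c / 2).
  have s1 : sin (c / 2) <= c / 2 by apply: sin_le_id; rewrite divr_ge0.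
  have s0 : 0 <= sin (c / 2).
    apply: sin_ge0_pi; apply/andP; split; first by rewrite divr_ge0.
    have := @pi_ge2 R; lra.
  have : sin (c / 2) ^+ 2 <= (2^-1) ^+ 2.
    by rewrite ler_sqr ?nnegrE ?invr_ge0 //; lra.
  have -> : (2^-1 : R) ^+ 2 = 4^-1 by field.
  lra.
have [x1|x1] := leP x 1; first by have := small x; rewrite x0 x1 => /(_ isT); lra.
have s1 := small 1; have {s1} : 1 / 2 <= sin (1 : R) by apply: s1; rewrite ler01 lexx.
have : sin 1 <= sin x.
  have pi2 := @pi_ge2 R.
  rewrite ltW // ltr_sin // in_itv /=; apply/andP; split; lra.
lra.
Qed.

(** The chord has length [2 |sin ((t - s) / 2)|], at least a quarter of the arc. *)
Lemma csq_cisB (s t : R) : `|t - s| <= pi -> (t - s) ^+ 2 / 16 <= csq (cis t - cis s).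
Proof.
move=> h; set x := (t - s) / 2.
have -> : csq (cis t - cis s) = 4 * sin x ^+ 2.
  have -> : csq (cis t - cis s) = 2 - 2 * cos (t - s).
    rewrite cosB /csq /=; have := cos2Dsin2 t; have := cos2Dsin2 s; lra.
  rewrite cos_half -/x; have := cos2Dsin2 x; lra.
have : (`|x| / 4) ^+ 2 <= sin x ^+ 2.
  have hx : `|x| / 4 <= sin `|x|.
    by apply: sin_lower; rewrite normr_ge0 /x normrM normfV (ger0_norm (ler0n _ 2)) ler_pM2r ?invr_gt0.
  have -> : sin x ^+ 2 = sin `|x| ^+ 2.
    by have [_|_] := ler0P x; rewrite ?sinN ?sqrrN.
  rewrite ler_sqr ?nnegrE ?divr_ge0 //.
  by apply: le_trans hx; rewrite divr_ge0.
rewrite exprMn real_normK ?num_real // /x; lra.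
Qed.

End sine_bound.

(** * Poisson integrals in a Stolz angle against averages over intervals *)

Section maximal_bound.
Context {R : realType}.
Local Notation mu := (@lebesgue_measure R).

Lemma poisson_le_near (z : R[i]) t : csq z < 1 -> poisson z t <= 2 / (1 - cabs z).
Proof.
move=> z1; have c1 : cabs z < 1 by rewrite cabs_lt1.
have h : 1 - cabs z <= cabs (cis t - z).
  by rewrite lerBlDr -(cabs_cis t) -{1}(subrK z (cis t)) cabsD.
have d0 : 0 < 1 - cabs z by rewrite subr_gt0.
rewrite /poisson ler_pdivrMr ?csq_cisB_gt0 // -!sqr_cabs.
have h2 : (1 - cabs z) ^+ 2 <= cabs (cis t - z) ^+ 2 by rewrite ler_sqr ?nnegrE ?(ltW d0) ?cabs_ge0.
rewrite mulrAC ler_pdivlMr //.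
have -> : (1 - cabs z ^+ 2) * (1 - cabs z) = (1 + cabs z) * (1 - cabs z) ^+ 2 by ring.
by apply: ler_pM => //; rewrite ?sqr_ge0 // ?addr_ge0 ?cabs_ge0 //; lra.
Qed.

(** In the Stolz angle [|z - cis s| <= K (1 - |z|) <= K |cis t - z|], so the chord from [cis s] to
    [cis t] is at most [(1 + K) |cis t - z|]. The 32 is 16 from the chord bound times
    [1 + |z| <= 2]. *)
Lemma poisson_le_far (z : R[i]) (K s t : R) : csq z < 1 -> 0 <= K ->
  cabs (z - cis s) <= K * (1 - cabs z) -> `|t - s| <= pi ->
  poisson z t * (t - s) ^+ 2 <= 32 * (1 + K) ^+ 2 * (1 - cabs z).
Proof.
move=> z1 K0 zs ts; have c1 : cabs z < 1 by rewrite cabs_lt1.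
have h : 1 - cabs z <= cabs (cis t - z).
  by rewrite lerBlDr -(cabs_cis t) -{1}(subrK z (cis t)) cabsD.
have d0 : 0 < 1 - cabs z by rewrite subr_gt0.
have h1 : cabs (cis t - cis s) <= (1 + K) * cabs (cis t - z).
  rewrite -(subrK z (cis t)) -addrA; apply: le_trans (cabsD _ _) _.
  rewrite mulrDl mul1r subrK lerD2l (le_trans zs) // ler_wpM2l //.
have h2 : (t - s) ^+ 2 / 16 <= (1 + K) ^+ 2 * csq (cis t - z).
  apply: le_trans (csq_cisB ts) _; rewrite -!sqr_cabs -exprMn ler_sqr ?nnegrE //.
    exact: cabs_ge0.
  by rewrite mulr_ge0 ?cabs_ge0 // addr_ge0.
rewrite /poisson mulrAC ler_pdivrMr ?csq_cisB_gt0 // -sqr_cabs.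
have -> : 1 - cabs z ^+ 2 = (1 - cabs z) * (1 + cabs z) by ring.
have p0 : (t - s) ^+ 2 <= 16 * ((1 + K) ^+ 2 * csq (cis t - z)) by lra.
set X := (t - s) ^+ 2 in p0 *; have X0 : 0 <= X by exact: sqr_ge0.
set Y := (1 + K) ^+ 2 * csq _ in p0.
have -> : 32 * (1 + K) ^+ 2 * (1 - cabs z) * csq (cis t - z) = (1 - cabs z) * (32 * Y).
  by rewrite /Y; ring.
rewrite -mulrA ler_wpM2l ?(ltW d0) //.
apply: (@le_trans _ _ (2 * X)); last by lra.
by rewrite ler_wpM2r //; lra.
Qed.

(* Dyadic decomposition of the arc around [cis s] at scale [1 - |z|]. *)
Lemma integral_poisson_maximal (G : R -> R) (z : R[i]) (K s lam : R) :
  measurable_fun setT G -> (forall t, 0 <= G t) -> csq z < 1 -> 0 <= K -> 0 <= lam ->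
  cabs (z - cis s) <= K * (1 - cabs z) ->
  (forall r : R, 0 < r -> (\int[mu]_(t in ball s r) (G t)%:E <= (2 * r * lam)%:E)%E) ->
  (\int[mu]_(t in `[(s - pi)%R, (s + pi)%R]) (poisson z t * G t)%:E <=
   ((4 + 256 * (1 + K) ^+ 2) * lam)%:E)%E.
Proof.
move=> mG G0 z1 K0 lam0 zs hG.
have d0 : 0 < 1 - cabs z by rewrite subr_gt0 cabs_lt1.
set del := 1 - cabs z in d0 zs.
pose I := `[s - pi, s + pi]%classic : set R.
pose B j : set R := ball s (2 ^+ j * del).
have mB j : measurable (B j) by exact: measurable_ball.
have mI : measurable I by exact: measurable_itv.
have mP : measurable_fun setT (fun t => poisson z t * G t).
  by apply: measurable_funM => //; exact: measurable_poisson.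
have P0 t : 0 <= poisson z t * G t by rewrite mulr_ge0 ?poisson_ge0.
have mBI j : measurable (B j `&` I) by apply: measurableI; [exact: mB|exact: mI].
have mBD j : measurable ((B j.+1 `\` B j) `&` I).
  by apply: measurableI; [apply: measurableD; exact: mB|exact: mI].
pose K2 := (1 + K) ^+ 2.
have K20 : 0 <= K2 by rewrite sqr_ge0.
have two0 j : 0 < 2 ^+ j :> R by rewrite exprn_gt0.
(* The central ball contributes 4 and the j-th ring [128 K2 / 2^j]; the partial sums of the rings
   are [256 K2 (1 - 2^-j)]. *)
have ind j : (\int[mu]_(t in B j `&` I) (poisson z t * G t)%:E <=
    ((4 + 256 * K2 * (1 - (2 ^+ j)^-1)) * lam)%:E)%E.
  elim: j => [|j IH].
    rewrite expr0 invr1 subrr mulr0 addr0.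
    apply: (@le_trans _ _ (\int[mu]_(t in B 0%N `&` I) (2 / del * G t)%:E)%E).
      apply: ge0_le_integral_fin; [exact: mBI|exact: measurable_funTS| |].
        by apply: measurable_funM => //; exact: measurable_funTS.
      by move=> t _; rewrite P0 ler_wpM2r // poisson_le_near.
    apply: (@le_trans _ _ (\int[mu]_(t in B 0%N) (2 / del * G t)%:E)%E).
      apply: ge0_subset_integral; [exact: mBI|exact: mB| | |by move=> t []].
        by apply/measurable_EFinP; apply: measurable_funM => //; exact: measurable_funTS.
      by move=> t _; rewrite lee_fin mulr_ge0 // divr_ge0 // ltW.
    rewrite ge0_integralZ_fin; [|exact: mB|exact: measurable_funTS|by []|by rewrite divr_ge0 // ltW].
    apply: le_trans (lee_wpmul2l _ (hG _ _)) _; rewrite ?lee_fin ?divr_ge0 ?(ltW d0) //.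
      by rewrite expr0 mul1r.
    rewrite expr0 mul1r le_eqVlt; apply/orP; left; apply/eqP.
    by move: (gt_eqF d0) => dn; field; rewrite dn.
  have -> : B j.+1 `&` I = (B j `&` I) `|` ((B j.+1 `\` B j) `&` I).
    rewrite -setIUl setDUK // => t; rewrite /B /ball /= => /lt_le_trans; apply.
    by rewrite ler_pM2r // ler_eXn2l // ltr1n.
  rewrite ge0_integral_setU //; first last.
  - by apply/disj_setPS => t [[Bj _] [[_ nBj] _]].
  - by move=> t _; rewrite lee_fin.
  - by apply/measurable_EFinP; exact: measurable_funTS.
  - exact: mBD.
  - exact: mBI.
  set k := 32 * K2 * del / (2 ^+ j * del) ^+ 2.
  have k0 : 0 <= k.
    by apply: divr_ge0 (sqr_ge0 _); apply: mulr_ge0 (ltW d0); apply: mulr_ge0.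
  have second : (\int[mu]_(t in (B j.+1 `\` B j) `&` I) (poisson z t * G t)%:E <=
      (k * (2 * (2 ^+ j.+1 * del) * lam))%:E)%E.
    apply: (@le_trans _ _ (\int[mu]_(t in (B j.+1 `\` B j) `&` I) (k * G t)%:E)%E).
      apply: ge0_le_integral_fin; [exact: mBD|exact: measurable_funTS| |].
        by apply: measurable_funM => //; exact: measurable_funTS.
      move=> t [[_ nB] It]; rewrite P0 ler_wpM2r //.
      have ts : `|t - s| <= pi.
        by move: It; rewrite /I /= in_itv /= ler_norml => /andP[? ?]; apply/andP; split; lra.
      have dist : 2 ^+ j * del <= `|t - s|.
        by rewrite leNgt; apply/negP => hlt; apply: nB; rewrite /B /ball /= distrC.
      rewrite /k ler_pdivlMr ?exprn_gt0 ?mulr_gt0 //.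
      apply: le_trans (poisson_le_far z1 K0 zs ts).
      rewrite ler_wpM2l ?poisson_ge0 // -(real_normK (num_real (t - s))).
      by rewrite ler_sqr ?nnegrE ?normr_ge0 // mulr_ge0 // ltW.
    apply: (@le_trans _ _ (\int[mu]_(t in B j.+1) (k * G t)%:E)%E).
      apply: ge0_subset_integral; [exact: mBD|exact: mB| | |].
      - by apply/measurable_EFinP; apply: measurable_funM => //; exact: measurable_funTS.
      - by move=> t _; rewrite lee_fin mulr_ge0.
      - by move=> t [[]].
    rewrite ge0_integralZ_fin; [|exact: mB|exact: measurable_funTS|by []|by []].
    rewrite [in X in (_ <= X)%E]EFinM; apply: lee_wpmul2l; first by rewrite lee_fin.
    by apply: hG; rewrite mulr_gt0.
  apply: le_trans (leeD IH second) _; rewrite -EFinD lee_fin le_eqVlt; apply/orP; left; apply/eqP.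
  rewrite /k !(exprS 2 j); move: (gt_eqF d0) (gt_eqF (two0 j)) => dn tn.
  by move: (2 ^+ j : R) tn => x tn; field; rewrite dn tn.
have [J hJ] : exists J, pi < 2 ^+ J * del.
  exists (Num.bound (pi / del)); rewrite -ltr_pdivrMr //.
  apply: lt_trans (archi_boundP _) _; first by rewrite divr_ge0 ?pi_ge0 ?ltW.
  by rewrite -natrX ltr_nat ltn_expl.
have -> : `[s - pi, (s + pi)%R]%classic = B J `&` I.
  apply/seteqP; split=> t; last by case.
  move=> It; split=> //; rewrite /B /ball /= distrC; apply: le_lt_trans hJ.
  by move: It; rewrite /= in_itv /= ler_norml => /andP[? ?]; apply/andP; split; lra.
apply: le_trans (ind J) _; rewrite lee_fin ler_wpM2r //.
rewrite lerD2l mulrBr mulr1 gerBl; apply: mulr_ge0; first exact: mulr_ge0.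
by rewrite invr_ge0 ltW.
Qed.

End maximal_bound.

Section nontangential_limits.
Context {R : realType} {H : hilbertType R}.
Local Notation C := R[i].
Local Notation mu := (@lebesgue_measure R).
Implicit Types (h : nat -> H) (t : R) (z w : C).

Lemma cabs_le1 z : (cabs z <= 1) = (csq z <= 1).
Proof. by rewrite -sqr_cabs expr_le1 ?cabs_ge0. Qed.

(** Lets estimates pass between a boundary point and nearby interior points, one polynomial at a
    time. *)
Lemma hpoly_lipschitz h N : exists2 L : R, 0 <= L &
  forall z w, cabs z <= 1 -> cabs w <= 1 ->
    `|hpoly h N z - hpoly h N w| <= (L * cabs (z - w))%:C%C.
Proof.
elim: N => [|N [L L0 IH]].
  by exists 0 => // z w _ _; rewrite /hpoly !big_ord0 subrr normr0 mul0r.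
exists (L + N%:R * Num.sqrt (sqn (h N))).
  by rewrite addr_ge0 // mulr_ge0 // sqrtr_ge0.
move=> z w z1 w1; rewrite /hpoly !big_ord_recr /= opprD addrACA.
apply: le_trans (ler_normD _ _) _; rewrite mulrDl rmorphD /=.
apply: lerD; first exact: IH.
rewrite -scalerBl normrZ norm_sqn cabsE -rmorphM lecR mulrAC ler_wpM2r ?sqrtr_ge0 //.
rewrite -lecR rmorphM /= -!cabsE.
elim: N {IH L L0} => [|N IH]; first by rewrite !expr0 subrr normr0 mulr_ge0 // realc_ge0.
have -> : z ^+ N.+1 - w ^+ N.+1 = z * (z ^+ N - w ^+ N) + (z - w) * w ^+ N.
  by rewrite !exprS; ring.
apply: le_trans (ler_normD _ _) _.
have le1 (x y : C) : cabs x <= 1 -> `|x * y| <= `|y|.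
  by move=> x1; rewrite normrM ler_piMl // cabsE -(rmorph1 (real_complex R)) lecR.
rewrite -natr1 rmorphD rmorph1 [leRHS]mulrDl mul1r; apply: lerD; first exact: le_trans (le1 _ _ z1) IH.
rewrite mulrC; apply: le1.
by rewrite cabs_le1 csqX exprn_ile1 ?csq_ge0 // -cabs_le1.
Qed.

(* The window [- pi, 3 pi] contains a full period around each [t] in [0, 2 pi]. *)
Definition window : set R := `[(- pi), (3 * pi)]%classic.

Definition windowed (g : R -> R) : R -> R := g \_ window.

Lemma windowed_sqn_hpoly_integrable h N :
  mu.-integrable window (EFin \o fun t => sqn (hpoly h N (cis t))).
Proof.
apply: continuous_compact_integrable; first exact: segment_compact.
apply: continuous_subspaceT; exact: continuous_sqn_hpoly.
Qed.

(** The window is covered by the two periods [[-pi, pi]] and [[pi, 3 pi]], each contributing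
    [2 * pi] times the coefficient sum. *)
Lemma integral_window_sqn_hpoly h N :
  (\int[mu]_(t in window) (sqn (hpoly h N (cis t)))%:E <=
   (4 * pi * \sum_(k < N) sqn (h k))%:E)%E.
Proof.
have pi0 : (0 : R) < pi := pi_gt0 R.
have mf D : measurable_fun D (fun t => (sqn (hpoly h N (cis t)))%:E).
  by apply/measurable_EFinP; exact: measurable_sqn_hpoly.
have f0 t : (0 <= (sqn (hpoly h N (cis t)))%:E)%E by rewrite lee_fin sqn_ge0.
pose A := `[(- pi)%R, (- pi + 2 * pi)%R]%classic : set R.
pose B := `[pi%R, (pi + 2 * pi)%R]%classic : set R.
have mA : measurable A by exact: measurable_itv.
have mB : measurable B by exact: measurable_itv.
have sub : window `<=` A `|` (B `\` A).
  move=> t; rewrite /window /A /B /= !in_itv /= => /andP[t1 t2].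
  have [t3|t3] := leP t pi; first by left; apply/andP; split; lra.
  right; split; first by apply/andP; split; lra.
  by move=> /andP[_]; lra.
apply: (@le_trans _ _ (\int[mu]_(t in A `|` (B `\` A)) (sqn (hpoly h N (cis t)))%:E)%E).
  apply: ge0_subset_integral => //; [exact: measurable_itv| |exact: mf].
  by apply: measurableU => //; exact: measurableD.
rewrite ge0_integral_setU //; first last.
- by apply/disj_setPS => t [? []].
- exact: mf.
- exact: measurableD.
apply: (@le_trans _ _ (\int[mu]_(t in A) (sqn (hpoly h N (cis t)))%:E + \int[mu]_(t in B) (sqn (hpoly h N (cis t)))%:E)%E).
  apply: leeD => //; apply: ge0_subset_integral;
    [exact: measurableD|exact: mB|exact: mf|by move=> *; exact: f0|by move=> t []].
by rewrite !parseval -EFinD lee_fin; lra.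
Qed.

Lemma windowed_ge0 (g : R -> R) t : (forall s, 0 <= g s) -> 0 <= windowed g t.
Proof. by move=> g0; rewrite /windowed patchE; case: ifP. Qed.

Lemma measurable_windowed h N : measurable_fun setT (windowed (fun t => sqn (hpoly h N (cis t)))).
Proof.
apply/(measurable_restrictT _ _).1; first exact: measurable_itv.
exact: measurable_sqn_hpoly.
Qed.

Lemma HL_windowed_hpoly h N (c : R) : 0 < c ->
  (mu [set t | HL_maximal (windowed (fun t => sqn (hpoly h N (cis t)))) t > c%:E] <=
   (12 * pi / c * \sum_(k < N) sqn (h k))%:E)%E.
Proof.
move=> c0; apply: le_trans (maximal_inequality _ c0) _.
  apply: integrable_locally_restrict; first exact: measurable_itv.
  exact: windowed_sqn_hpoly_integrable.
have -> : 12 * pi / c * \sum_(k < N) sqn (h k) = 3 / c * (4 * pi * \sum_(k < N) sqn (h k)) by ring.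
rewrite [in leRHS]EFinM; apply: lee_wpmul2l; first by rewrite lee_fin divr_ge0 // ltW.
apply: le_trans (integral_window_sqn_hpoly h N).
rewrite [leRHS]integral_mkcond le_eqVlt; apply/orP; left; apply/eqP.
apply: eq_integral => t _; rewrite restrict_EFin /= ger0_norm //.
by apply: windowed_ge0 => s; exact: sqn_ge0.
Qed.

Lemma measurable_HL_windowed h N (c : R) :
  measurable [set t | (HL_maximal (windowed (fun t => sqn (hpoly h N (cis t)))) t > c%:E)%E].
Proof.
rewrite -[X in measurable X]setTI; apply: emeasurable_fun_o_infty => //.
apply: measurable_HL_maximal; apply: integrable_locally_restrict; first exact: measurable_itv.
exact: windowed_sqn_hpoly_integrable.
Qed.

(** One value of the maximal function at [s] controls the polynomial on the whole Stolz angle at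
    [cis s]: the Poisson bound over the period centred at [s] is fed into the dyadic estimate. *)
Lemma sqn_hpoly_nontangential h N z (K s lam : R) : 0 <= s <= 2 * pi ->
  csq z < 1 -> 0 <= K -> 0 <= lam -> cabs (z - cis s) <= K * (1 - cabs z) ->
  (HL_maximal (windowed (fun t => sqn (hpoly h N (cis t)))) s <= lam%:E)%E ->
  sqn (hpoly h N z) <= 2 / pi * (4 + 256 * (1 + K) ^+ 2) * lam.
Proof.
move=> /andP[s0 s2] z1 K0 lam0 zs hs; have pi0 : (0 : R) < pi := pi_gt0 R.
pose G := windowed (fun t => sqn (hpoly h N (cis t))).
have G0 t : 0 <= G t by apply: windowed_ge0 => ?; exact: sqn_ge0.
rewrite -lee_fin; apply: le_trans (sqn_hpoly_poisson h N (s - pi) z1) _.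
rewrite -mulrA [in leRHS]EFinM; apply: lee_wpmul2l; first by rewrite lee_fin divr_ge0 // ltW.
apply: le_trans (@integral_poisson_maximal _ G z K s lam _ _ _ _ _ _ _) => //.
- have -> : (s - pi + 2 * pi)%R = (s + pi)%R by ring.
  rewrite le_eqVlt; apply/orP; left; apply/eqP; apply: eq_integral => t.
  rewrite inE /= in_itv /= => /andP[t1 t2]; rewrite /G /windowed patchE ifT //.
  by rewrite inE /window /= in_itv /=; apply/andP; split; lra.
- exact: measurable_windowed.
- move=> r r0.
  have : (iavg G (ball s r) <= lam%:E)%E.
    by apply: le_trans hs; apply: ereal_sup_ubound; exists r => //=; rewrite in_itv /= r0.
  rewrite /iavg lebesgue_measure_ball ?(ltW r0) // inver mulrn_eq0 /= gt_eqF //.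
  rewrite muleC lee_pdivrMr; last by rewrite mulrn_wgt0.
  rewrite -EFinM => h1; apply: (@le_trans _ _ (lam * (r *+ 2))%:E).
    apply: le_trans h1; rewrite le_eqVlt; apply/orP; left; apply/eqP.
    by apply: eq_integral => t _; rewrite /= ger0_norm.
  by rewrite lee_fin -mulr_natr; lra.
Qed.

End nontangential_limits.

(** * Almost everywhere nontangential convergence *)

Section fatou_nontangential.
Context {R : realType} {H : hilbertType R}.
Local Notation C := R[i].
Local Notation mu := (@lebesgue_measure R).
Implicit Types (h : nat -> H) (t : R) (z w : C).

Definition block h (N k : nat) : H := if (N <= k)%N then h k else 0.

Lemma sum_block (V : zmodType) (F : nat -> V) N M : (N <= M)%N ->
  \sum_(k < M) (if (N <= k)%N then F k else 0) = \sum_(k < M) F k - \sum_(k < N) F k.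
Proof.
move=> NM; rewrite -(big_mkord xpredT F) -(big_mkord xpredT F).
rewrite -(big_mkord xpredT (fun k => if (N <= k)%N then F k else 0)).
rewrite !(big_cat_nat (leq0n N) NM) /=.
rewrite [X in X + _ = _]big_nat_cond big1 => [|k /andP[/andP[_ kN] _]]; last first.
  by rewrite leqNgt kN.
rewrite add0r addrAC subrr add0r; apply: eq_big_nat => k /andP[Nk _].
by rewrite Nk.
Qed.

Lemma hpoly_block h N M z : (N <= M)%N ->
  hpoly (block h N) M z = hpoly h M z - hpoly h N z.
Proof.
move=> NM; rewrite /hpoly -(sum_block (fun k => z ^+ k *: h k) NM).
by apply: eq_bigr => k _; rewrite /block; case: ifP => // _; rewrite scaler0.
Qed.

Lemma sum_sqn_block h N M : (N <= M)%N ->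
  \sum_(k < M) sqn (block h N k) = \sum_(k < M) sqn (h k) - \sum_(k < N) sqn (h k).
Proof.
move=> NM; rewrite -(sum_block (fun k => sqn (h k)) NM).
by apply: eq_bigr => k _; rewrite /block; case: ifP => // _; rewrite sqn0.
Qed.

Lemma bounded_sum_tail (a : nat -> R) (B e : R) : (forall k, 0 <= a k) -> 0 < e ->
  (forall N, \sum_(k < N) a k <= B) ->
  exists n, forall M, \sum_(k < M) a k <= \sum_(k < n) a k + e.
Proof.
move=> a0 e0 hB; pose S N := \sum_(k < N) a k.
have ndS : nondecreasing_seq S.
  by apply/nondecreasing_seqP => N; rewrite /S big_ord_recr /= lerDl.
have cS : cvgn S.
  by apply: nondecreasing_is_cvgn => //; exists B => _ [N _ <-]; exact: hB.
have /cvgrPdist_lt /(_ _ e0) [n _ hn] := cS.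
exists n => M; apply: le_trans (nondecreasing_cvgn_le ndS cS M) _.
have := hn n (leqnn n) => /=; rewrite ltr_distlC => /andP[+ _]; rewrite -/(S n); lra.
Qed.

Lemma square_summable_blocks h (B : R) (e : nat -> R) : (forall j, 0 < e j) ->
  (forall N, \sum_(k < N) sqn (h k) <= B) ->
  exists Nf : nat -> nat, [/\ forall j, (j <= Nf j)%N, forall j, (Nf j <= Nf j.+1)%N &
    forall j, \sum_(k < Nf j.+1) sqn (block h (Nf j) k) <= e j].
Proof.
move=> e0 hB; have /choice[n hn] := fun j => bounded_sum_tail (fun k => sqn_ge0 (h k)) (e0 j) hB.
(* Cumulative sums dominate each [n j] and are increasing; the added 1 also gives [j <= Nf j]. *)
pose Nf j := (\sum_(i < j.+1) (n i + 1))%N.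
have Nf1 j : (Nf j <= Nf j.+1)%N by rewrite /Nf [in X in (_ <= X)%N]big_ord_recr leq_addr.
exists Nf; split => // j.
  elim: j => // j IH; rewrite /Nf big_ord_recr /= -/(Nf j).
  by rewrite addnA addn1 ltnS (leq_trans IH) // leq_addr.
rewrite sum_sqn_block //.
have : \sum_(k < n j) sqn (h k) <= \sum_(k < Nf j) sqn (h k).
  have nN : (n j <= Nf j)%N by rewrite /Nf big_ord_recr /= addnA addn1 leqW // leq_addl.
  have := sum_sqn_block h nN; rewrite -subr_ge0 => <-.
  by apply: sumr_ge0 => k _; exact: sqn_ge0.
have := hn j (Nf j.+1); lra.
Qed.

(** Block energies [16^-j] against thresholds [4^-j] leave exceptional sets of measure of order
    [4^-j], so Borel-Cantelli applies. The thresholds bound squares, which makes norms of order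
    [2^-j]. *)
Lemma ae_small_blocks h (B : R) : (forall N, \sum_(k < N) sqn (h k) <= B) ->
  exists (Nf : nat -> nat) (Z : set R), [/\ measurable Z, mu Z = 0%E,
    forall j, (j <= Nf j)%N, forall j, (Nf j <= Nf j.+1)%N &
    forall t, ~ Z t -> exists J, forall j, (J <= j)%N ->
      (HL_maximal (windowed (fun s => sqn (hpoly (block h (Nf j)) (Nf j.+1) (cis s)))) t
        <= (4^-1 ^+ j)%:E)%E].
Proof.
move=> hB; have [|Nf [Nf1 Nf2 Nf3]] := @square_summable_blocks h B (fun j => 16^-1 ^+ j) _ hB.
  by move=> j; rewrite exprn_gt0 // invr_gt0.
pose HLj j := HL_maximal (windowed (fun s => sqn (hpoly (block h (Nf j)) (Nf j.+1) (cis s)))).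
pose E j := [set t | (HLj j t > (4^-1 ^+ j)%:E)%E].
have q0 j : 0 < 4^-1 ^+ j :> R by rewrite exprn_gt0 // invr_gt0.
have mE j : measurable (E j) by exact: measurable_HL_windowed.
have muE j : (mu (E j) <= (24 * pi / (2 ^ j.+1)%:R)%:E)%E.
  apply: le_trans (HL_windowed_hpoly _ _ (q0 j)) _; rewrite lee_fin.
  apply: (@le_trans _ _ (12 * pi / 4^-1 ^+ j * 16^-1 ^+ j)).
    by rewrite ler_wpM2l // divr_ge0 ?mulr_ge0 ?pi_ge0 ?(ltW (q0 j)).
  rewrite -mulrA natrX exprS -exprVn invrK -exprMn.
  have -> : (4 * 16^-1 : R) = 4^-1 by field.
  have -> : 24 * pi / (2 * 2 ^+ j) = 12 * pi * 2^-1 ^+ j :> R.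
    have : 2 ^+ j != 0 :> R by rewrite expf_neq0.
    by rewrite exprVn; move: (2 ^+ j : R) => x x0; field.
  rewrite ler_wpM2l ?mulr_ge0 ?pi_ge0 // lerXn2r ?nnegrE ?invr_ge0 //; lra.
exists Nf, (lim_sup_set E); split => //.
- by apply: bigcap_measurable => // k _; apply: bigcup_measurable => j _; exact: mE.
- apply: lim_sup_set_cvg0 => //.
  apply: le_lt_trans (lee_nneseries _ (fun j _ => muE j)) _; first by move=> *; exact: measure_ge0.
  apply: le_lt_trans (epsilon_trick0 xpredT _) _; last by rewrite ltry.
  by rewrite mulr_ge0 // pi_ge0.
- move=> t /existsNP[J /not_implyP[_ hJ]]; exists J => j Jj.
  by rewrite leNgt; apply/negP => hlt; apply: hJ; exists j.
Qed.

Lemma cabs_radial (r : R) t : 0 <= r <= 1 ->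
  cabs (r%:C%C * cis t) = r /\ cabs (r%:C%C * cis t - cis t) = 1 - r.
Proof.
move=> /andP[r0 r1]; split.
  by rewrite /cabs csqM csq_cis mulr1 csq_real sqrtr_sqr ger0_norm.
rewrite -{2}(mul1r (cis t)) -mulrBl -(rmorph1 (real_complex R)) -rmorphB.
by rewrite /cabs csqM csq_cis mulr1 csq_real -sqrrN opprB sqrtr_sqr ger0_norm // subr_ge0.
Qed.

Definition has_nontangential_limit (f : C -> H) t (l : H) : Prop :=
  forall K eps : R, 0 < K -> 0 < eps -> exists2 delta : R, 0 < delta &
    forall z, csq z < 1 -> cabs (z - cis t) < K * (1 - cabs z) ->
      cabs (z - cis t) < delta -> `|f z - l| <= eps%:C%C.

(** Outside the exceptional set the partial sums along [Nf] converge geometrically, uniformly on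
    each Stolz angle and at its vertex. A single Lipschitz polynomial then links [f z] to the
    limit. *)
Lemma power_series_nontangential_ae h (B : R) (f : C -> H) :
  (forall N, \sum_(k < N) sqn (h k) <= B) ->
  (forall z (e : R), csq z < 1 -> 0 < e ->
     exists N0, forall N, (N0 <= N)%N -> `|f z - hpoly h N z| <= e%:C%C) ->
  exists Z : set R, [/\ measurable Z, mu Z = 0%E &
    forall t, 0 <= t <= 2 * pi -> ~ Z t -> exists l, has_nontangential_limit f t l].
Proof.
move=> hB hf; have [Nf [Z [mZ Z0 Nf1 Nf2 HZ]]] := ae_small_blocks hB.
exists Z; split => // t t02 /HZ[J hJ].
pose c K := Num.sqrt (2 / pi * (4 + 256 * (1 + K) ^+ 2)) : R.
have c0 K : 0 <= c K by exact: sqrtr_ge0.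
have half0 : 0 <= (2^-1 : R) < 1 by rewrite invr_ge0 /=; lra.
have small K j z : 0 <= K -> (J <= j)%N -> csq z < 1 ->
    cabs (z - cis t) <= K * (1 - cabs z) ->
    `|hpoly h (Nf j.+1) z - hpoly h (Nf j) z| <= (c K * 2^-1 ^+ j)%:C%C.
  move=> K0 Jj z1 zt; rewrite -hpoly_block //.
  have cp : 0 <= 2 / pi * (4 + 256 * (1 + K) ^+ 2) :> R.
    by rewrite mulr_ge0 ?divr_ge0 ?pi_ge0 // addr_ge0 // mulr_ge0 // sqr_ge0.
  rewrite ler_norm_real ?mulr_ge0 ?exprn_ge0 ?invr_ge0 // exprMn sqr_sqrtr //.
  rewrite -exprM mulnC exprM (_ : 2^-1 ^+ 2 = 4^-1 :> R); last by field.
  by apply: (@sqn_hpoly_nontangential _ _ _ _ _ K t) => //; exact: hJ.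
(* The vertex is reached along the radius, which lies in the angle [K = 1] with equality. The radius
   [r] below is close enough to 1 that the Lipschitz error is at most [e]. *)
have bd j : (J <= j)%N -> `|hpoly h (Nf j.+1) (cis t) - hpoly h (Nf j) (cis t)| <= (c 1 * 2^-1 ^+ j)%:C%C.
  move=> Jj; rewrite -hpoly_block //.
  have [L L0 hL] := hpoly_lipschitz (block h (Nf j)) (Nf j.+1).
  apply/ler_addgt0Pr => e; rewrite ltcE /= => /andP[/eqP e2 e1].
  have {e2} eE : e = (Re e)%:C%C by case: e e1 e2 => a b /= _ ->.
  pose r := 1 - Num.min 1 (Re e / (L + 1)); pose z : C := r%:C%C * cis t.
  have L1 : 0 < L + 1 by rewrite ltr_wpDl.
  have d0 : 0 < Num.min 1 (Re e / (L + 1)) by rewrite lt_min ltr01 /= divr_gt0.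
  have d1 : Num.min 1 (Re e / (L + 1)) <= 1 by rewrite ge_min lexx.
  have d2 : Num.min 1 (Re e / (L + 1)) <= Re e / (L + 1) by rewrite ge_min lexx orbT.
  have r0 : 0 <= r by rewrite subr_ge0.
  have [|cz czt] := @cabs_radial r t; first by rewrite r0 /r; lra.
  rewrite -/z in cz czt.
  have z1 : csq z < 1 by rewrite -cabs_lt1 cz /r; lra.
  have h1 := small 1 j z ler01 Jj z1.
  rewrite czt cz mul1r lexx -hpoly_block // in h1.
  have := hL (cis t) z; rewrite cabs_cis cz cabsBC czt => /(_ (lexx _)) h2.
  rewrite -(subrK (hpoly (block h (Nf j)) (Nf j.+1) z) (hpoly _ _ (cis t))) addrC.
  apply: (le_trans (ler_normD _ _)); apply: lerD; first exact: h1.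
  apply: le_trans (h2 _) _; first by rewrite /r; lra.
  rewrite eE lecR /r subKr; apply: le_trans (ler_wpM2l L0 d2) _.
  by rewrite mulrA ler_pdivrMr // mulrC ler_wpM2l ?(ltW e1) // lerDl.
have [|n|l hl] := @geometric_cvg _ _ (fun n => hpoly h (Nf (J + n)%N) (cis t)) (c 1 * 2^-1 ^+ J) 2^-1 _ half0.
- by rewrite mulr_ge0 // exprn_ge0 // invr_ge0.
- by rewrite addnS -mulrA -exprD; apply: bd; exact: leq_addr.
exists l => K eps K0 eps0.
have e30 : 0 < eps / 3 by rewrite divr_gt0.
have tail K' : exists n, c K' * 2^-1 ^+ J * 2^-1 ^+ n / (1 - 2^-1) < eps / 3.
  have [n /(_ n (leqnn n)) hn] := geometric_small (c K' * 2^-1 ^+ J / (1 - 2^-1)) half0 e30.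
  by exists n; rewrite mulrAC.
have [n1 hn1] := tail 1; have [n2 hn2] := tail K.
(* A common index for the tail at the vertex (constant [c 1]) and the tail inside the angle
   (constant [c K]). *)
pose n := maxn n1 n2.
have mono K' m : (m <= n)%N -> c K' * 2^-1 ^+ J * 2^-1 ^+ m / (1 - 2^-1) < eps / 3 ->
    c K' * 2^-1 ^+ J * 2^-1 ^+ n / (1 - 2^-1) <= eps / 3.
  move=> mn h1; apply: le_trans (ltW h1); case/andP: half0 => p0 p1.
  rewrite ler_pM2r ?invr_gt0 ?subr_gt0 // ler_wpM2l ?mulr_ge0 ?exprn_ge0 //.
  by rewrite ler_wiXn2l // ltW.
have {hn1}hn1 := mono 1 n1 (leq_maxl _ _) hn1; have {hn2}hn2 := mono K n2 (leq_maxr _ _) hn2.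
have [L L0 hL] := hpoly_lipschitz h (Nf (J + n)%N).
have L1 : 0 < L + 1 by rewrite ltr_wpDl.
exists (eps / 3 / (L + 1)); first by rewrite divr_gt0.
move=> z z1 zt zd.
have hz : `|f z - hpoly h (Nf (J + n)%N) z| <= (eps / 3)%:C%C.
  have [|k|l' hl'] := @geometric_cvg _ _ (fun n => hpoly h (Nf (J + n)%N) z) (c K * 2^-1 ^+ J) 2^-1 _ half0.
  - by rewrite mulr_ge0 // exprn_ge0 // invr_ge0.
  - by rewrite addnS -mulrA -exprD; apply: small; [exact: ltW|exact: leq_addr|by []|exact: ltW].
  (* The blocks converge to some [l']; [hf] identifies it, because [Nf] tends to infinity. *)
  have -> : f z = l'.
    apply/eqP; rewrite -subr_eq0; apply/eqP.
    suff : `|f z - l'| <= 0 by rewrite normr_le0 => /eqP.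
    apply/ler_addgt0Pr => e; rewrite ltcE /= add0r => /andP[/eqP e2 e1].
    have {e2} eE : e = (Re e)%:C%C by case: e e1 e2 => a b /= _ ->.
    have e20 : 0 < Re e / 2 by rewrite divr_gt0.
    have [N0 hN0] := hf z _ z1 e20.
    have [m /(_ (m + N0)%N (leq_addr _ _)) hm] := geometric_small (c K * 2^-1 ^+ J / (1 - 2^-1)) half0 e20.
    have {}hN0 := hN0 (Nf (J + (m + N0)))%N.
    rewrite -(subrK (hpoly h (Nf (J + (m + N0))%N) z) (f z)) -addrA.
    apply: (le_trans (ler_normD _ _)); rewrite eE (splitr (Re e)) rmorphD /=.
    apply: lerD; first by apply: hN0; apply: leq_trans (Nf1 _); rewrite addnA leq_addl.
    by rewrite distrC; apply: le_trans (hl' _) _; rewrite lecR mulrAC ltW.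
  by apply: le_trans (hl' n) _; rewrite lecR.
have zle : cabs z <= 1 by rewrite ltW // cabs_lt1.
have h2 := hL z (cis t) zle; rewrite cabs_cis in h2.
have -> : f z - l = (f z - hpoly h (Nf (J + n)%N) z) +
    (hpoly h (Nf (J + n)%N) z - hpoly h (Nf (J + n)%N) (cis t)) + (hpoly h (Nf (J + n)%N) (cis t) - l).
  by rewrite !addrA !subrK.
apply: le_trans (ler_normD _ _) _.
have -> : eps%:C%C = (eps / 3)%:C%C + (eps / 3)%:C%C + (eps / 3)%:C%C.
  by rewrite -!rmorphD /=; congr (_%:C%C); field.
apply: lerD; last by rewrite distrC; apply: le_trans (hl n) _; rewrite lecR.
apply: le_trans (ler_normD _ _) _; apply: lerD; first exact: hz.
apply: le_trans (h2 (lexx _)) _; rewrite lecR.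
apply: le_trans (ler_wpM2l L0 (ltW zd)) _.
by rewrite mulrA ler_pdivrMr // mulrC ler_wpM2l ?(ltW e30) // lerDl.
Qed.

End fatou_nontangential.

(** * Boundary values of the characteristic function *)

Section circle_parametrization.
Context {R : realType}.
Local Notation T := (borel_circle R).
Local Notation mu := (@lebesgue_measure R).
Implicit Types (t : R) (xi : T).

Lemma circle_val_expi t : circle_val (expi t) = cis t. Proof. by []. Qed.

Lemma csq_circle_val xi : csq (circle_val xi) = 1.
Proof.
have /set_mem h := svalP (xi : circle R).
have {}h : `|circle_val xi| = 1 by exact: h.
apply: complexI; rewrite csqE h expr1n //.
Qed.

Lemma open_halfspace (f : R[i] -> R) (x : R) :
  (forall z w, f z - f w <= cabs (z - w)) -> open [set z : R[i]^o | x < f z].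
Proof.
move=> lf; rewrite openE => z /= xz; apply/nbhs_ballP.
exists (f z - x)%:C%C; first by rewrite /= -(rmorph0 (real_complex R)) ltcR subr_gt0.
move=> w; rewrite /ball /= cabsE ltcR => zw.
have := lf z w; lra.
Qed.

Lemma measurable_circle_coord (f : R[i] -> R) :
  (forall z w, f z - f w <= cabs (z - w)) -> measurable_fun setT (f \o @circle_val R).
Proof.
move=> lf; apply: (measurability _ (RGenOInfty.measurableE R)).
move=> _ [_ [x ->] <-]; rewrite setTI; apply: sub_sigma_algebra.
exists [set z : R[i]^o | x < f z]; first exact: open_halfspace.
by apply/seteqP; split=> xi /=; rewrite in_itv /= andbT.
Qed.

Lemma measurable_Re_circle : measurable_fun setT (fun xi => Re (circle_val xi)).
Proof.
apply: (@measurable_circle_coord (@complex.Re R)) => -[a b] [c d].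
rewrite /= /cabs /csq /=; apply: le_trans (ler_norm _) _.
by rewrite -sqrtr_sqr ler_wsqrtr // lerDl sqr_ge0.
Qed.

Lemma measurable_Im_circle : measurable_fun setT (fun xi => Im (circle_val xi)).
Proof.
apply: (@measurable_circle_coord (@complex.Im R)) => -[a b] [c d].
rewrite /= /cabs /csq /=; apply: le_trans (ler_norm _) _.
by rewrite -sqrtr_sqr ler_wsqrtr // lerDr sqr_ge0.
Qed.

(** Continued by constants outside []-1, 1[], so that measurability on the whole line can be
    composed with the real part. *)
Definition arccos_ext (x : R) : R :=
  if (-1 < x) && (x < 1) then acos x else if x <= -1 then pi else 0.

Lemma arccos_extE x : -1 <= x <= 1 -> arccos_ext x = acos x.
Proof.
move=> /andP[x1 x2]; rewrite /arccos_ext.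
have [x3|x3] := leP x (-1).
  have -> : x = -1 by apply/eqP; rewrite eq_le x3.
  by rewrite /= acosN1.
have [x4|x4] //= := ltP x 1.
have -> : x = 1 by apply/eqP; rewrite eq_le x2.
by rewrite acos1.
Qed.

Lemma measurable_arccos_ext : measurable_fun setT arccos_ext.
Proof.
rewrite /arccos_ext; apply: measurable_fun_if => //.
- apply: measurable_and; apply: measurable_fun_ltr => //; exact: measurable_cst.
- rewrite (_ : _ `&` _ = `]-1, 1[%classic); last first.
    by apply/seteqP; split=> x /=; rewrite in_itv /=; [case|split].
  apply: open_continuous_measurable_fun; first exact: interval_open.
  by move=> x; rewrite inE /= in_itv /=; exact: continuous_acos.
- apply: measurable_funTS; apply: measurable_fun_ifT => //; first exact: measurable_fun_ler.
Qed.

(** A measurable inverse of [expi] on [[0, 2 pi[]: preimages under it carry null sets from the line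
    to the circle. *)
Definition carg xi : R := if 0 <= Im (circle_val xi)
  then arccos_ext (Re (circle_val xi)) else 2 * pi - arccos_ext (Re (circle_val xi)).

Lemma measurable_carg : measurable_fun setT carg.
Proof.
have ma : measurable_fun setT (fun xi => arccos_ext (Re (circle_val xi))).
  by apply: (measurableT_comp measurable_arccos_ext); exact: measurable_Re_circle.
apply: measurable_fun_ifT => //; last exact: measurable_funB.
by apply: measurable_fun_ler => //; exact: measurable_Im_circle.
Qed.

Lemma carg_expi t : 0 <= t < 2 * pi -> carg (expi t) = t.
Proof.
move=> /andP[t0 t2]; rewrite /carg circle_val_expi /= arccos_extE ?cos_geN1 ?cos_le1 //.
have [tp|tp] := leP t pi.
  by rewrite sin_ge0_pi ?t0 // cosK // in_itv /= t0.
have sE : sin t = - sin (t - pi) by rewrite sinB sinpi cospi; lra.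
have s0 : 0 < sin (t - pi) by apply: sin_gt0_pi; apply/andP; split; lra.
rewrite sE ifF; last by apply/negbTE; rewrite -ltNge; lra.
have -> : cos t = cos (2 * pi - t).
  by rewrite cosB mulr2n mulrDl mul1r -mulr2n cos2pi sin2pi; lra.
rewrite cosK; first lra.
by rewrite in_itv /=; apply/andP; split; lra.
Qed.

Lemma expi_surj xi : exists2 t, 0 <= t < 2 * pi & expi t = xi.
Proof.
have pi0 : (0 : R) < pi := pi_gt0 R.
have c1 : Re (circle_val xi) ^+ 2 + Im (circle_val xi) ^+ 2 = 1 by exact: csq_circle_val.
set a := Re _ in c1 *; set b := Im _ in c1.
have a1 : -1 <= a <= 1.
  by rewrite -ler_norml -(expr_le1 (n := 2)) // real_normK ?num_real //; have := sqr_ge0 b; lra.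
have [h0 h1] := acos_def a1; have sA := sin_acos a1.
have sb : Num.sqrt (1 - a ^+ 2) = `|b|.
  by rewrite -sqrtr_sqr; congr Num.sqrt; lra.
have inj t : cos t = a -> sin t = b -> expi t = xi.
  move=> ct st; apply: val_inj; rewrite -[LHS]/(cis t) -[RHS]/(circle_val xi).
  by rewrite /cis ct st /a /b; case: (circle_val xi).
have [b0|b0] := leP 0 b.
  exists (acos a); first by move: h0 => /andP[? ?]; apply/andP; split; lra.
  by apply: inj => //; rewrite sA sb ger0_norm.
have h2 : 0 < acos a.
  move: h0 => /andP[]; rewrite le_eqVlt => /predU1P[a0|//] _.
  by move: sA; rewrite -a0 sin0 sb => /esym/eqP; rewrite normr_eq0 (lt_eqF b0).
exists (2 * pi - acos a); first by move: h0 => /andP[? ?]; apply/andP; split; lra.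
have c2 : cos (2 * pi) = 1 :> R by rewrite mulr2n mulrDl mul1r -mulr2n cos2pi.
have s2 : sin (2 * pi) = 0 :> R by rewrite mulr2n mulrDl mul1r -mulr2n sin2pi.
apply: inj; first by rewrite cosB c2 s2 h1; lra.
by rewrite sinB c2 s2 sA sb ltr0_norm //; lra.
Qed.

Lemma circle_lebesgueE (A : set T) :
  circle_lebesgue A = mu ((@expi R) @^-1` A `&` `[0, 2 * pi[).
Proof. by []. Qed.

Lemma ae_circle (P : T -> Prop) (Z : set R) : measurable Z -> mu Z = 0%E ->
  (forall t, 0 <= t < 2 * pi -> ~ Z t -> P (expi t)) ->
  {ae @circle_lebesgue R, forall xi, P xi}.
Proof.
move=> mZ Z0 hP; exists (carg @^-1` Z); split.
- by rewrite -[X in measurable X]setTI; exact: measurable_carg.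
- apply/eqP; rewrite circle_lebesgueE eq_le measure_ge0 andbT -Z0.
  apply: le_measure; rewrite ?inE //.
    apply: measurableI; last exact: measurable_itv.
    rewrite -[X in measurable X]setTI; apply: (measurableT_comp measurable_carg) => //.
    exact: measurable_expi.
  by move=> t [/= h]; rewrite in_itv /= => t2; rewrite carg_expi in h.
- move=> xi /= nP; apply: contrapT => nZ; apply: nP.
  have [t t2 te] := expi_surj xi; rewrite -te; apply: hP => // Zt; apply: nZ.
  by rewrite -te carg_expi.
Qed.

Lemma ae_circleP (P : T -> Prop) : {ae @circle_lebesgue R, forall xi, P xi} ->
  exists Z : set R, [/\ measurable Z, mu Z = 0%E &
    forall t, 0 <= t < 2 * pi -> ~ Z t -> P (expi t)].
Proof.
move=> [B [mB B0 hB]]; exists ((@expi R) @^-1` B `&` `[0, 2 * pi[); split.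
- apply: measurableI; last exact: measurable_itv.
  by rewrite -[X in measurable X]setTI; exact: measurable_expi.
- by rewrite -circle_lebesgueE.
- move=> t t2 nZ; apply: contrapT => nP; apply: nZ; split; last by rewrite /= in_itv.
  exact: hB.
Qed.

End circle_parametrization.

(** * Orthonormal bases of finite-dimensional subspaces *)

Section orthonormal_bases.
Context {R : realType} {H : hilbertType R}.
Local Notation C := R[i].
Implicit Types (M : set H) (x y : H).

Definition orthonormal_basis M m (e : 'I_m -> H) : Prop :=
  [/\ forall i, M (e i), forall i j, inner (e i) (e j) = (i == j)%:R &
      forall x, M x -> x = \sum_i inner x (e i) *: e i].

Lemma subspace_sum M (I : Type) (r : seq I) (a : I -> C) (F : I -> H) :
  subspace_of M -> (forall i, M (F i)) -> M (\sum_(i <- r) a i *: F i).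
Proof.
move=> [M0 ML] MF; elim: r => [|i r IH]; first by rewrite big_nil.
by rewrite big_cons; exact: ML.
Qed.

Lemma inner_suml (I : Type) (r : seq I) (a : I -> C) (F : I -> H) y :
  inner (\sum_(i <- r) a i *: F i) y = \sum_(i <- r) a i * inner (F i) y.
Proof.
elim: r => [|i r IH]; first by rewrite !big_nil inner0l.
by rewrite !big_cons innerDl innerZl IH.
Qed.

Lemma inner_sumr (I : Type) (r : seq I) (a : I -> C) (F : I -> H) y :
  inner y (\sum_(i <- r) a i *: F i) = \sum_(i <- r) (a i)^*%C * inner y (F i).
Proof.
elim: r => [|i r IH]; first by rewrite !big_nil inner0r.
by rewrite !big_cons innerDr innerZr IH.
Qed.

Lemma inner_orthonormal_sum m (e : 'I_m -> H) (a : 'I_m -> C) j :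
  (forall i j, inner (e i) (e j) = (i == j)%:R) ->
  inner (\sum_i a i *: e i) (e j) = a j.
Proof.
move=> oe; rewrite inner_suml (bigD1 j) //= oe eqxx mulr1 big1 ?addr0 //.
by move=> i /negPf ij; rewrite oe ij mulr0.
Qed.

(** Dependent vectors are dropped, hence the separate size [m]. Quantifying over all subspaces that
    contain the [f i] expresses that each [e j] lies in their span. *)
Lemma gram_schmidt n (f : 'I_n -> H) : exists m (e : 'I_m -> H),
  [/\ forall M, subspace_of M -> (forall i, M (f i)) -> forall j, M (e j),
      forall i j, inner (e i) (e j) = (i == j)%:R &
      forall i, f i = \sum_j inner (f i) (e j) *: e j].
Proof.
elim: n f => [|n IH] f.
  by exists 0%N, (fun=> 0); split=> [M _ _ []|[]|[]].
have [m [e [eM oe fe]]] := IH (fun i => f (widen_ord (leqnSn n) i)).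
pose y := f ord_max - \sum_j inner (f ord_max) (e j) *: e j.
have ye j : inner y (e j) = 0.
  by rewrite /y linearBl /= (inner_orthonormal_sum _ _ oe) subrr.
have [y0|y0] := eqVneq y 0.
  exists m, e; split => // [M sM Mf|i]; first by apply: eM => // i.
  have [in_|] := unliftP ord_max i.
    move=> ->; have := fe in_; congr (_ = _); first by congr f; apply: val_inj; rewrite /= /bump leqNgt ltn_ord.
    by apply: eq_bigr => j _; congr (inner (f _) _ *: _); apply: val_inj; rewrite /= /bump leqNgt ltn_ord.
  by move=> ->; apply/eqP; rewrite -subr_eq0 -/y y0.
have sy : 0 < Num.sqrt (sqn y) by rewrite sqrtr_gt0 lt_neqAle sqn_ge0 eq_sym sqn_eq0 y0.
pose u := (Num.sqrt (sqn y))^-1%:C%C *: y.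
have uu : inner u u = 1.
  rewrite inner_sqn sqnZ csq_real exprVn sqr_sqrtr ?sqn_ge0 // mulVf //.
  by rewrite sqn_eq0.
have ue j : inner u (e j) = 0 by rewrite innerZl ye mulr0.
have eu j : inner (e j) u = 0 by rewrite innerJ ue conjc0.
pose e' (j : 'I_m.+1) := if unlift ord_max j is Some j' then e j' else u.
have e'w (j : 'I_m) : e' (widen_ord (leqnSn m) j) = e j.
  rewrite /e' (_ : widen_ord _ j = lift ord_max j) ?liftK //.
  by apply: val_inj; rewrite /= /bump leqNgt ltn_ord.
have e'm : e' ord_max = u by rewrite /e' unlift_none.
exists m.+1, e'; split.
- move=> M sM Mf j; rewrite /e'; case: unliftP => [j' _|_]; first by apply: eM => // i.
  have [M0 ML] := sM; rewrite /u -[_ *: y]addr0; apply: (ML) => //.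
  rewrite /y -scaleN1r addrC; apply: ML => //.
  by apply: subspace_sum => // i; apply: eM => // k.
- move=> i j; rewrite /e'; case: (unliftP ord_max i) => [i' ->|->]; case: (unliftP ord_max j) => [j' ->|->].
  + by rewrite oe (inj_eq (@lift_inj _ _)).
  + by rewrite eu eq_sym (negPf (neq_lift _ _)).
  + by rewrite ue (negPf (neq_lift _ _)).
  + by rewrite uu eqxx.
- move=> i; rewrite big_ord_recr /= e'm.
  rewrite (eq_bigr (fun j => inner (f i) (e j) *: e j)) => [|j _]; last by rewrite e'w.
  have [i'|] := unliftP ord_max i; move=> ->.
    have fi : f (lift ord_max i') = \sum_j inner (f (lift ord_max i')) (e j) *: e j.
      have := fe i'; rewrite (_ : widen_ord _ i' = lift ord_max i') //.
      by apply: val_inj; rewrite /= /bump leqNgt ltn_ord.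
    have fu : inner (f (lift ord_max i')) u = 0.
      by rewrite fi inner_suml big1 // => j _; rewrite eu mulr0.
    by rewrite -fi fu scale0r addr0.
  have fy : f ord_max = y + \sum_j inner (f ord_max) (e j) *: e j by rewrite /y subrK.
  rewrite addrC {1}fy; congr (_ + _).
  rewrite fy innerDl inner_suml [X in _ + X]big1 ?addr0 => [|j _]; last by rewrite eu mulr0.
  rewrite /u innerZr inner_sqn conjc_real -rmorphM scalerA -rmorphM /=.
  have -> : (Num.sqrt (sqn y))^-1 * sqn y * (Num.sqrt (sqn y))^-1 = 1.
    by rewrite -{2}(sqr_sqrtr (sqn_ge0 y)); field; rewrite gt_eqF.
  by rewrite scale1r.
Qed.

Lemma has_dim_subspace M n : has_dim M n -> subspace_of M.
Proof.
move=> [f [_ ->]]; split.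
  by exists (fun=> 0) => //; rewrite big1 // => i _; rewrite scale0r.
move=> a _ _ [c _ <-] [d _ <-]; exists (fun i => a * c i + d i) => //.
rewrite scaler_sumr -big_split; apply: eq_bigr => i _.
by rewrite scalerDl scalerA.
Qed.

Lemma has_dim_orthonormal M n : has_dim M n -> exists m (e : 'I_m -> H), orthonormal_basis M e.
Proof.
move=> dM; have sM := has_dim_subspace dM; have [f [free ME]] := dM.
have Mf i : M (f i).
  rewrite ME; exists (fun j => (j == i)%:R) => //.
  rewrite (bigD1 i) //= eqxx scale1r big1 ?addr0 // => j /negPf ->.
  by rewrite scale0r.
have [m [e [eM oe fe]]] := gram_schmidt f.
exists m, e; split => //; first exact: eM.
move=> x; rewrite ME => -[c _ <-].
transitivity (\sum_i \sum_j (c i * inner (f i) (e j)) *: e j).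
  by apply: eq_bigr => i _; rewrite {1}fe scaler_sumr; apply: eq_bigr => j _; rewrite scalerA.
rewrite exchange_big; apply: eq_bigr => j _ /=.
by rewrite inner_suml scaler_suml.
Qed.

Lemma csq_inner_orthonormal m (e : 'I_m -> H) i x :
  (forall i j, inner (e i) (e j) = (i == j)%:R) -> csq (inner x (e i)) <= sqn x.
Proof.
move=> oe; apply: le_trans (csq_inner_le _ _) _.
have -> : sqn (e i) = 1 by rewrite /sqn /rip oe eqxx.
by rewrite mulr1.
Qed.

Lemma linear_on_sum M (T : H -> H) (I : Type) (r : seq I) (a : I -> C) (F : I -> H) :
  subspace_of M -> (forall (c : C) x y, M x -> M y -> T (c *: x + y) = c *: T x + T y) ->
  (forall i, M (F i)) -> T (\sum_(i <- r) a i *: F i) = \sum_(i <- r) a i *: T (F i).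
Proof.
move=> sM lT MF; have [M0 _] := sM.
have T0 : T 0 = 0 by have := lT (-1) 0 0 M0 M0; rewrite scaler0 addr0 scaleN1r addNr.
elim: r => [|i r IH]; first by rewrite !big_nil T0.
by rewrite !big_cons lT ?IH //; exact: subspace_sum.
Qed.

Lemma norm_inner_le x y : `|inner x y| <= `|x| * `|y|.
Proof.
rewrite !norm_sqn -rmorphM /= ler_normc ?mulr_ge0 ?sqrtr_ge0 //.
by rewrite exprMn !sqr_sqrtr ?sqn_ge0 // csq_inner_le.
Qed.

Lemma finite_rank_bounded m (u v : 'I_m -> H) :
  exists k : C, forall x, `|\sum_i inner x (u i) *: v i| <= k * `|x|.
Proof.
exists (\sum_i `|u i| * `|v i|) => x; rewrite mulr_suml.
apply: le_trans (ler_norm_sum _ _ _) _; apply: ler_sum => i _.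
by rewrite normrZ mulrAC; apply: ler_wpM2r => //; rewrite mulrC norm_inner_le.
Qed.

Lemma finite_rank_linear m (u v : 'I_m -> H) (a : C) x y :
  \sum_i inner (a *: x + y) (u i) *: v i =
  a *: (\sum_i inner x (u i) *: v i) + \sum_i inner y (u i) *: v i.
Proof.
rewrite scaler_sumr -big_split; apply: eq_bigr => i _ /=.
by rewrite innerDl innerZl scalerDl scalerA.
Qed.

End orthonormal_bases.

Section boundary_values.
Context {R : realType} {H : hilbertType R}.
Local Notation C := R[i].
Local Notation mu := (@lebesgue_measure R).
Implicit Types (M N : set H) (F : C -> H -> H) (T : H -> H) (t : R).

Lemma posC_real (K : C) : 0 < K -> exists2 k : R, 0 < k & K = k%:C%C.
Proof. by case: K => a b; rewrite ltcE /= => /andP[/eqP -> a0]; exists a. Qed.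

Definition rad n : R := 1 - n.+2%:R^-1.

Lemma rad_bounds n : 0 < rad n < 1.
Proof.
rewrite /rad subr_gt0 invf_lt1 // ltr1n /= gtrBl invr_gt0 //.
Qed.

Lemma csq_rad n t : csq ((rad n)%:C%C * cis t) = rad n ^+ 2.
Proof. by rewrite csqM csq_cis csq_real mulr1. Qed.

Lemma csq_rad_lt1 n t : csq ((rad n)%:C%C * cis t) < 1.
Proof. by rewrite csq_rad; have /andP[? ?] := rad_bounds n; rewrite expr_lt1 // ltW. Qed.

Lemma rad_near (delta : R) : 0 < delta -> exists k, forall n, (k <= n)%N -> 1 - rad n < delta.
Proof.
move=> d0; exists (Num.bound delta^-1) => n Nn; rewrite /rad subKr.
rewrite invf_plt ?posrE //; apply: lt_le_trans (archi_boundP _) _; first by rewrite invr_ge0 ltW.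
by rewrite ler_nat (leq_trans Nn) // leqW // leqW.
Qed.

(** The radius lies in the Stolz angle with constant 2, where the distance to the vertex is
    [1 - r]. *)
Lemma nontangential_radial M F t T x : M x -> nontangential_limit M F (cis t) T ->
  forall eps : R, 0 < eps -> exists k, forall n, (k <= n)%N ->
    `|F ((rad n)%:C%C * cis t) x - T x| <= (eps * Num.sqrt (sqn x))%:C%C.
Proof.
move=> Mx lim eps eps0.
have [||_ /posC_real[d d0 ->] hd] := lim 2%:R%:C%C eps%:C%C.
- by rewrite -(rmorph0 (real_complex R)) ltcR.
- by rewrite -(rmorph0 (real_complex R)) ltcR.
have [N hN] := rad_near d0; exists N => n Nn; have {}hN := hN n Nn.
have /andP[r0 r1] := rad_bounds n.
have [|c1 c2] := @cabs_radial _ (rad n) t; first by rewrite !ltW.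
rewrite rmorphM /= -norm_sqn; apply: hd => //; rewrite !cabsE ?c1 ?c2.
- by rewrite -(rmorph1 (real_complex R)) ltcR.
- by rewrite -(rmorph1 (real_complex R)) -rmorphB -rmorphM ltcR; lra.
- by rewrite ltcR.
Qed.

Lemma boundary_valueP M N F (xi : C) :
  (operator_on M N (boundary_value M N F xi) /\
   nontangential_limit M F xi (boundary_value M N F xi)) \/
  (boundary_value M N F xi = (fun=> 0) /\
   forall T, operator_on M N T -> ~ nontangential_limit M F xi T).
Proof.
rewrite /boundary_value; set P := [set T | _]; have [h|[-> nP]] := xgetVP (fun=> 0) P; first by left.
by right; split => // T oT hT; apply: (nP T).
Qed.

Variables U W D Wi : {linear H -> H}.
Hypothesis UW : perturbation_of U W D Wi.

Lemma Theta_nontangential_ae (d : H) : D d = d ->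
  {ae mu, forall t, 0 <= t < 2 * pi ->
    exists l, has_nontangential_limit (fun z => Theta U z d) t l}.
Proof.
move=> dd.
have [z e z1 e0|Z [mZ Z0 hZ]] := @power_series_nontangential_ae _ _ (Theta_coef U W D Wi d) (sqn d)
   (fun z => Theta U z d) (sum_sqn_Theta_coef_le UW d).
  have z01 : 0 <= csq z < 1 by rewrite csq_ge0.
  have [N hN] := Theta_series_cvg UW z01 e0 dd; exists N.+1 => -[//|n] Nn.
  exact: hN.
exists Z; split => // t /= nP; apply: contrapT => nZ; apply: nP => /andP[t0 t2].
by apply: hZ => //; rewrite t0 ltW.
Qed.

(** Finite dimension upgrades the limits on basis vectors to a limit in operator norm. *)
Lemma Theta_boundary_ae m (e : 'I_m -> H) : orthonormal_basis (defect U) e ->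
  {ae mu, forall t, 0 <= t < 2 * pi ->
    exists T, operator_on (defect U) (defect_star U) T /\
      nontangential_limit (defect U) (Theta U) (cis t) T}.
Proof.
move=> [eM oe eE].
have De i : D (e i) = e i by have := eM i; rewrite (defectE UW).
have : {ae mu, forall t, forall i, 0 <= t < 2 * pi ->
    exists l, has_nontangential_limit (fun z => Theta U z (e i)) t l}.
  apply: filter_forall => i; exact: Theta_nontangential_ae.
apply: (@filterS _ _ (ae_filter_ringOfSetsType mu)) => t ht t2.
have /choice[l hl] : forall i, exists l, has_nontangential_limit (fun z => Theta U z (e i)) t l.
  by move=> i; exact: ht.
exists (fun x => \sum_i inner x (e i) *: l i).
have lim : nontangential_limit (defect U) (Theta U) (cis t) (fun x => \sum_i inner x (e i) *: l i).
  move=> _ _ /posC_real[K K0 ->] /posC_real[eps eps0 ->].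
  have em0 : 0 < eps / m.+1%:R by rewrite divr_gt0.
  have /choice[d hd] : forall i, exists d : R, 0 < d /\ forall z, csq z < 1 -> cabs (z - cis t) < K * (1 - cabs z) ->
      cabs (z - cis t) < d -> `|Theta U z (e i) - l i| <= (eps / m.+1%:R)%:C%C.
    by move=> i; have [d d0 h] := hl i K _ K0 em0; exists d.
  (* The inverse of [1 + sum 1 / d i] lies below every [d i] and is positive even for an empty
     basis. *)
  have [delta delta0 hdelta] : exists2 delta : R, 0 < delta & forall i, delta <= d i.
    exists (1 + \sum_i (d i)^-1)^-1 => [|i].
      rewrite invr_gt0 ltr_pwDl // sumr_ge0 // => i _.
      by rewrite invr_ge0 ltW //; have [] := hd i.
    have [di0 _] := hd i.
    rewrite invf_ple ?posrE //; last first.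
      by rewrite ltr_pwDl // sumr_ge0 // => k _; rewrite invr_ge0 ltW //; have [] := hd k.
    rewrite (bigD1 i) //= addrCA lerDl addr_ge0 // sumr_ge0 // => k _.
    by rewrite invr_ge0 ltW //; have [] := hd k.
  exists delta%:C%C; first by rewrite -(rmorph0 (real_complex R)) ltcR.
  move=> z; rewrite !cabsE -(rmorph1 (real_complex R)) -rmorphB -rmorphM !ltcR => z1 zK zd x Mx.
  have {}z1 : csq z < 1 by rewrite -cabs_lt1.
  have ThS : Theta U z x = \sum_i inner x (e i) *: Theta U z (e i).
    have sM : subspace_of (defect U).
      split=> [|a u v]; rewrite !(defectE UW) ?linear0 // => Du Dv.
      by rewrite linearP /= Du Dv.
    rewrite {1}(eE x Mx) (linear_on_sum (M := defect U)) // => a u v.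
    by rewrite !(defectE UW); exact: (Theta_linear UW).
  rewrite ThS -sumrB; apply: le_trans (ler_norm_sum _ _ _) _.
  apply: (@le_trans _ _ (\sum_(i < m) (eps / m.+1%:R * Num.sqrt (sqn x))%:C%C)).
    apply: ler_sum => i _; rewrite -scalerBr normrZ mulrC rmorphM /=.
    apply: ler_pM => //.
      have [_ h] := hd i; apply: h => //; exact: lt_le_trans zd (hdelta i).
    by rewrite cabsE lecR ler_wsqrtr // (csq_inner_orthonormal _ _ oe).
  rewrite -rmorph_sum norm_sqn -rmorphM lecR sumr_const card_ord -mulrnAl.
  rewrite ler_wpM2r ?sqrtr_ge0 // -mulrnAr ler_piMr ?(ltW eps0) //.
  by rewrite -[X in X *+ m]mul1r -mulrnAl ler_pdivrMr // mul1r ler_nat.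
split => //; split.
- move=> x Mx; rewrite (defect_starE UW).
  have [P PE] : exists P : {linear H -> H}, (fun y => W (D (Wi y))) = P.
    by apply: linear_pack => a u v; do 3 rewrite linearP /=.
  have {PE} PE y : W (D (Wi y)) = P y by rewrite -PE.
  rewrite PE; set T := \sum_i _.
  apply/eqP; rewrite -subr_eq0; apply/eqP.
  (* The limit stays in the range of the projection [P = W D Wi], because it is a limit of values
     that [P] fixes. *)
  suff : `|P T - T| <= 0 by rewrite normr_le0 => /eqP.
  apply/ler_addgt0Pr => _ /posC_real[eps eps0 ->]; rewrite add0r.
  pose s := Num.sqrt (sqn x) + 1.
  have s0 : 0 < s by rewrite ltr_wpDl ?sqrtr_ge0.
  have [|N /(_ N (leqnn N))] := nontangential_radial Mx lim (_ : 0 < eps / 2 / s).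
    by rewrite !divr_gt0.
  set Th := Theta U _ x; rewrite -/T => h.
  have {}h : `|Th - T| <= (eps / 2)%:C%C.
    apply: le_trans h _; rewrite lecR mulrAC ler_pdivrMr // ler_wpM2l ?lerDl //.
    by rewrite divr_ge0 // ltW.
  have PTh : P Th = Th.
    rewrite -PE -(defect_starE UW); apply: (Theta_defect_star UW); first exact: csq_rad_lt1.
    by have := Mx; rewrite (defectE UW).
  have -> : P T - T = P (T - Th) + (Th - T) by rewrite linearB /= PTh addrA subrK.
  apply: le_trans (ler_normD _ _) _; rewrite (splitr eps) rmorphD /=.
  apply: lerD => //; apply: le_trans h; rewrite distrC ler_norm_sqn -PE.
  by rewrite (sqnW UW) (le_trans (sqn_proj_le UW _)) // (sqnWi UW).
- by move=> a x y _ _; exact: finite_rank_linear.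
- by have [k hk] := finite_rank_bounded e l; exists k => x _; exact: hk.
Qed.

End boundary_values.

(** * Singular spectral measures *)

Section measurable_sections.
Context {R : realType}.
Local Notation C := R[i].
Local Notation T := (borel_circle R).
Variables (E : T -> hilbertType R) (e : nat -> forall xi, E xi).
Hypothesis fe : fundamental_sequence e.
Implicit Types (f g : forall xi, E xi) (xi : T).

Lemma measurable_complexD (f g : T -> C) : measurable_complex f ->
  measurable_complex g -> measurable_complex (fun xi => f xi + g xi).
Proof.
move=> [rf jf] [rg jg]; split.
  rewrite (_ : (fun xi => _) = (fun xi => Re (f xi)) \+ (fun xi => Re (g xi))).
    exact: measurable_funD.
  by apply/funext => xi /=; case: (f xi) (g xi) => [? ?] [].
rewrite (_ : (fun xi => _) = (fun xi => Im (f xi)) \+ (fun xi => Im (g xi))).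
  exact: measurable_funD.
by apply/funext => xi /=; case: (f xi) (g xi) => [? ?] [].
Qed.

Lemma measurable_complexM (f g : T -> C) : measurable_complex f ->
  measurable_complex g -> measurable_complex (fun xi => f xi * g xi).
Proof.
move=> [rf jf] [rg jg]; split.
  rewrite (_ : (fun xi => _) = (fun xi => Re (f xi)) \* (fun xi => Re (g xi)) \-
      (fun xi => Im (f xi)) \* (fun xi => Im (g xi))).
    by apply: measurable_funB; exact: measurable_funM.
  by apply/funext => xi /=; case: (f xi) (g xi) => [? ?] [].
rewrite (_ : (fun xi => _) = (fun xi => Re (f xi)) \* (fun xi => Im (g xi)) \+
    (fun xi => Im (f xi)) \* (fun xi => Re (g xi))).
  by apply: measurable_funD; exact: measurable_funM.
by apply/funext => xi /=; case: (f xi) (g xi) => [? ?] [].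
Qed.

Lemma measurable_complex_cst (a : C) : measurable_complex (fun _ : T => a).
Proof. by split; exact: measurable_cst. Qed.

Lemma measurable_complex_sum (I : Type) (s : seq I) (F : I -> T -> C) :
  (forall i, measurable_complex (F i)) ->
  measurable_complex (fun xi => \sum_(i <- s) F i xi).
Proof.
move=> mF; elim: s => [|i s IH].
  rewrite (_ : (fun xi => _) = fun=> 0); first exact: measurable_complex_cst.
  by apply/funext => xi; rewrite big_nil.
rewrite (_ : (fun xi => _) = fun xi => F i xi + \sum_(j <- s) F j xi).
  exact: measurable_complexD.
by apply/funext => xi; rewrite big_cons.
Qed.

Lemma measurable_section_e k : measurable_section e (e k).
Proof. by move=> j; case: fe. Qed.

Lemma measurable_sectionZ (a : T -> C) f : measurable_complex a -> measurable_section e f ->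
  measurable_section e (fun xi => a xi *: f xi).
Proof.
move=> ma mf k.
rewrite (_ : (fun xi => _) = fun xi => a xi * inner (f xi) (e k xi)).
  exact: measurable_complexM.
by apply/funext => xi; rewrite innerZl.
Qed.

(* Countably many sections, dense in every fibre: [sqn (f xi)] is a supremum
   over them, hence measurable. *)
Definition rational_section (s : seq (rat * rat)) xi : E xi :=
  \sum_(k < size s) Complex (ratr (nth 0 s k).1) (ratr (nth 0 s k).2) *: e k xi.

Lemma measurable_inner_rational f s : measurable_section e f ->
  measurable_fun setT (fun xi => rip (f xi) (rational_section s xi)).
Proof.
move=> mf; pose a (k : nat) : C := (Complex (ratr (nth 0 s k).1) (ratr (nth 0 s k).2))^*%C.
have [h _] : measurable_complex (fun xi => \sum_(k < size s) a k * inner (f xi) (e k xi)).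
  apply: measurable_complex_sum => k; apply: measurable_complexM; last exact: mf.
  exact: measurable_complex_cst.
rewrite (_ : (fun xi => _) = fun xi => Re (\sum_(k < size s) a k * inner (f xi) (e k xi))) //.
by apply/funext => xi; rewrite /rip /rational_section inner_sumr.
Qed.

Lemma measurable_rational_section s : measurable_section e (rational_section s).
Proof.
move=> j; rewrite (_ : (fun xi => _) = fun xi => \sum_(k < size s)
  Complex (ratr (nth 0 s k).1) (ratr (nth 0 s k).2) * inner (e k xi) (e j xi)).
  apply: measurable_complex_sum => k; apply: measurable_complexM; last exact: measurable_section_e.
  exact: measurable_complex_cst.
by apply/funext => xi; rewrite /rational_section inner_suml.
Qed.

Lemma rat_approx (x eps : R) : 0 < eps -> exists q : rat, (x - ratr q) ^+ 2 < eps.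
Proof.
move=> e0; have s0 : 0 < Num.sqrt eps by rewrite sqrtr_gt0.
have [q] := @rat_in_itvoo R (x - Num.sqrt eps) (x + Num.sqrt eps) ltac:(lra).
rewrite in_itv /= => /andP[q1 q2]; exists q.
rewrite -(sqr_sqrtr (ltW e0)) -real_normK ?num_real // ltr_sqr ?nnegrE ?normr_ge0 ?(ltW s0) //.
by rewrite ltr_norml; apply/andP; split; lra.
Qed.

Lemma rational_section_dense xi (x : E xi) (eps : R) : 0 < eps ->
  exists s, sqn (x - rational_section s xi) < eps.
Proof.
move=> e0; have [_ /(_ xi) dE] := fe.
have h0 : 0 < eps / 4 by rewrite divr_gt0.
have s0 : 0 < Num.sqrt (eps / 4) by rewrite sqrtr_gt0.
have [] := dE (ball x (Num.sqrt (eps / 4))%:C%C).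
- by exists x; apply: ballxx; rewrite -(rmorph0 (real_complex R)) ltcR.
- by apply: ball_open; rewrite -(rmorph0 (real_complex R)) ltcR.
move=> y [xy [n [c yE]]].
have xy4 : sqn (x - y) < eps / 4.
  move: xy; rewrite -ball_normE /= norm_sqn ltcR => xy.
  by rewrite -(sqr_sqrtr (sqn_ge0 (x - y))) -(sqr_sqrtr (ltW h0)) ltr_sqr ?nnegrE ?sqrtr_ge0.
(* The factor by which coefficient errors are amplified, by [sqn_sum_le]; the added 1 makes division
   by it legitimate. *)
pose K := n%:R * (\sum_(k < n) sqn (e k xi)) + 1.
have K0 : 0 < K.
  by rewrite ltr_wpDl // mulr_ge0 // sumr_ge0 // => k _; exact: sqn_ge0.
have d0 : 0 < eps / 8 / K by rewrite !divr_gt0.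
have /choice[q hq] : forall k, exists q : rat * rat, csq (c k - Complex (ratr q.1) (ratr q.2)) < eps / 4 / K.
  move=> k; have [q1 h1] := rat_approx (Re (c k)) d0; have [q2 h2] := rat_approx (Im (c k)) d0.
  exists (q1, q2); case: (c k) h1 h2 => a b /= h1 h2; rewrite /csq /=.
  have -> : eps / 4 / K = eps / 8 / K + eps / 8 / K by field; rewrite gt_eqF.
  exact: ltrD.
exists (mkseq q n).
have sE : rational_section (mkseq q n) xi = \sum_(k < n) Complex (ratr (q k).1) (ratr (q k).2) *: e k xi.
  rewrite /rational_section -(big_mkord xpredT (fun k => Complex (ratr (nth 0 (mkseq q n) k).1)
    (ratr (nth 0 (mkseq q n) k).2) *: e k xi)) size_mkseq big_mkord.
  by apply: eq_bigr => k _; rewrite nth_mkseq.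
have yq : sqn (y - rational_section (mkseq q n) xi) <= eps / 4.
  rewrite yE sE -sumrB; apply: le_trans (sqn_sum_le _) _.
  apply: (@le_trans _ _ (n%:R * \sum_(k < n) (eps / 4 / K * sqn (e k xi)))).
    rewrite ler_wpM2l //; apply: ler_sum => k _.
    by rewrite -scalerBl sqnZ ler_wpM2r ?sqn_ge0 // ltW.
  rewrite -mulr_sumr mulrCA mulrAC -(mulrA (eps / 4)) ler_piMr ?(ltW h0) //.
  by rewrite ler_pdivrMr // mul1r /K lerDl.
have := sqnD_le (x - y) (y - rational_section (mkseq q n) xi).
rewrite addrA subrK; lra.
Qed.

Lemma measurable_sqn_section f : measurable_section e f ->
  measurable_fun setT (fun xi => sqn (f xi)).
Proof.
move=> mf; apply: (measurability _ (RGenOInfty.measurableE R)).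
move=> _ [_ [a ->] <-]; rewrite setTI.
(* This is [|f|^2 - |f - r_s|^2], at most [|f|^2] and arbitrarily close to it, and [f] enters only
   through inner products. *)
pose h (s : seq (rat * rat)) xi := 2 * rip (f xi) (rational_section s xi) - sqn (rational_section s xi).
have mh s : measurable_fun setT (h s).
  apply: measurable_funB; first by apply: measurable_funM => //; exact: measurable_inner_rational.
  exact: (measurable_inner_rational s (measurable_rational_section s)).
have hE s xi : h s xi = sqn (f xi) - sqn (f xi - rational_section s xi) by rewrite /h sqnB; ring.
have [q qs] : exists q : nat -> seq (rat * rat), forall s, exists k, q k = s.
  exists (fun k => odflt [::] (unpickle k)) => s; exists (pickle s).
  by rewrite pickleK.
have -> : (fun xi => sqn (f xi)) @^-1` `]a, +oo[%classic = \bigcup_k [set xi | a < h (q k) xi].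
  apply/seteqP; split=> xi /=; rewrite ?in_itv /= ?andbT.
    move=> af; have [|s hs] := @rational_section_dense xi (f xi) (sqn (f xi) - a); first by rewrite subr_gt0.
    by have [k qk] := qs s; exists k => //=; rewrite qk hE; lra.
  move=> [k _] /=; rewrite hE.
  by have := sqn_ge0 (f xi - rational_section (q k) xi); lra.
apply: bigcup_measurable => k _; move: (q k) => s.
rewrite -[X in measurable X]setTI.
have -> : [set xi | a < h s xi] = h s @^-1` `]a, +oo[%classic.
  by apply/seteqP; split=> xi /=; rewrite in_itv /= andbT.
by apply: mh => //; exact: measurable_itv.
Qed.

End measurable_sections.

Section spectral_representation.
Context {R : realType} {H : hilbertType R}.
Local Notation C := R[i].
Local Notation T := (borel_circle R).
Variables (mu : {finite_measure set T -> \bar R}) (E : T -> hilbertType R).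
Variables (e : nat -> forall xi, E xi) (V : H -> forall xi, E xi).
Hypothesis fe : fundamental_sequence e.
Hypothesis VU : direct_integral_unitary mu e V.
Implicit Types (x y : H) (xi : T) (z : C).

Lemma measurable_sqn_V x : measurable_fun setT (fun xi => sqn (V x xi)).
Proof. by apply: (measurable_sqn_section fe); case: VU => /(_ x) []. Qed.

Lemma sqnormE (f : forall xi, E xi) : sqnorm mu f = (\int[mu]_xi (sqn (f xi))%:E)%E.
Proof. by apply: eq_integral => xi _; rewrite -sqnE. Qed.

Lemma integral_sqn_V x : (\int[mu]_xi (sqn (V x xi))%:E = (sqn x)%:E)%E.
Proof. by rewrite -sqnormE; case: VU => _ _ -> _; rewrite -sqnE. Qed.

Lemma V_linear (a : C) x y : {ae mu, forall xi, V (a *: x + y) xi = a *: V x xi + V y xi}.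
Proof. by case: VU. Qed.

Lemma V_lincomb (I : Type) (s : seq I) (a : I -> C) (F : I -> H) :
  {ae mu, forall xi, V (\sum_(i <- s) a i *: F i) xi = \sum_(i <- s) a i *: V (F i) xi}.
Proof.
elim: s => [|i s IH].
  apply: filterS (V_linear 1 0 0) => xi.
  by rewrite !big_nil !scale1r addr0 => /eqP; rewrite -subr_eq0 opprD addrA subrr sub0r oppr_eq0 => /eqP.
apply: filterS2 IH (V_linear (a i) (F i) (\sum_(j <- s) a j *: F j)) => xi h.
by rewrite !big_cons h.
Qed.

Variables U W D Wi : {linear H -> H}.
Hypothesis UW : perturbation_of U W D Wi.
Hypothesis VW : forall x, {ae mu, forall xi, V (W x) xi = circle_val xi *: V x xi}.
Variables (m : nat) (b : 'I_m -> H).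
Hypothesis ob : orthonormal_basis (defect U) b.

Definition defect_density xi : R := \sum_i sqn (V (b i) xi).

Lemma defect_density_ge0 xi : 0 <= defect_density xi.
Proof. by apply: sumr_ge0 => i _; exact: sqn_ge0. Qed.

Lemma measurable_defect_density : measurable_fun setT defect_density.
Proof. by apply: measurable_sum => i; exact: measurable_sqn_V. Qed.

Lemma integral_defect_density : (\int[mu]_xi (defect_density xi)%:E < +oo)%E.
Proof.
under eq_integral do rewrite -sumEFin.
rewrite ge0_integral_sum //; first last.
- by move=> i xi _; rewrite lee_fin sqn_ge0.
- by move=> i; apply/measurable_EFinP; exact: measurable_sqn_V.
under eq_bigr do rewrite integral_sqn_V.
by rewrite sumEFin ltry.
Qed.

Definition defect_poisson z xi : R :=
  (1 - csq z) / csq (circle_val xi - z) * defect_density xi.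

Lemma csq_circle_valB_gt0 xi z : csq z < 1 -> 0 < csq (circle_val xi - z).
Proof.
move=> z1; rewrite lt_neqAle csq_ge0 eq_sym csq_eq0 subr_eq0 andbT.
by apply: contraTneq z1 => <-; rewrite csq_circle_val ltxx.
Qed.

Lemma measurable_defect_poisson z : csq z < 1 -> measurable_fun setT (defect_poisson z).
Proof.
move=> z1; apply: measurable_funM; last exact: measurable_defect_density.
apply: measurable_funM => //.
have mc : measurable_fun setT (fun xi => csq (circle_val xi - z)).
  rewrite (_ : (fun xi => _) = fun xi => (Re (circle_val xi) - Re z) ^+ 2 + (Im (circle_val xi) - Im z) ^+ 2).
    apply: measurable_funD; apply: measurable_funX; apply: measurable_funB => //.
      exact: measurable_Re_circle.
    exact: measurable_Im_circle.
  by apply/funext => xi; case: (circle_val xi) z {z1} => [? ?] [].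
rewrite (_ : (fun xi => _) = fun xi => csq (circle_val xi - z) `^ (-1)).
  by apply: (measurableT_comp (measurable_powR _)).
by apply/funext => xi; rewrite powR_inv1 // ltW // csq_circle_valB_gt0.
Qed.

(** With [u] and [c] of [sqn_Theta], fibrewise [V c = (1 - z conj(xi)) V u], so
    [|V u|^2 = |V c|^2 / |xi - z|^2]. Expanding [c] in the basis bounds [|V c|^2] by [m |c|^2] times
    the density. *)
Lemma Theta_defect_poisson z d : csq z < 1 -> D d = d ->
  ((sqn d - sqn (Theta U z d))%:E <=
   (4 * m%:R * sqn d)%:E * \int[mu]_xi (defect_poisson z xi)%:E)%E.
Proof.
move=> z1 dd; have [u [c [Dc cd uc ->]]] := sqn_Theta UW z1 dd.
have z10 : 0 < 1 - csq z by rewrite subr_gt0.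
have kd0 : 0 <= 4 * m%:R * sqn d by rewrite !mulr_ge0 ?sqn_ge0.
have mdp := measurable_defect_poisson z1.
have dp0 xi : 0 <= defect_poisson z xi.
  by rewrite mulr_ge0 ?defect_density_ge0 // divr_ge0 ?csq_ge0 // ltW.
rewrite -ge0_integralZ_fin //.
rewrite EFinM -integral_sqn_V -ge0_integralZ_fin //; first last.
- exact: ltW.
- by move=> xi _; exact: sqn_ge0.
- exact: measurable_sqn_V.
apply: ae_ge0_le_integral => //.
- by move=> xi _; rewrite lee_fin mulr_ge0 ?sqn_ge0 // ltW.
- by apply/measurable_EFinP; apply: measurable_funM => //; exact: measurable_sqn_V.
- by move=> xi _; rewrite lee_fin mulr_ge0.
- by apply/measurable_EFinP; exact: measurable_funM.
have [bM ob' bE] := ob.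
have cb : c = \sum_i inner c (b i) *: b i by apply: bE; rewrite (defectE UW).
have h1 := V_linear (- z) (Wi u) u; have h2 := VW (Wi u).
have h3 := V_lincomb (index_enum 'I_m) (fun i => inner c (b i)) b.
rewrite -cb in h3; rewrite scaleNr addrC uc in h1; rewrite (WK UW) in h2.
apply: filterS2 h3 (filterI h1 h2) => xi vc [h4 h5] _.
rewrite lee_fin /defect_poisson.
have {h5}h5 : V (Wi u) xi = (circle_val xi)^*%C *: V u xi.
  by rewrite h5 scalerA mulrC -sqr_normc -csqE csq_circle_val scale1r.
have vu : csq (circle_val xi - z) * sqn (V u xi) = sqn (V c xi).
  have -> : V c xi = (1 - z * (circle_val xi)^*%C) *: V u xi.
    by rewrite h4 h5 scalerA scalerBl scale1r mulNr scaleNr addrC.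
  rewrite sqnZ.
  congr (_ * _); rewrite -[RHS]mul1r -{1}(csq_circle_val xi) -csqM mulrBr mulr1.
  by rewrite mulrCA -sqr_normc -csqE csq_circle_val mulr1.
have cn : sqn (V c xi) <= m%:R * (sqn c * defect_density xi).
  rewrite vc; apply: le_trans (sqn_sum_le _) _; rewrite ler_wpM2l // /defect_density mulr_sumr.
  apply: ler_sum => i _; rewrite sqnZ ler_wpM2r ?sqn_ge0 //.
  exact: csq_inner_orthonormal.
have q0 := csq_circle_valB_gt0 xi z1.
have -> : 4 * m%:R * sqn d * ((1 - csq z) / csq (circle_val xi - z) * defect_density xi) =
  (1 - csq z) * ((4 * m%:R * sqn d * defect_density xi) / csq (circle_val xi - z)) by field; rewrite gt_eqF.
rewrite ler_wpM2l ?(ltW z10) // ler_pdivlMr // mulrC vu; apply: le_trans cn _.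
have : sqn c * defect_density xi <= 4 * sqn d * defect_density xi.
  by rewrite ler_wpM2r ?defect_density_ge0.
have : (0 : R) <= m%:R by [].
move: (defect_density xi) (m%:R : R) => w k k0 h.
have -> : 4 * k * sqn d * w = k * (4 * sqn d * w) by ring.
by rewrite ler_wpM2l.
Qed.

End spectral_representation.

(** * Radial Poisson integrals of a singular measure *)

Section singular_poisson_integrals.
Context {R : realType}.
Local Notation T := (borel_circle R).
Local Notation leb := (@lebesgue_measure R).
Implicit Types (t : R) (xi : T).

Definition radial_kernel n t xi : R :=
  (1 - csq ((rad n)%:C%C * cis t : R[i])) / csq (circle_val xi - (rad n)%:C%C * cis t).

Lemma radial_kernel_ge0 n t xi : 0 <= radial_kernel n t xi.
Proof. by rewrite divr_ge0 ?csq_ge0 // subr_ge0 ltW // csq_rad_lt1. Qed.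

Lemma csqB_swap (a b : R[i]) (r : R) : csq a = 1 -> csq b = 1 ->
  csq (a - r%:C%C * b) = csq (b - r%:C%C * a).
Proof.
case: a b => [a1 a2] [b1 b2]; rewrite /csq /= => ha hb.
apply/eqP; rewrite -subr_eq0; set x := (X in X == 0).
have -> : x = (1 - r ^+ 2) * ((a1 ^+ 2 + a2 ^+ 2) - (b1 ^+ 2 + b2 ^+ 2)) by rewrite /x; ring.
by rewrite ha hb subrr mulr0.
Qed.

(** The symmetry [|xi - r eta| = |eta - r xi|] on the circle exchanges the two variables, so that
    the integral in [t] is again that of a Poisson kernel. *)
Lemma radial_kernelE n t xi :
  radial_kernel n t xi = poisson ((rad n)%:C%C * circle_val xi) t.
Proof.
rewrite /radial_kernel /poisson csq_rad csqM csq_circle_val csq_real mulr1.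
by rewrite csqB_swap ?csq_cis ?csq_circle_val.
Qed.

Lemma radial_kernel_le n t xi (eta : R) : 0 < eta ->
  eta <= csq (cis t - circle_val xi) -> radial_kernel n t xi <= 8 * (1 - rad n) / eta.
Proof.
move=> eta0 heta; have /andP[r0 r1] := @rad_bounds R n.
have x1 : csq (circle_val xi) = 1 := csq_circle_val xi.
set r := rad n in r0 r1 *; pose z : R[i] := r%:C%C * circle_val xi.
have cz : csq z = r ^+ 2 by rewrite csqM x1 csq_real mulr1.
have z1 : csq z < 1 by rewrite cz expr_lt1 // ltW.
have cabsz : cabs z = r by rewrite /cabs cz sqrtr_sqr ger0_norm // ltW.
rewrite radial_kernelE /poisson -/r -/z cz.
have c0 : 0 < csq (cis t - z) by exact: csq_cisB_gt0.
have h1 : 1 - r <= cabs (cis t - z).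
  by rewrite lerBlDr -(cabs_cis t) -{1}(subrK z (cis t)) -cabsz cabsD.
have h2 : cabs (cis t - circle_val xi) <= 2 * cabs (cis t - z).
  rewrite -(subrK z (cis t)) -addrA; apply: le_trans (cabsD _ _) _; rewrite subrK.
  have -> : cabs (z - circle_val xi) = 1 - r.
    rewrite /z -{2}(mul1r (circle_val xi)) -mulrBl -(rmorph1 (real_complex R)) -rmorphB.
    by rewrite /cabs csqM x1 mulr1 csq_real -sqrrN opprB sqrtr_sqr ger0_norm // subr_ge0 ltW.
  lra.
have h3 : eta <= 4 * csq (cis t - z).
  apply: le_trans heta _; rewrite -!sqr_cabs.
  have -> : 4 * cabs (cis t - z) ^+ 2 = (2 * cabs (cis t - z)) ^+ 2 by ring.
  by rewrite ler_sqr ?nnegrE ?cabs_ge0 // mulr_ge0 ?cabs_ge0.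
rewrite ler_pdivrMr // mulrAC ler_pdivlMr //.
have -> : 8 * (1 - r) * csq (cis t - z) = (1 - r) * 2 * (4 * csq (cis t - z)) by ring.
have -> : 1 - r ^+ 2 = (1 - r) * (1 + r) by ring.
apply: ler_pM => //; last by rewrite ler_wpM2l ?subr_ge0 ?(ltW r1) //; lra.
- by rewrite mulr_ge0 //; lra.
- exact: ltW.
Qed.

Lemma cvg_rad : (fun n => 1 - rad n : R) @ \oo --> (0 : R).
Proof.
apply/cvgrPdist_lt => e e0; have [k hk] := rad_near e0; exists k => // n /= kn.
have /andP[r0 r1] := @rad_bounds R n.
by rewrite sub0r normrN ger0_norm ?hk // subr_ge0 ltW.
Qed.

Lemma measurable_radial_kernel n :
  measurable_fun setT (fun p : R * T => radial_kernel n p.1 p.2).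
Proof.
have mcos : measurable_fun setT (fun p : R * T => cos p.1).
  apply: (measurableT_comp (f := @cos R)) => //.
  by apply: continuous_measurable_fun; exact: continuous_cos.
have msin : measurable_fun setT (fun p : R * T => sin p.1).
  apply: (measurableT_comp (f := @sin R)) => //.
  by apply: continuous_measurable_fun; exact: continuous_sin.
have mRe : measurable_fun setT (fun p : R * T => Re (circle_val p.2)).
  by apply: (measurableT_comp (@measurable_Re_circle R)).
have mIm : measurable_fun setT (fun p : R * T => Im (circle_val p.2)).
  by apply: (measurableT_comp (@measurable_Im_circle R)).
rewrite (_ : (fun p => _) = fun p : R * T => (1 - rad n ^+ 2) *
  (((Re (circle_val p.2) - rad n * cos p.1) ^+ 2 + (Im (circle_val p.2) - rad n * sin p.1) ^+ 2) `^ (-1))).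
  apply: measurable_funM => //; apply: (measurableT_comp (measurable_powR _)).
  apply: measurable_funD; apply: measurable_funX; apply: measurable_funB => //; exact: measurable_funM.
apply/funext => -[t xi]; rewrite /radial_kernel csq_rad powR_inv1 ?addr_ge0 ?sqr_ge0 //.
congr (_ / _); rewrite /csq /=; case: (circle_val xi) => a b /=.
by rewrite !mul0r subr0 addr0.
Qed.

Lemma integral_radial_kernel (H : hilbertType R) (v : H) n xi (K : set R) :
  v != 0 -> measurable K -> K `<=` `[0, 2 * pi[ ->
  (\int[leb]_(t in K) (radial_kernel n t xi)%:E <= (8 * pi)%:E)%E.
Proof.
move=> v0 mK K2.
have z1 : csq ((rad n)%:C%C * circle_val xi) < 1.
  by have := @csq_rad_lt1 R n 0; rewrite csq_rad csqM csq_circle_val csq_real mulr1.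
under eq_integral do rewrite radial_kernelE.
apply: le_trans (integral_poisson_le 0 v0 z1); rewrite add0r.
apply: ge0_subset_integral => //.
- by apply/measurable_EFinP; exact: measurable_poisson.
- by move=> t _; rewrite lee_fin poisson_ge0.
- by move=> t /K2; rewrite /= !in_itv /= => /andP[-> /ltW].
Qed.

Lemma compact_dist (K : set R) xi : compact K -> (forall t, K t -> expi t <> xi) ->
  exists2 eta : R, 0 < eta & forall t, K t -> eta <= csq (cis t - circle_val xi).
Proof.
move=> cK Kxi; pose f t := csq (cis t - circle_val xi).
have cf : compact (f @` K).
  by apply: continuous_compact => //; apply: continuous_subspaceT; exact: continuous_csq_cisB.
have n0 : ~ (f @` K) 0.
  move=> [t Kt /eqP]; rewrite /f csq_eq0 subr_eq0 => /eqP ct; apply: (Kxi t Kt).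
  by apply: val_inj; exact: ct.
have oC : open (~` (f @` K)).
  by apply: closed_openC; apply: compact_closed => //; exact: Rhausdorff.
have := open_nbhs_nbhs (conj oC n0) => /nbhs_ballP [eta /= eta0 heta].
exists eta => // t Kt; rewrite leNgt; apply/negP => h.
apply: (heta (f t)); last by exists t.
by rewrite /ball /= sub0r normrN ger0_norm // csq_ge0.
Qed.

Variables (mu : {finite_measure set T -> \bar R}) (w : T -> R).
Hypotheses (mw : measurable_fun setT w) (w0 : forall xi, 0 <= w xi)
  (iw : (\int[mu]_xi (w xi)%:E < +oo)%E).

Definition radial_average n t : \bar R := (\int[mu]_xi (radial_kernel n t xi * w xi)%:E)%E.

Lemma measurable_weighted_kernel n (K : set R) : measurable K ->
  measurable_fun setT (fun p : R * T => (\1_K p.1 * (radial_kernel n p.1 p.2 * w p.2))%:E).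
Proof.
move=> mK; apply/measurable_EFinP; apply: measurable_funM.
  by apply: (measurableT_comp (f := (\1_K : R -> R))) => //; exact: measurable_indic.
apply: measurable_funM; first exact: measurable_radial_kernel.
exact: (measurableT_comp mw).
Qed.

Lemma weighted_kernel_ge0 n (K : set R) t xi : 0 <= \1_K t * (radial_kernel n t xi * w xi).
Proof. by apply: mulr_ge0 => //; apply: mulr_ge0 => //; exact: radial_kernel_ge0. Qed.

Lemma measurable_radial_average n : measurable_fun setT (radial_average n).
Proof.
have := measurable_fun_fubini_tonelli_F (m2 := mu) _ (measurable_weighted_kernel n measurableT).
rewrite /fubini_F (_ : (fun x => _) = radial_average n).
  by apply => -[t xi]; rewrite lee_fin weighted_kernel_ge0.
by apply/funext => t; apply: eq_integral => xi _ /=; rewrite indicT /= mul1r.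
Qed.

(** After Tonelli, the integral of the kernel over [K] is bounded by [8 * pi] and tends to 0 at each
    point off the compact arc set, hence off the [mu]-null set [A]. Dominated convergence
    concludes. *)
Lemma integral_radial_average_cvg0 (H : hilbertType R) (v : H) (K : set R) (A : set T) :
  v != 0 -> compact K -> K `<=` `[0, 2 * pi[ -> measurable A -> mu A = 0%E ->
  (forall t, K t -> A (expi t)) ->
  (fun n => \int[leb]_(t in K) radial_average n t)%E @ \oo --> 0%E.
Proof.
move=> v0 cK K2 mA A0 KA.
have mK : measurable K by exact: compact_measurable.
pose G n xi := (\int[leb]_t (\1_K t * (radial_kernel n t xi * w xi))%:E)%E.
have swap n : (\int[leb]_(t in K) radial_average n t = \int[mu]_xi G n xi)%E.
  have := fubini_tonelli (m1 := leb) (m2 := mu) _ (measurable_weighted_kernel n mK).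
  rewrite /fubini_F /fubini_G => <-; last by move=> -[t xi]; rewrite lee_fin weighted_kernel_ge0.
  rewrite [LHS]integral_mkcond; apply: eq_integral => t _; rewrite patchE.
  case: ifPn => tK; rewrite /= indicE; last by rewrite (negPf tK) integral0_eq // => xi _; rewrite mul0r.
  by rewrite tK; apply: eq_integral => xi _; rewrite mul1r.
have GE n xi : G n xi = ((w xi)%:E * \int[leb]_(t in K) (radial_kernel n t xi)%:E)%E.
  rewrite -ge0_integralZ_fin //; last 2 first.
  - by have := measurableT_comp (@measurable_radial_kernel n) (@pair2_measurable _ _ R T xi); move=> h; apply: measurable_funTS.
  - by move=> t _; exact: radial_kernel_ge0.
  rewrite [RHS]integral_mkcond; apply: eq_integral => t _; rewrite patchE indicE.
  by case: ifPn => _; rewrite ?mul1r ?mul0r // mulrC.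
have lek n xi : (\int[leb]_(t in K) (radial_kernel n t xi)%:E <= (8 * pi)%:E)%E.
  exact: integral_radial_kernel v0 mK K2.
under eq_fun do rewrite swap.
have mG n : measurable_fun setT (G n).
  have := measurable_fun_fubini_tonelli_G (m1 := leb) _ (measurable_weighted_kernel n mK).
  by apply => -[t xi]; rewrite lee_fin weighted_kernel_ge0.
have ig : mu.-integrable setT (fun xi => ((8 * pi) * w xi)%:E).
  apply/integrableP; split; first by apply/measurable_EFinP; exact: measurable_funM.
  under eq_integral do rewrite /= ger0_norm ?mulr_ge0 ?pi_ge0 //.
  by rewrite ge0_integralZ_fin ?mulr_ge0 ?pi_ge0 // lte_mul_pinfty ?lee_fin ?mulr_ge0 ?pi_ge0.
have Gbd n xi : (0 <= G n xi <= ((8 * pi) * w xi)%:E)%E.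
  rewrite GE; apply/andP; split.
    by apply: mule_ge0; [rewrite lee_fin|apply: integral_ge0 => t _; rewrite lee_fin radial_kernel_ge0].
  by rewrite mulrC EFinM; apply: lee_wpmul2l; rewrite ?lee_fin.
have Gcvg xi : ~ A xi -> G ^~ xi @ \oo --> 0%E.
  move=> nA; have [|eta eta0 heta] := @compact_dist K xi cK.
    by move=> t Kt te; apply: nA; rewrite -te; exact: KA.
  have ub n : (G n xi <= (w xi * (8 * (1 - rad n) / eta) * fine (leb K))%:E)%E.
    rewrite GE -mulrA EFinM; apply: lee_wpmul2l; first by rewrite lee_fin.
    apply: (@le_trans _ _ (\int[leb]_(t in K) (8 * (1 - rad n) / eta)%:E)%E).
      apply: ge0_le_integral_fin => //.
        have := measurableT_comp (@measurable_radial_kernel n) (@pair2_measurable _ _ R T xi).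
        by move=> h; apply: measurable_funTS.
      by move=> t Kt; rewrite radial_kernel_ge0 radial_kernel_le // heta.
    have fK : leb K \is a fin_num by rewrite ge0_fin_numE //; exact: compact_finite_measure.
    by rewrite [leRHS]EFinM fineK // integral_cst.
  apply: (@squeeze_cvge _ _ _ _ (cst 0%E) _ (fun n => (w xi * (8 * (1 - rad n) / eta) * fine (leb K))%:E)).
  - by apply: nearW => n; rewrite ub andbT; case/andP: (Gbd n xi).
  - exact: cvg_cst.
  - apply: cvg_EFin; first by apply: nearW.
    have -> : (0 : R) = w xi * (8 * 0 / eta) * fine (leb K) by rewrite !(mulr0, mul0r).
    by apply: cvgMl; apply: cvgMr; apply: cvgMl; apply: cvgMr; exact: cvg_rad.
have [//|//|||_ _] := @dominated_convergence _ _ _ mu setT measurableT G (cst 0%E)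
   (fun xi => ((8 * pi) * w xi)%:E) mG.
- exists A; split => // xi /= /not_implyP[_ nc]; apply: contrapT => nA; apply: nc; exact: Gcvg.
- exact: ig.
- by apply: aeW => xi n _; have /andP[G0 G1] := Gbd n xi; rewrite gee0_abs.
- by rewrite integral0_eq.
Qed.

(** If the averages stayed above [1 / (k + 1)] on a set of positive length, a compact part of it,
    carried into the [mu]-null set, would contradict the vanishing of their integrals. *)
Lemma singular_radial_average_ae (H : hilbertType R) (v : H) : v != 0 ->
  mutually_singular mu (@circle_lebesgue R) ->
  {ae leb, forall t, 0 <= t < 2 * pi ->
    forall (k N : nat), exists2 n, (N <= n)%N & (radial_average n t < k.+1%:R^-1%:E)%E}.
Proof.
move=> v0 [A [mA A0 CA0]].
pose I := `[0, 2 * pi[%classic : set R.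
have mI : measurable I by exact: measurable_itv.
have mexpi B : measurable B -> measurable ((@expi R) @^-1` B).
  by move=> mB; rewrite -[X in measurable X]setTI; exact: measurable_expi.
pose bad k N : set R := [set t | forall n, (N <= n)%N -> (k.+1%:R^-1%:E <= radial_average n t)%E].
have mbad k N : measurable (bad k N).
  have -> : bad k N = \bigcap_(n in [set n | (N <= n)%N]) [set t | (k.+1%:R^-1%:E <= radial_average n t)%E].
    by apply/seteqP; split.
  apply: bigcap_measurable; first by exists N => /=.
  move=> n _; rewrite -[X in measurable X]setTI.
  by apply: emeasurable_fun_c_infty => //; exact: measurable_radial_average.
pose B k N := (@expi R) @^-1` A `&` I `&` bad k N.
have mB k N : measurable (B k N) by apply: measurableI => //; apply: measurableI => //; exact: mexpi.
have B0 k N : leb (B k N) = 0%E.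
  apply/eqP; rewrite eq_le measure_ge0 andbT leNgt; apply/negP => pos.
  have fin : (leb (B k N) < +oo)%E.
    apply: (@le_lt_trans _ _ (leb I)).
      by apply: le_measure; [by apply/mem_set; exact: mB|exact/mem_set|move=> t [[]]].
    by rewrite lebesgue_measure_itv /=; case: ifP => _; rewrite ?ltry // -EFinB ltry.
  have finB : leb (B k N) = (fine (leb (B k N)))%:E by rewrite fineK // ge0_fin_numE.
  have [|K [cK KB hK]] := lebesgue_regularity_inner (mB k N) fin (_ : 0 < fine (leb (B k N))).
    by rewrite -lte_fin -finB.
  rewrite -finB in hK.
  have mK : measurable K by exact: compact_measurable.
  have K0 : (0 < leb K)%E.
    rewrite lt0e measure_ge0 andbT; apply/eqP => K0.
    have mD : measurable (B k N `\` K) by exact: measurableD.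
    have : (leb (B k N) <= leb K + leb (B k N `\` K))%E.
      by rewrite -{1}(setDUK KB); exact: measureU2.
    by rewrite K0 add0e leNgt hK.
  have finK : leb K = (fine (leb K))%:E.
    by rewrite fineK // ge0_fin_numE // compact_finite_measure.
  have KI t : K t -> 0 <= t < 2 * pi /\ A (expi t) /\ bad k N t.
    by move=> /KB[[At]]; rewrite /I /= in_itv.
  have c0 := @integral_radial_average_cvg0 H v K A v0 cK _ mA A0 _.
  have : ((k.+1%:R^-1)%:E * leb K <= 0)%E.
    (* On [K] the averages are at least [1 / (k + 1)] from index [N] on, so their integrals cannot
       fall below [leb K / (k + 1)]. *)
    apply: (cvge_ge _ (c0 _ _)).
    - exists N => // j /= Nj; rewrite -integral_cst //.
      apply: ge0_le_integral => //.
      + by move=> t _; rewrite lee_fin.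
      + by apply: measurable_funTS; exact: measurable_radial_average.
      + by move=> t /KI[_ [_ bt]]; exact: bt.
    - by move=> t /KI[t2 _]; rewrite /= in_itv.
    - by move=> t /KI[_ []].
  by apply/negP; rewrite -ltNge mule_gt0 // lte_fin.
have mCA : measurable ((@expi R) @^-1` (~` A) `&` I).
  by apply: measurableI => //; apply: mexpi; exact: measurableC.
have CA0' : leb ((@expi R) @^-1` (~` A) `&` I) = 0%E by rewrite -circle_lebesgueE.
apply: (@negligibleS _ _ _ leb ((@expi R) @^-1` (~` A) `&` I `|` \bigcup_k \bigcup_N B k N)).
  move=> t /= /not_implyP[t2 /existsNP[k /existsNP[N nb]]].
  have It : I t by rewrite /I /= in_itv.
  have [At|nA] := pselect (A (expi t)); last by left.
  right; exists k => //; exists N => //; split => // j Nj.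
  by rewrite leNgt; apply/negP => h; apply: nb; exists j.
apply: negligibleU; first by eexists; split; [exact: mCA|exact: CA0'|].
apply: negligible_bigcup => k; apply: negligible_bigcup => N.
by exists (B k N); split; [apply (mB k N)|exact: B0|].
Qed.

End singular_poisson_integrals.

(** * Defect operators on the boundary *)

Section finite_dimensional_operators.
Context {R : realType} {H : hilbertType R}.
Local Notation C := R[i].
Implicit Types (M N : set H) (x y : H).

(** The default is excluded by an explicit adjoint, [y |-> sum_i inner y (T (e i)) e i]. *)
Lemma adjoint_on_finite M N T m (e : 'I_m -> H) : subspace_of M ->
  orthonormal_basis M e -> operator_on M N T ->
  operator_on N M (adjoint_on M N T) /\
  forall x y, M x -> N y -> inner (T x) y = inner x (adjoint_on M N T y).
Proof.
move=> sM [eM oe eE] oT; have [_ lT _] := oT; have [|[_ no]] := adjoint_onP M N T => //.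
have [k hk] := finite_rank_bounded (fun i => T (e i)) e.
exfalso; apply: (no (fun y => \sum_i inner y (T (e i)) *: e i)).
  split=> [y _|a x y _ _|]; first exact: subspace_sum.
    exact: finite_rank_linear.
  by exists k => y _.
move=> x y Mx Ny; rewrite {1}(eE x Mx) (linear_on_sum _ _ sM lT eM) inner_suml inner_sumr.
by apply: eq_bigr => i _; rewrite -innerJ mulrC.
Qed.

Local Open Scope sesquilinear_scope.

(** The spectral theorem for the Hermitian matrix of [P]. Vectors are rows here, so the new basis is
    read off the rows of the unitary factor. *)
Lemma orthonormal_eigenbasis M m (e : 'I_m -> H) (P : H -> H) : subspace_of M ->
  orthonormal_basis M e -> operator_on M M P ->
  (forall x y, M x -> M y -> inner (P x) y = inner x (P y)) ->
  exists (f : 'I_m -> H) (s : 'I_m -> C),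
    orthonormal_basis M f /\ forall i, P (f i) = s i *: f i.
Proof.
move=> sM [eM oe eE] oP sP; have [MP lP _] := oP.
pose A : 'M[C]_m := \matrix_(i, j) inner (P (e i)) (e j).
have hA : A \is normalmx.
  apply/normalmxP; suff -> : A ^t* = A by [].
  apply/matrixP => i j; rewrite !mxE sP // [RHS]innerJ.
  by [].
have /orthomx_spectralP AE := hA.
pose Q := spectralmx A; pose d := spectral_diag A.
have uQ : Q \is unitarymx := spectral_unitarymx A.
have QA : Q *m A = diag_mx d *m Q.
  by rewrite {1}AE mulmxA mulmxA mulmxV ?mul1mx // unitarymx_unit.
have QQ : Q *m Q ^t* = 1%:M by apply/unitarymxP.
have QQ' : Q ^t* *m Q = 1%:M by apply/mulmx1C.
pose f k := \sum_j Q k j *: e j.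
have Mf k : M (f k) by exact: subspace_sum.
have fe x k : inner x (f k) = \sum_j inner x (e j) * (Q ^t*) j k.
  by rewrite inner_sumr; apply: eq_bigr => j _; rewrite !mxE mulrC.
exists f, (fun k => d 0 k); split; first split=> //.
- move=> i j; rewrite fe.
  have := congr1 (fun X : 'M[C]_m => X i j) QQ; rewrite !mxE => <-.
  by apply: eq_bigr => k _; rewrite (inner_orthonormal_sum _ _ oe).
- move=> x Mx; rewrite {1}(eE x Mx).
  transitivity (\sum_k \sum_l (inner x (f k) * Q k l) *: e l); last first.
    by apply: eq_bigr => k _; rewrite scaler_sumr; apply: eq_bigr => l _; rewrite scalerA.
  rewrite exchange_big; apply: eq_bigr => l _ /=; rewrite -scaler_suml; congr (_ *: _).
  have h j : (j == l)%:R = \sum_k (Q ^t*) j k * Q k l.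
    by have := congr1 (fun X : 'M[C]_m => X j l) QQ'; rewrite !mxE => <-.
  transitivity (\sum_j inner x (e j) * (j == l)%:R).
    rewrite (bigD1 l) //= eqxx mulr1 big1 ?addr0 // => j /negPf ->.
    by rewrite mulr0.
  under eq_bigr do rewrite h mulr_sumr.
  rewrite exchange_big; apply: eq_bigr => k _ /=; rewrite fe mulr_suml.
  by apply: eq_bigr => j _; rewrite mulrA.
- move=> k; rewrite /f (linear_on_sum _ _ sM lP eM) scaler_sumr.
  transitivity (\sum_l (Q *m A) k l *: e l).
    transitivity (\sum_j \sum_l (Q k j * A j l) *: e l).
      apply: eq_bigr => j _; rewrite (eE _ (MP _ (eM j))) scaler_sumr.
      by apply: eq_bigr => l _; rewrite scalerA !mxE.
    by rewrite exchange_big; apply: eq_bigr => l _ /=; rewrite -scaler_suml mxE.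
  by rewrite QA; apply: eq_bigr => l _; rewrite mul_diag_mx mxE scalerA.
Qed.

Lemma sqrt_on_finite M m (e : 'I_m -> H) (P : H -> H) : subspace_of M ->
  orthonormal_basis M e -> operator_on M M P -> (forall x, M x -> 0 <= inner (P x) x) ->
  [/\ operator_on M M (sqrt_on M P),
    forall x, M x -> 0 <= inner (sqrt_on M P x) x &
    forall x, M x -> sqrt_on M P (sqrt_on M P x) = P x].
Proof.
move=> sM ob oP pP; rewrite /sqrt_on; set X := [set S | _].
suff [S XS] : exists S, X S by exact: (xgetPex _ (ex_intro _ S XS)).
have [_ lP _] := oP.
have [f [s [[Mf of_ fE] Pf]]] := orthonormal_eigenbasis sM ob oP (positive_symmetric sM lP pP).
have s0 k : 0 <= s k by have := pP _ (Mf k); rewrite Pf innerZl of_ eqxx mulr1.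
pose S x := \sum_k inner x (f k) *: (sqrtC (s k) *: f k).
have SE x k : inner (S x) (f k) = sqrtC (s k) * inner x (f k).
  rewrite /S; under eq_bigr do rewrite scalerA.
  by rewrite (inner_orthonormal_sum _ _ of_) mulrC.
exists S; split; first split.
- by move=> x Mx; rewrite /S; under eq_bigr do rewrite scalerA; exact: subspace_sum.
- by move=> a x y _ _; exact: finite_rank_linear.
- by have [k hk] := finite_rank_bounded f (fun k => sqrtC (s k) *: f k); exists k => x _; exact: hk.
- move=> x Mx; rewrite /S inner_suml; apply: sumr_ge0 => k _.
  rewrite innerZl mulrCA mulr_ge0 ?sqrtC_ge0 // (innerJ (f k)).
  case: (inner x (f k)) => p q; rewrite lecE /=.
  by apply/andP; split; [apply/eqP; ring|rewrite mulrN opprK addr_ge0 // -expr2 sqr_ge0].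
- move=> x Mx; rewrite {2}(fE x Mx) (linear_on_sum _ _ sM lP Mf); apply: eq_bigr => k _.
  by rewrite SE Pf !scalerA mulrAC -expr2 sqrtCK mulrC.
Qed.

(** Injectivity makes the square matrix of [T] row free, hence invertible. *)
Lemma isometric_onto M N n T : has_dim M n -> has_dim N n -> operator_on M N T ->
  (forall x, M x -> T x = 0 -> x = 0) -> forall y, N y -> exists2 x, M x & T x = y.
Proof.
move=> dM [g [_ NE]] oT iT; have sM := has_dim_subspace dM.
have [f [free ME]] := dM; have [NT lT _] := oT.
have Mf i : M (f i).
  rewrite ME; exists (fun j => (j == i)%:R) => //.
  rewrite (bigD1 i) //= eqxx scale1r big1 ?addr0 // => j /negPf ->.
  by rewrite scale0r.
have /choice[c cE] : forall i, exists c : 'I_n -> C, T (f i) = \sum_j c j *: g j.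
  by move=> i; have := NT _ (Mf i); rewrite NE => -[c _ <-]; exists c.
pose A : 'M[C]_n := \matrix_(i, j) c i j.
have TfE (v : 'rV[C]_n) : T (\sum_i v 0 i *: f i) = \sum_j (v *m A) 0 j *: g j.
  rewrite (linear_on_sum _ _ sM lT Mf).
  transitivity (\sum_i \sum_j (v 0 i * A i j) *: g j).
    apply: eq_bigr => i _; rewrite cE scaler_sumr; apply: eq_bigr => j _.
    by rewrite scalerA mxE.
  by rewrite exchange_big; apply: eq_bigr => j _ /=; rewrite -scaler_suml mxE.
have uA : A \in unitmx.
  rewrite -row_free_unit; apply: inj_row_free => v vA.
  have /free h : \sum_i v 0 i *: f i = 0.
    apply: iT; first exact: subspace_sum.
    by rewrite TfE vA big1 // => j _; rewrite mxE scale0r.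
  by apply/rowP => i; rewrite mxE h.
move=> y; rewrite NE => -[d _ <-].
pose v := (\row_j d j) *m invmx A.
exists (\sum_i v 0 i *: f i); first exact: subspace_sum.
by rewrite TfE -mulmxA mulVmx // mulmx1; apply: eq_bigr => j _; rewrite mxE.
Qed.

End finite_dimensional_operators.

Section boundary_contraction.
Context {R : realType} {H : hilbertType R}.
Local Notation C := R[i].
Local Notation T := (borel_circle R).
Local Notation leb := (@lebesgue_measure R).
Implicit Types (M N : set H) (x y d : H) (t : R) (xi : T).

Lemma sqrt_sqn_dist x y (e : R) : `|x - y| <= e%:C%C ->
  `|Num.sqrt (sqn x) - Num.sqrt (sqn y)| <= e.
Proof.
move=> h; rewrite ler_distl; apply/andP; split.
  rewrite lerBlDr -lecR rmorphD /= -!norm_sqn -(subrK x y) addrC.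
  by apply: le_trans (ler_normD _ _) _; rewrite lerD2l distrC.
rewrite -lecR rmorphD /= -!norm_sqn -{1}(subrK y x) addrC.
by apply: le_trans (ler_normD _ _) _; rewrite lerD2l.
Qed.

Lemma nontangential_sqn_cvg M (F : C -> H -> H) t S x : M x ->
  nontangential_limit M F (cis t) S ->
  (fun n => sqn (F ((rad n)%:C%C * cis t) x)) @ \oo --> sqn (S x).
Proof.
move=> Mx lim.
have h : (fun n => Num.sqrt (sqn (F ((rad n)%:C%C * cis t) x))) @ \oo --> Num.sqrt (sqn (S x)).
  apply/cvgrPdist_le => e e0; have s0 : 0 < Num.sqrt (sqn x) + 1 by rewrite ltr_wpDl ?sqrtr_ge0.
  have [|k hk] := nontangential_radial Mx lim (_ : 0 < e / (Num.sqrt (sqn x) + 1)).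
    by rewrite divr_gt0.
  exists k => // n /= kn; rewrite distrC; apply: sqrt_sqn_dist.
  apply: le_trans (hk n kn) _; rewrite lecR mulrAC ler_pdivrMr //.
  by rewrite ler_wpM2l ?(ltW e0) // lerDl.
rewrite -(sqr_sqrtr (sqn_ge0 (S x))) expr2.
rewrite (_ : (fun n => _) = (fun n => Num.sqrt (sqn (F ((rad n)%:C%C * cis t) x))) \*
  (fun n => Num.sqrt (sqn (F ((rad n)%:C%C * cis t) x)))); first exact: cvgM.
by apply/funext => n /=; rewrite -expr2 sqr_sqrtr ?sqn_ge0.
Qed.

Variables U W D Wi : {linear H -> H}.
Hypothesis UW : perturbation_of U W D Wi.
Variables (m : nat) (b : 'I_m -> H).
Hypothesis ob : orthonormal_basis (defect U) b.

Lemma Theta_bd_ae : {ae @circle_lebesgue R, forall xi,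
  operator_on (defect U) (defect_star U) (Theta_bd U xi) /\
  nontangential_limit (defect U) (Theta U) (circle_val xi) (Theta_bd U xi)}.
Proof.
have [Z [mZ Z0 hZ]] := Theta_boundary_ae UW ob.
apply: (ae_circle mZ Z0) => t t2 nZ.
have [S [oS lS]] : exists S, operator_on (defect U) (defect_star U) S /\
    nontangential_limit (defect U) (Theta U) (cis t) S.
  by apply: contrapT => nS; apply: nZ; apply: hZ => /= h; apply: nS; exact: h.
by have [//|[_ /(_ _ oS)]] := boundary_valueP (defect U) (defect_star U) (Theta U) (cis t).
Qed.

Lemma nontangential_sqn_le xi S d : defect U d ->
  nontangential_limit (defect U) (Theta U) (circle_val xi) S -> sqn (S d) <= sqn d.
Proof.
have [t _ <-] := expi_surj xi; move=> dd /(nontangential_sqn_cvg dd) h.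
apply: (cvgr_to_le h); apply: nearW => n; apply: (sqn_Theta_le UW); first exact: csq_rad_lt1.
by rewrite -(defectE UW).
Qed.

(** One inequality is contractivity. For the other, radii with a small average make
    [|d|^2 - |Theta d|^2] small, and along all radii it converges, so its limit vanishes. *)
Lemma singular_isometric_ae (mu : {finite_measure set T -> \bar R}) (E : T -> hilbertType R)
    (e : nat -> forall xi, E xi) (V : H -> forall xi, E xi) (v : H) :
  v != 0 -> fundamental_sequence e -> direct_integral_unitary mu e V ->
  (forall x, {ae mu, forall xi, V (W x) xi = circle_val xi *: V x xi}) ->
  mutually_singular mu (@circle_lebesgue R) ->
  {ae @circle_lebesgue R, forall xi d, defect U d -> sqn (Theta_bd U xi d) = sqn d}.
Proof.
move=> v0 fe VU VW sing.
have [Z1 [mZ1 Z10 h1]] := ae_circleP Theta_bd_ae.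
have [Z2 [mZ2 Z20 h2]] := singular_radial_average_ae (measurable_defect_density fe VU b)
  (defect_density_ge0 V b) (integral_defect_density fe VU b) v0 sing.
apply: (@ae_circle _ _ (Z1 `|` Z2)).
- exact: measurableU.
- by apply: etrans Z10; exact: measureU0.
move=> t t2 /not_orP[nZ1 nZ2] d dd.
have [_ lim] := h1 t t2 nZ1.
have {}h2 : forall k N : nat, exists2 n, (N <= n)%N &
    (radial_average mu (defect_density V b) n t < k.+1%:R^-1%:E)%E.
  by apply: contrapT => nS; apply: nZ2; apply: h2 => /= h; apply: nS; exact: h.
apply/eqP; rewrite eq_le (nontangential_sqn_le dd lim) /=.
have cv := nontangential_sqn_cvg dd lim.
set c := 4 * m%:R * sqn d; have c0 : 0 <= c by rewrite !mulr_ge0 ?sqn_ge0.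
have Dd : D d = d by rewrite -(defectE UW).
rewrite -subr_le0; apply/ler_addgt0Pr => eps eps0; rewrite add0r.
have [k hk] : exists k : nat, (c + 1) / k.+1%:R < eps.
  have c1 : 0 < c + 1 by rewrite ltr_wpDl.
  have [k _ hk] := near_infty_natSinv_lt (PosNum (divr_gt0 eps0 c1)).
  by exists k; rewrite mulrC -ltr_pdivlMr //; exact: hk (leqnn k).
have k0 : 0 < k.+1%:R^-1 :> R by rewrite invr_gt0.
move/cvgrPdist_le : cv => /(_ _ k0)[N _ hN].
have [n Nn hn] := h2 k N.
have := Theta_defect_poisson fe VU UW VW ob (@csq_rad_lt1 R n t) Dd.
rewrite -/c => hT.
have {}hT : ((sqn d - sqn (Theta U ((rad n)%:C%C * cis t) d))%:E <= (c * k.+1%:R^-1)%:E)%E.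
  apply: le_trans hT _; rewrite [leRHS]EFinM; apply: lee_wpmul2l; first by rewrite lee_fin.
  exact: ltW.
have := hN n Nn; rewrite /= ler_norml => /andP[hN2 _]; move: hN2.
rewrite lee_fin in hT => hN'.
move: hk hT hN'; rewrite mulrDl mul1r.
move=> hk1 hk2 hk3; apply: ltW; apply: le_lt_trans hk1.
rewrite -(subrKA (sqn (Theta U ((rad n)%:C%C * cis t) d))); apply: lerD => //.
by rewrite -opprB lerNl.
Qed.

End boundary_contraction.

Section boundary_algebra.
Context {R : realType} {H : hilbertType R}.
Local Notation C := R[i].
Local Notation T := (borel_circle R).
Variables (U : H -> H) (n m : nat) (b : 'I_m -> H).
Hypotheses (dim_defect : has_dim (defect U) n) (dim_defect_star : has_dim (defect_star U) n).
Hypothesis ob : orthonormal_basis (defect U) b.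
Variable xi : T.
Local Notation M := (defect U).
Local Notation N := (defect_star U).
Local Notation S := (Theta_bd U xi).
Hypothesis oS : operator_on M N S.

Let sM : subspace_of M := has_dim_subspace dim_defect.
Local Notation S' := (adjoint_on M N S).

Lemma defect_gramE x y : M x -> M y -> inner (x - S' (S x)) y = inner x y - inner (S x) (S y).
Proof.
move=> Mx My; have [_ adjP] := adjoint_on_finite sM ob oS; have [NS _ _] := oS.
rewrite innerDl -scaleN1r innerZl mulN1r; congr (_ - _).
by rewrite innerJ -adjP // -?innerJ //; exact: NS.
Qed.

Lemma isometric_Xspace : (forall d, M d -> sqn (S d) = sqn d) -> Xspace U xi = [set 0].
Proof.
move=> iS.
have [oS' _] := adjoint_on_finite sM ob oS; have [NS lS _] := oS; have [MS' _ _] := oS'.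
have [M0 Mlin] := sM.
have ripS x y : M x -> M y -> rip (S x) (S y) = rip x y.
  move=> Mx My; have := iS _ (Mlin 1 x y Mx My).
  by rewrite lS // !scale1r !sqnD !iS //; lra.
have innerS x y : M x -> M y -> inner (S x) (S y) = inner x y.
  move=> Mx My; rewrite !inner_rip ripS //; congr Complex.
  have Miy : M ('i%C *: y) by rewrite -[_ *: y]addr0; exact: Mlin.
  have S0 : S 0 = 0 by have := lS (-1) 0 0 M0 M0; rewrite scaler0 addr0 scaleN1r addNr.
  have -> : 'i%C *: S y = S ('i%C *: y) by rewrite -[in RHS](addr0 ('i%C *: y)) lS // S0 addr0.
  exact: ripS.
have P0 x : M x -> x - S' (S x) = 0.
  move=> Mx; apply: sqn0_eq.
  have Mz : M (x - S' (S x)).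
    by rewrite addrC -scaleN1r; apply: Mlin => //; apply: MS'; exact: NS.
  by rewrite /sqn /rip defect_gramE // innerS // subrr.
(* Either [Delta] is the default zero, or it is a symmetric square root of 0 and [|Delta x|^2 =
   inner x (Delta (Delta x)) = 0]. *)
have De0 x : M x -> Delta U xi x = 0.
  rewrite /Delta; have [[oD pD DD]|->] := sqrt_onP M (fun x => x - S' (S x)); last by [].
  have [MD lD _] := oD.
  move=> Mx; apply: sqn0_eq; rewrite /sqn /rip (positive_symmetric sM lD pD) //; last exact: MD.
  by rewrite DD // P0 // inner0r.
apply/seteqP; split => x.
  move=> [Mx hx]; apply: sqn0_eq; rewrite /sqn /rip hx //; split => //; exact: De0.
by move=> ->; split=> // y _; rewrite inner0l.
Qed.

Lemma Xspace0_isometric : (forall d, M d -> sqn (S d) <= sqn d) -> Xspace U xi = [set 0] ->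
  unitary_on M N S.
Proof.
move=> cS X0.
have [oS' adjP] := adjoint_on_finite sM ob oS; have [NS lS bS] := oS; have [MS' lS' bS'] := oS'.
have [M0 Mlin] := sM.
have oP : operator_on M M (fun x => x - S' (S x)).
  split.
  - move=> x Mx; rewrite addrC -scaleN1r; apply: Mlin => //; apply: MS'; exact: NS.
  - move=> a x y Mx My; rewrite lS // lS'; [|exact: NS..].
    by rewrite scalerBr opprD addrACA.
  - have [k hk] := bS; have [k' hk'] := bS'.
    exists (1 + `|k'| * `|k|) => x Mx; rewrite mulrDl mul1r.
    apply: le_trans (ler_normB _ _) _; rewrite lerD2l.
    have absle (p q r : C) : 0 <= p -> 0 <= q -> p <= r * q -> p <= `|r| * q.
      move=> p0 q0 pq; have rq := le_trans p0 pq.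
      by apply: le_trans pq _; rewrite -{1}(ger0_norm rq) normrM (ger0_norm q0).
    apply: le_trans (absle _ _ _ _ _ (hk' _ (NS _ Mx))) _ => //.
    by rewrite -mulrA ler_wpM2l // absle // hk.
have pP x : M x -> 0 <= inner (x - S' (S x)) x.
  move=> Mx; rewrite defect_gramE // !inner_sqn -rmorphB realc_ge0 subr_ge0; exact: cS.
have [oD pD DD] := sqrt_on_finite sM ob oP pP; have [MD lD _] := oD.
(* A symmetric operator maps into the orthogonal complement of its kernel, which is [Xspace]. *)
have D0 x : M x -> Delta U xi x = 0.
  move=> Mx; suff : Xspace U xi (Delta U xi x) by rewrite X0.
  split; first exact: MD.
  move=> y [My Dy0]; rewrite /Delta (positive_symmetric sM lD pD) //.
  by rewrite -/(Delta U xi y) Dy0 inner0r.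
have innerS x y : M x -> M y -> inner (S x) (S y) = inner x y.
  move=> Mx My; apply/eqP; rewrite eq_sym -subr_eq0 -defect_gramE // -DD //.
  by rewrite -/(Delta U xi _) -/(Delta U xi x) D0 ?D0 // ?inner0l // D0.
split => //; apply: (isometric_onto dim_defect dim_defect_star oS) => x Mx Sx0.
by apply: sqn0_eq; rewrite /sqn /rip -innerS // Sx0 inner0l.
Qed.

End boundary_algebra.

Lemma has_dim0 (R : realType) (H : hilbertType R) (M : set H) : has_dim M 0 <-> M = [set 0].
Proof.
split=> [[e [_ ->]]|->].
  by apply/seteqP; split=> x => [[c _ <-]|->]; [rewrite big_ord0|exists (fun=> 0) => //; rewrite big_ord0].
exists (fun=> 0); split=> [c _ []//|].
by apply/seteqP; split=> x => [->|[c _ <-]]; [exists (fun=> 0) => //; rewrite big_ord0|rewrite big_ord0].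
Qed.

(** * Inner characteristic functions *)

Section stable_vectors.
Context {R : realType} {H : hilbertType R}.
Local Notation C := R[i].
Implicit Types (x y u v d : H) (eps : R).
Variables U W D Wi : {linear H -> H}.
Hypothesis UW : perturbation_of U W D Wi.

(** Strong convergence to 0 of the adjoint iterates: their norms decrease, so a single small one
    suffices. *)
Definition stable v : Prop := forall eps, 0 < eps -> exists N, sqn (iter N (adj U) v) < eps.

Lemma sqn_iter_adj_add N k v : sqn (iter (N + k) (adj U) v) <= sqn (iter N (adj U) v).
Proof. by rewrite addnC iterD; exact: (sqn_iter_adj_le UW). Qed.

Lemma stableD u v : stable u -> stable v -> stable (u + v).
Proof.
move=> su sv eps eps0; have e4 : 0 < eps / 4 by rewrite divr_gt0.
have [N hN] := su _ e4; have [M hM] := sv _ e4; exists (N + M)%N.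
have h := iter_adj_linear UW (N + M) 1 u v; rewrite !scale1r in h; rewrite h.
apply: le_lt_trans (sqnD_le _ _) _.
have := sqn_iter_adj_add N M u; have := sqn_iter_adj_add M N v; rewrite (addnC M N).
lra.
Qed.

Lemma stable_adj v : stable v -> stable (adj U v).
Proof.
move=> sv eps eps0; have [N hN] := sv eps eps0; exists N.
by rewrite -iterSr iterS; apply: le_lt_trans (sqn_adj_le UW _) _.
Qed.

(** [Wi v] is [adj v] plus a defect vector. *)
Lemma stable_Wi v : (forall d, D d = d -> stable d) -> stable v -> stable (Wi v).
Proof.
move=> sD sv; rewrite -(subrK (D (Wi v)) (Wi v)) -(adjE UW).
by apply: stableD; [exact: stable_adj|apply: sD; exact: (proj_idem UW)].
Qed.

Lemma stable_iter_Wi k d : (forall d, D d = d -> stable d) -> D d = d -> stable (iter k Wi d).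
Proof.
move=> sD Dd; elim: k => [|k IH]; first exact: sD.
by rewrite iterS; exact: stable_Wi.
Qed.

Lemma sqn_iter_Wi k v : sqn (iter k Wi v) = sqn v.
Proof. by elim: k => // k IH; rewrite iterS (sqnWi UW). Qed.

Lemma rip_iter_Wi k u v : rip (iter k Wi u) (iter k Wi v) = rip u v.
Proof. by elim: k => // k IH; rewrite !iterS (ripWi UW). Qed.

Lemma iter_WiK k v : iter k Wi (iter k W v) = v.
Proof. by elim: k v => // k IH v; rewrite iterSr [iter k.+1 W v]iterS (WiK UW). Qed.

Lemma sum_sqn_defect_adj k v :
  \sum_(j < k) sqn (D (Wi (iter j (adj U) v))) = sqn v - sqn (iter k (adj U) v).
Proof.
elim: k => [|k IH]; first by rewrite big_ord0 subrr.
by rewrite big_ord_recr /= IH (sqn_adj UW); ring.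
Qed.

Lemma rip_iter_Wi_adj k u v : rip u v = rip (iter k Wi u) (iter k (adj U) v) +
  \sum_(j < k) rip (D (iter j.+1 Wi u)) (D (Wi (iter j (adj U) v))).
Proof.
elim: k => [|k IH]; first by rewrite big_ord0 addr0.
rewrite big_ord_recr /= IH -(ripWi UW) -[in LHS](subrK (D (Wi (iter k (adj U) v))) (Wi (iter k (adj U) v))).
rewrite -(adjE UW) ripDr -addrA; congr (_ + _); rewrite addrC; congr (_ + _).
by rewrite (proj_sym UW) (proj_idem UW).
Qed.

Lemma bounded_sum_shift (a : nat -> R) (c eps : R) : (forall k, 0 <= a k) -> 0 < eps ->
  (forall N, \sum_(k < N) a k <= c) -> exists N0, forall N k,
    (N0 <= N)%N -> \sum_(j < k) a (N + j).+1 <= eps.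
Proof.
move=> a0 eps0 ac; have [N0 hN0] := bounded_sum_tail a0 eps0 ac.
exists N0 => N k N0N; have := hN0 (N.+1 + k)%N; rewrite big_split_ord /=.
have : \sum_(i < N0) a i <= \sum_(i < N.+1) a i.
  by rewrite -(subnKC (leqW N0N)) big_split_ord /= lerDl sumr_ge0.
by under [X in _ + X]eq_bigr do rewrite addSn; lra.
Qed.

(** In [rip_iter_Wi_adj] the leading term dies by stability. Young with weight [s] splits the sum
    into one bounded by [delta] and one that telescopes below [|v|^2]. *)
Lemma rip_stable_le x u v s delta : 0 < s -> stable v -> sqn u = sqn x ->
  (forall k, \sum_(j < k) sqn (D (iter j.+1 Wi u)) <= delta) ->
  2 * rip u v <= s * delta + sqn v / s.
Proof.
move=> s0 sv ux hd; apply/ler_addgt0Pr => eps eps0.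
have x1 : 0 < sqn x + 1 by rewrite ltr_wpDl ?sqn_ge0.
pose t := eps / 2 / (sqn x + 1); have t0 : 0 < t by rewrite !divr_gt0.
have [k hk] := sv (t * (eps / 2)) ltac:(rewrite mulr_gt0 // divr_gt0 //).
rewrite (rip_iter_Wi_adj k) mulrDr mulr_sumr addrC; apply: lerD.
  apply: (@le_trans _ _ (\sum_(j < k) (s * sqn (D (iter j.+1 Wi u)) + sqn (D (Wi (iter j (adj U) v))) / s))).
    by apply: ler_sum => j _; exact: rip_le.
  rewrite big_split /= -mulr_sumr -mulr_suml; apply: lerD.
    by apply: ler_wpM2l; [exact: ltW|exact: hd].
  by rewrite ler_wpM2r ?invr_ge0 ?(ltW s0) // sum_sqn_defect_adj gerBl sqn_ge0.
apply: le_trans (rip_le _ _ t0) _; rewrite sqn_iter_Wi ux (splitr eps); apply: lerD.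
  by rewrite /t mulrAC ler_pdivrMr // ler_wpM2l ?divr_ge0 ?(ltW eps0) // lerDl.
by rewrite ler_pdivrMr // mulrC ltW.
Qed.

(** Shifting [x] by [N] leaves a small tail of the convergent sum, while [|v N|] stays fixed;
    [s = (q + 1) / eps] balances the two terms. *)
Lemma rip_stable_le0 x y (v : nat -> H) (q : R) N1 c :
  (forall N, \sum_(k < N) sqn (D (iter k Wi x)) <= c) ->
  (forall N, (N1 <= N)%N -> [/\ rip x y = rip (iter N Wi x) (v N), stable (v N) & sqn (v N) = q]) ->
  rip x y <= 0.
Proof.
move=> hc hv; apply/ler_addgt0Pr => eps eps0; rewrite add0r.
have q0 : 0 <= q by have [_ _ <-] := hv N1 (leqnn _); exact: sqn_ge0.
have q1 : 0 < q + 1 by rewrite ltr_wpDl.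
pose s := (q + 1) / eps; have s0 : 0 < s by rewrite divr_gt0.
have [N0 hN0] := bounded_sum_shift (fun k => sqn_ge0 (D (iter k Wi x))) (divr_gt0 eps0 s0) hc.
pose N := maxn N0 N1.
have [-> sv vq] := hv N (leq_maxr _ _).
have h : forall k, \sum_(j < k) sqn (D (iter j.+1 Wi (iter N Wi x))) <= eps / s.
  move=> k; have := hN0 N k (leq_maxl _ _).
  by under eq_bigr do rewrite addnC -addSn iterD.
have := rip_stable_le s0 sv (sqn_iter_Wi N x) h.
have -> : s * (eps / s) = eps by rewrite mulrCA divff ?mulr1 // gt_eqF.
have : sqn (v N) / s <= eps.
  by rewrite ler_pdivrMr // vq /s mulrCA divff ?gt_eqF // mulr1 lerDl.
lra.
Qed.

Hypothesis U_cnu : completely_non_unitary U.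

(** The vectors with this property form a closed subspace invariant under [W] and its inverse, on
    which [U] agrees with [W]. *)
Lemma completely_non_unitary_eq0 x : (forall j, D (iter j W x) = 0) ->
  (forall j, D (iter j Wi x) = 0) -> x = 0.
Proof.
pose M := [set y | forall j, D (iter j W y) = 0 /\ D (iter j Wi y) = 0].
move=> h1 h2; have : M x by move=> j; split.
have iterP (L : {linear H -> H}) j (a : C) y z : iter j L (a *: y + z) = a *: iter j L y + iter j L z.
  by elim: j => // j IH; rewrite !iterS IH linearP.
have iter_sqn (L : {linear H -> H}) j y : (forall z, sqn (L z) = sqn z) -> sqn (iter j L y) = sqn y.
  by move=> sL; elim: j => // j IH; rewrite iterS sL.
have iterB (L : {linear H -> H}) j y z : iter j L (y - z) = iter j L y - iter j L z.
  by rewrite addrC -scaleN1r iterP scaleN1r addrC.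
have cl (L : {linear H -> H}) j y : (forall z, sqn (L z) = sqn z) ->
    closure M y -> (forall z, M z -> D (iter j L z) = 0) -> D (iter j L y) = 0.
  move=> sL cly ML; apply/eqP; rewrite -normr_le0; apply/ler_addgt0Pr => e e0.
  rewrite add0r.
  have [z [Mz]] := cly (ball y e) (nbhsx_ballx _ _ e0).
  rewrite -ball_normE /= => yz; apply: le_trans (ltW yz).
  rewrite -[D _]subr0 -(ML z Mz) -linearB -iterB ler_norm_sqn.
  by apply: le_trans (sqn_proj_le UW _) _; rewrite iter_sqn.
have MD0 y : M y -> D y = 0 by move=> /(_ 0%N) [].
have UM y : M y -> U y = W y by move=> /MD0 y0; rewrite (UE UW) y0 subr0.
have MW y : M y -> M (W y).
  move=> My j; rewrite -iterSr; have [-> _] := My j.+1; split=> //.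
  case: j => [|j]; first by have [] := My 1%N.
  by rewrite iterSr (WiK UW); have [] := My j.
have MWi y : M y -> M (Wi y).
  move=> My j; rewrite -[iter j Wi _]iterSr; have [_ ->] := My j.+1; split=> //.
  case: j => [|j]; first by have [] := My 1%N.
  by rewrite iterSr (WK UW); have [] := My j.
have -> : M = [set 0]; last by [].
apply: U_cnu.
- split=> [j|a y z My Mz j]; first by split; elim: j => [|j IH]; rewrite ?linear0 // iterSr linear0.
  have [y1 y2] := My j; have [z1 z2] := Mz j.
  by rewrite !iterP !linearP /= y1 y2 z1 z2 scaler0 addr0.
- apply/closure_id/seteqP; split; first exact: subset_closure.
  move=> y cly j; split; apply: cl => //.
  + exact: (sqnW UW).
  + by move=> z Mz; have [] := Mz j.
  + exact: (sqnWi UW).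
  + by move=> z Mz; have [] := Mz j.
- by move=> y My; rewrite UM //; exact: MW.
- split; first split.
  + by move=> y My; rewrite UM //; exact: MW.
  + by move=> a y z _ _; rewrite linearP.
  + by exists 1 => y My; rewrite mul1r UM // ler_norm_sqn (sqnW UW).
  + move=> y z My Mz; rewrite !UM // !inner_rip (ripW UW); congr Complex.
    by rewrite -linearZ (ripW UW).
  + by move=> y My; exists (Wi y); [exact: MWi|rewrite UM ?(WK UW) //; exact: MWi].
Qed.

(** For [y = W^j d], the vectors [v N = W^-N y] are stable once [N >= j]. The one-sided bound
    suffices: for [d = D (W^-j x)] the product [rip x y] is [|d|^2], and negative powers are treated
    alike. *)
Lemma summable_defect_eq0 x c : (forall d, D d = d -> stable d) ->
  (forall N, \sum_(k < N) sqn (D (iter k Wi x)) <= c) -> x = 0.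
Proof.
move=> sD hc.
have orth y (v : nat -> H) N1 q : (forall N, (N1 <= N)%N ->
    [/\ rip x y = rip (iter N Wi x) (v N), stable (v N) & sqn (v N) = q]) -> rip x y <= 0.
  exact: rip_stable_le0 hc.
have orthW j d : D d = d -> rip x (iter j W d) <= 0.
  move=> Dd; apply: (@orth _ (fun N => iter (N - j) Wi d) j (sqn d)) => N jN; split.
  - rewrite -(rip_iter_Wi N); congr rip.
    by rewrite -{1}(subnK jN) iterD iter_WiK.
  - exact: stable_iter_Wi.
  - exact: sqn_iter_Wi.
have orthWi j d : D d = d -> rip x (iter j Wi d) <= 0.
  move=> Dd; apply: (@orth _ (fun N => iter (N + j) Wi d) 0%N (sqn d)) => N _; split.
  - by rewrite -(rip_iter_Wi N) iterD.
  - exact: stable_iter_Wi.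
  - exact: sqn_iter_Wi.
apply: completely_non_unitary_eq0 => j; apply: sqn0_eq; rewrite -(rip_proj_sqn UW).
  have := orthWi j (D (iter j W x)) (proj_idem UW _).
  by rewrite -{1}(iter_WiK j x) rip_iter_Wi.
have := orthW j (D (iter j Wi x)) (proj_idem UW _).
by rewrite -(rip_iter_Wi j) iter_WiK.
Qed.

End stable_vectors.

Section inner_implies_stable.
Context {R : realType} {H : hilbertType R}.
Local Notation C := R[i].
Local Notation leb := (@lebesgue_measure R).
Variables U W D Wi : {linear H -> H}.
Hypothesis UW : perturbation_of U W D Wi.
Variables (m : nat) (b : 'I_m -> H).
Hypothesis ob : orthonormal_basis (defect U) b.

Lemma Theta_polynomial_approx d : D d = d -> exists N : nat -> nat, forall n t,
  `|Theta U ((rad n)%:C%C * cis t) d -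
    hpoly (fun k => (rad n)%:C%C ^+ k *: Theta_coef U W D Wi d k) (N n).+1 (cis t)|
  <= (n.+1%:R^-1)%:C%C.
Proof.
move=> Dd.
suff /choice[N hN] : forall n, exists N : nat, forall t, `|Theta U ((rad n)%:C%C * cis t) d -
    hpoly (fun k => (rad n)%:C%C ^+ k *: Theta_coef U W D Wi d k) N.+1 (cis t)|
  <= (n.+1%:R^-1)%:C%C by exists N.
move=> n; have r01 : 0 <= (rad n : R) ^+ 2 < 1 by rewrite sqr_ge0 -(csq_rad n 0) csq_rad_lt1.
have e0 : 0 < n.+1%:R^-1 :> R by rewrite invr_gt0.
have [N hN] := Theta_series_cvg UW r01 e0 Dd; exists N => t.
have := hN N _ (leqnn N) (csq_rad n t).
rewrite (_ : \sum_(k < N.+1) _ = hpoly (fun k => (rad n)%:C%C ^+ k *: Theta_coef U W D Wi d k) N.+1 (cis t)) //.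
by apply: eq_bigr => k _; rewrite scalerA exprMn mulrC.
Qed.

(** If the iterates kept squared norm at least [eps], Parseval would keep the means of the
    approximating polynomials below [|d|^2 - eps], whereas dominated convergence sends them to
    [|d|^2]. *)
Lemma Theta_inner_stable d : Theta_inner U -> D d = d -> stable U d.
Proof.
move=> inn Dd eps eps0; apply: contrapT => /forallNP nst.
have dd : defect U d by rewrite (defectE UW).
have [N hN] := Theta_polynomial_approx Dd.
pose h n (k : nat) := (rad n)%:C%C ^+ k *: Theta_coef U W D Wi d k.
pose g n t := sqn (hpoly (h n) (N n).+1 (cis t)).
pose I := `[0, 2 * pi[%classic : set R.
have mI : measurable I by exact: measurable_itv.
have lebI : leb I = (2 * pi)%:E.
  by rewrite lebesgue_measure_itv /= lte_fin mulr_gt0 ?pi_gt0 // -EFinB subr0.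
have [Z1 [mZ1 Z10 h1]] := ae_circleP (Theta_bd_ae UW ob).
have [Z2 [mZ2 Z20 h2]] := ae_circleP inn.
have gcvg t : 0 <= t < 2 * pi -> ~ Z1 t -> ~ Z2 t -> (fun n => g n t) @ \oo --> sqn d.
  move=> t2 nZ1 nZ2; have [_ lim] := h1 t t2 nZ1; have [_ iS _] := h2 t t2 nZ2.
  have := nontangential_sqn_cvg dd lim; have -> : sqn (Theta_bd U (expi t) d) = sqn d by rewrite /sqn /rip iS.
  move=> cv; have cs := cvg_comp _ _ cv (@sqrt_continuous R (sqn d)).
  have cg : (fun n => Num.sqrt (g n t)) @ \oo --> Num.sqrt (sqn d).
    apply/cvgrPdist_le => e e0; have e2 : 0 < e / 2 by rewrite divr_gt0.
    have [k1 _ hk1] := near_infty_natSinv_lt (PosNum e2).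
    move/cvgrPdist_le : cs => /(_ _ e2)[k2 _ hk2].
    exists (maxn k1 k2) => // n /=; rewrite geq_max => /andP[n1 n2].
    rewrite -(subrKA (Num.sqrt (sqn (Theta U ((rad n)%:C%C * cis t) d)))) (splitr e).
    apply: le_trans (ler_normD _ _) _; apply: lerD; first exact: hk2.
    by apply: le_trans (sqrt_sqn_dist (hN n t)) _; exact: ltW (hk1 n n1).
  rewrite -(sqr_sqrtr (sqn_ge0 d)) expr2.
  rewrite (_ : (fun n => _) = (fun n => Num.sqrt (g n t)) \* (fun n => Num.sqrt (g n t))); first exact: cvgM.
  by apply/funext => n /=; rewrite -expr2 sqr_sqrtr ?sqn_ge0.
have gle n t : g n t <= 2 * sqn d + 2.
  rewrite /g -[hpoly _ _ _](subKr (Theta U ((rad n)%:C%C * cis t) d)).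
  apply: le_trans (sqnD_le _ _) _; rewrite sqnN; apply: lerD.
    by rewrite ler_pM2l //; apply: (sqn_Theta_le UW) => //; exact: csq_rad_lt1.
  rewrite -[leRHS]mulr1 ler_pM2l //.
  have := hN n t; rewrite ler_norm_real // => h3; apply: le_trans h3 _.
  by rewrite expr_le1 // invf_le1 // ler1n.
have ig n : (\int[leb]_(t in I) (g n t)%:E <= (2 * pi * (sqn d - eps))%:E)%E.
  apply: (@le_trans _ _ (\int[leb]_(t in `[0%R, (0 + 2 * pi)%R]) (g n t)%:E)%E).
    apply: ge0_subset_integral => //.
    - by apply/measurable_EFinP; exact: measurable_sqn_hpoly.
    - by move=> t _; rewrite lee_fin sqn_ge0.
    - by move=> t; rewrite /I /= !in_itv /= add0r => /andP[-> /ltW].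
  rewrite parseval lee_fin ler_wpM2l ?mulr_ge0 ?pi_ge0 //.
  have st : eps <= sqn (iter (N n) (adj U) d) by rewrite leNgt; apply/negP; exact: nst.
  apply: (@le_trans _ _ (\sum_(k < (N n).+1) sqn (Theta_coef U W D Wi d k))).
    apply: ler_sum => k _; rewrite sqnZ ler_piMl ?sqn_ge0 // csqX csq_real.
    have /andP[r0 r1] := @rad_bounds R n.
    by rewrite !exprn_ile1 ?exprn_ge0 // ltW.
  by rewrite (sum_sqn_Theta_coef UW) lerD2l lerN2.
have mg n : measurable_fun I (fun t => (g n t)%:E) by apply/measurable_EFinP; exact: measurable_sqn_hpoly.
have icst (c : R) : (\int[leb]_(t in I) (cst c%:E) t = (2 * pi * c)%:E)%E.
  transitivity (c%:E * leb I)%E; first exact: integral_cst.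
  by rewrite lebI -EFinM mulrC.
have cl : leb.-integrable I (cst (2 * sqn d + 2)%:E).
  apply/integrableP; split; first exact: measurable_cst.
  by have := ltry (2 * pi * `|2 * sqn d + 2|); rewrite -icst.
have [||_ _ cv] := @dominated_convergence _ _ _ leb I mI (fun n t => (g n t)%:E)
  (cst (sqn d)%:E) (cst (2 * sqn d + 2)%:E) mg (measurable_cst _) _ cl _.
- exists (Z1 `|` Z2); split.
  + exact: measurableU.
  + by apply: etrans Z10; exact: measureU0.
  + move=> t /= /not_implyP[]; rewrite /I /= in_itv /= => t2 nc.
    apply: contrapT => /not_orP[nZ1 nZ2]; apply: nc.
    by apply: cvg_EFin; [exact: nearW|exact: gcvg].
- by apply: aeW => t n _; rewrite /= ger0_norm ?sqn_ge0 // lee_fin.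
have : (\int[leb]_(t in I) (cst (sqn d)%:E) t <= (2 * pi * (sqn d - eps))%:E)%E.
  by apply: (cvge_le _ cv); apply: nearW.
rewrite icst lee_fin ler_pM2l ?mulr_gt0 ?pi_gt0 //.
by lra.
Qed.

End inner_implies_stable.

(** * Sets on which the spectral measure is dominated by arc length *)

Section dominated_part.
Context {R : realType}.
Local Notation C := R[i].
Local Notation T := (borel_circle R).
Local Notation leb := (@lebesgue_measure R).
Local Notation arc := (@circle_lebesgue R).
Variable mu : {finite_measure set T -> \bar R}.
Implicit Types (f : T -> R) (S P : set T).

Lemma circle_lebesgue_fin S : measurable S -> arc S \is a fin_num.
Proof.
move=> mS; rewrite ge0_fin_numE // circle_lebesgueE.
have m1 : measurable ((@expi R) @^-1` S `&` `[0, 2 * pi[).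
  apply: measurableI; last exact: measurable_itv.
  by rewrite -[X in measurable X]setTI; exact: measurable_expi.
apply: (@le_lt_trans _ _ (leb `[0, 2 * pi[)).
  by apply: le_measure; [apply/mem_set; exact: m1|apply/mem_set; exact: measurable_itv|exact: subIsetr].
by rewrite lebesgue_measure_itv /=; case: ifP => _; rewrite ?ltry // -EFinB ltry.
Qed.

(* Hahn decomposition of mu - n arc for every n: mu is singular if all the
   negative parts are mu-null. *)
Lemma dominated_subset : ~ mutually_singular mu arc ->
  exists (k : nat) P, [/\ measurable P, (0 < mu P)%E &
    forall S, measurable S -> S `<=` P -> (mu S <= k%:R%:E * arc S)%E].
Proof.
move=> nsing.
pose arcF : {finite_measure set T -> \bar R} :=
  HB.pack arc (Measure_isFinite.Build _ _ _ arc circle_lebesgue_fin).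
pose nu (n : nat) := cadd (charge_of_finite_measure mu)
   (cscale (- n%:R) (charge_of_finite_measure arcF)).
have /choice[Q hQ] : forall n, exists Q : set T * set T, hahn_decomposition (nu n) Q.1 Q.2.
  by move=> n; have [P [N h]] := Hahn_decomposition (nu n); exists (P, N).
have nuE n S : measurable S -> (nu n S = mu S - n%:R%:E * arc S)%E.
  by move=> _; transitivity (mu S + (- n%:R)%:E * arc S)%E => //; rewrite EFinN mulNe.
have mfin S : measurable S -> mu S = (fine (mu S))%:E.
  by move=> mS; rewrite fineK // fin_num_measure.
have afin S : measurable S -> arc S = (fine (arc S))%:E.
  by move=> mS; rewrite fineK // circle_lebesgue_fin.
have [[n hn]|neg0] := pselect (exists n, mu (Q n).2 <> 0%E).
  have [_ [mN hN] _ _] := hQ n; exists n, (Q n).2; split => //.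
    by rewrite lt0e measure_ge0 andbT; apply/eqP.
  move=> S mS SN; have h : (nu n S <= 0)%E := hN S mS SN.
  move: h; rewrite nuE // mfin // afin // -EFinM -EFinB !lee_fin.
  by rewrite subr_le0.
exfalso; apply: nsing; exists (\bigcup_n (Q n).2).
have mN n : measurable (Q n).2 by have [_ [mN _] _ _] := hQ n.
have mU : measurable (\bigcup_n (Q n).2) by exact: bigcup_measurable.
split => //.
  apply/eqP; rewrite eq_le measure_ge0 andbT.
  apply: le_trans (measure_sigma_subadditive _ mN mU _) _ => //.
  rewrite eseries0 // => n _ _; apply: contrapT => h; apply: neg0; by exists n.
set A := ~` _; have mA : measurable A by exact: measurableC.
have AP n : A `<=` (Q n).1.
  move=> x Ax; have [_ _ PN _] := hQ n.
  have : ((Q n).1 `|` (Q n).2) x by rewrite PN.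
  by case=> // xN; exfalso; apply: Ax; exists n.
(* [A] avoids every negative set, so this holds for all [n] and the Archimedean property forces
   [arc A = 0]. *)
have h n : n%:R * fine (arc A) <= fine (mu A).
  have [[_ hP] _ _ _] := hQ n; have hA : (0 <= nu n A)%E := hP A mA (AP n).
  by move: hA; rewrite nuE // mfin // afin // -EFinM -EFinB lee_fin subr_ge0.
rewrite afin //; congr EFin; apply/eqP; rewrite eq_le fine_ge0 // andbT leNgt; apply/negP => a0.
have := archi_boundP (divr_ge0 (fine_ge0 (measure_ge0 mu A)) (ltW a0)).
by rewrite ltr_pdivrMr // ltNge h.
Qed.

(** Monotonicity of the integral in the measure asks for a comparison on all sets. The restriction
    of [mu] to the complement of [P] is added to [k arc] for that purpose and contributes nothing
    over [P]. *)
Lemma ge0_integral_dominated P (k : R) f : 0 <= k -> measurable P ->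
  (forall S, measurable S -> S `<=` P -> (mu S <= k%:E * arc S)%E) ->
  measurable_fun setT f -> (forall xi, 0 <= f xi) ->
  (\int[mu]_(xi in P) (f xi)%:E <= k%:E * \int[arc]_xi (f xi)%:E)%E.
Proof.
move=> k0 mP dom mf f0; have mCP := measurableC mP.
pose kk := NngNum k0.
have le12 S : measurable S -> (mu S <= measure_add (mscale kk arc) (mrestr mu mCP) S)%E.
  move=> mS; rewrite measure_addE /mscale /mrestr /=.
  rewrite -{1}(setIT S) -(setUv P) setIUr measureU //; first last.
  - by rewrite setIACA setICr setI0.
  - exact: measurableI.
  - exact: measurableI.
  apply: leeD => //; apply: le_trans (dom _ (measurableI _ _ mS mP) (@subIsetr _ _ _)) _.
  apply: lee_wpmul2l; first by rewrite lee_fin.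
  by apply: le_measure; [apply/mem_set; exact: measurableI|apply/mem_set|exact: subIsetl].
have mfE : measurable_fun setT (fun xi => (f xi)%:E) by exact/measurable_EFinP.
have fE0 xi : (0 <= (f xi)%:E)%E by rewrite lee_fin.
apply: le_trans (ge0_le_measure_integral le12 mP fE0 mfE) _.
have mfP := measurable_funS measurableT (@subsetT _ P) mfE.
rewrite ge0_integral_measure_add // ge0_integral_mscale //.
have -> : (\int[mrestr mu mCP]_(xi in P) (f xi)%:E = 0)%E.
  apply: null_set_integral => //.
  by transitivity (mu (P `&` ~` P)); [|rewrite setICr measure0].
rewrite adde0; apply: lee_wpmul2l; first by rewrite lee_fin.
exact: ge0_subset_integral.
Qed.

Lemma circle_integral_le f : measurable_fun setT f -> (forall xi, 0 <= f xi) ->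
  (\int[arc]_xi (f xi)%:E <= \int[leb]_(t in `[0%R, (0 + 2 * pi)%R]) (f (expi t))%:E)%E.
Proof.
move=> mf f0; pose I := `[0, 2 * pi[%classic : set R.
have mI : measurable I by exact: measurable_itv.
have mCI : measurable (~` I) by exact: measurableC.
have mfE : measurable_fun setT (fun xi => (f xi)%:E) by exact/measurable_EFinP.
have mg : measurable_fun setT (fun t => (f (expi t))%:E).
  by apply/measurable_EFinP; apply: (measurableT_comp mf); exact: measurable_expi.
have restr_le (g : R -> \bar R) : measurable_fun setT g -> (forall t, 0 <= g t)%E ->
    (\int[mrestr leb (measurable_itv02pi (R:=R))]_t g t <= \int[leb]_(t in I) g t)%E.
  move=> mg' g0.
  have := @ge0_negligible_integral _ _ _ (mrestr leb (measurable_itv02pi (R:=R))) setT (~` I) g.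
  rewrite setTD setCK => -> //.
    by apply: ge0_le_measure_integral => // S mS; apply: le_measure; rewrite ?inE //; exact: measurableI.
  by transitivity (leb (~` I `&` I)); [|rewrite setICl measure0].
rewrite /circle_lebesgue ge0_integral_pushforward //.
- apply: le_trans (restr_le _ mg _) _; first by move=> t; rewrite lee_fin.
  apply: ge0_subset_integral => //; first by exact: measurable_funTS.
    by move=> t _; rewrite lee_fin.
  by move=> t; rewrite /I /= !in_itv /= add0r => /andP[-> /ltW].
- exact: measurable_expi.
- by move=> y _; rewrite lee_fin.
Qed.

Lemma measurable_complexX (g : T -> C) k : measurable_complex g ->
  measurable_complex (fun xi => g xi ^+ k).
Proof.
move=> mg; elim: k => [|k IH]; first exact: measurable_complex_cst.
rewrite (_ : (fun xi => _) = fun xi => g xi * g xi ^+ k); first exact: measurable_complexM.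
by apply/funext => xi; rewrite exprS.
Qed.

Lemma measurable_csq_poly (c : nat -> C) N :
  measurable_fun setT (fun xi : T => csq (\sum_(k < N) circle_val xi ^+ k * c k)).
Proof.
have [mr mi] : measurable_complex (fun xi : T => \sum_(k < N) circle_val xi ^+ k * c k).
  apply: (measurable_complex_sum (index_enum 'I_N) (F := fun k xi => circle_val xi ^+ k * c k)) => k.
  apply: measurable_complexM; last exact: measurable_complex_cst.
  apply: measurable_complexX; split; [exact: measurable_Re_circle|exact: measurable_Im_circle].
by apply: measurable_funD; exact: measurable_funX.
Qed.

Lemma circle_parseval_le (H : hilbertType R) (u : H) (c : nat -> C) N : sqn u = 1 ->
  (\int[arc]_xi (csq (\sum_(k < N) circle_val xi ^+ k * c k))%:E <=
   (2 * pi * \sum_(k < N) csq (c k))%:E)%E.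
Proof.
move=> u1; pose h k := c k *: u.
have pE t : csq (\sum_(k < N) circle_val (expi t) ^+ k * c k) = sqn (hpoly h N (cis t)).
  have -> : hpoly h N (cis t) = (\sum_(k < N) circle_val (expi t) ^+ k * c k) *: u.
    by rewrite scaler_suml; apply: eq_bigr => k _; rewrite scalerA.
  by rewrite sqnZ u1 mulr1.
apply: le_trans (circle_integral_le _ _) _.
- exact: measurable_csq_poly.
- by move=> xi; exact: csq_ge0.
under eq_integral do rewrite pE.
rewrite parseval lee_fin ler_wpM2l ?mulr_ge0 ?pi_ge0 //.
by apply: ler_sum => k _; rewrite sqnZ u1 mulr1.
Qed.

End dominated_part.

Section dominated_vectors.
Context {R : realType} {H : hilbertType R}.
Local Notation C := R[i].
Local Notation T := (borel_circle R).
Local Notation arc := (@circle_lebesgue R).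
Variables (mu : {finite_measure set T -> \bar R}) (E : T -> hilbertType R).
Variables (e : nat -> forall xi, E xi) (V : H -> forall xi, E xi).
Hypothesis fe : fundamental_sequence e.
Hypothesis E_neq0 : {ae mu, forall xi, exists x : E xi, x <> 0}.
Hypothesis VU : direct_integral_unitary mu e V.
Implicit Types (x y : H) (xi : T).

Lemma fundamental_neq0 xi (x : E xi) : x <> 0 -> exists j, e j xi != 0.
Proof.
move=> x0; apply: contrapT => /forallNP e0; apply: x0; apply: sqn0_eq.
apply/ler_addgt0Pr => eps eps0; rewrite add0r.
have [s] := rational_section_dense fe x eps0.
rewrite /rational_section big1 ?subr0 => [/ltW//|k _].
by have /negP := e0 k; rewrite negbK => /eqP ->; rewrite scaler0.
Qed.

Variables (m : nat) (b : 'I_m -> H).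
Local Notation w := (defect_density V b).

(** Almost every fibre is nonzero, so some [e j] is nonzero there. The countably many truncations
    cover [P] up to a null set, and one has positive measure. *)
Lemma truncated_section P : measurable P -> (0 < mu P)%E -> exists j (K : nat) B,
  [/\ measurable B, B `<=` P, (0 < mu B)%E &
    forall xi, B xi -> [/\ e j xi != 0, sqn (e j xi) <= K%:R & w xi <= K%:R]].
Proof.
move=> mP P0.
pose B j (K : nat) := P `&` [set xi | 0 < sqn (e j xi)] `&` [set xi | sqn (e j xi) <= K%:R] `&` [set xi | w xi <= K%:R].
have mle (f : T -> R) (a : R) : measurable_fun setT f -> measurable [set xi | f xi <= a].
  move=> mf; rewrite -[X in measurable X]setTI.
  have -> : [set xi | f xi <= a] = f @^-1` `]-oo, a]%classic.
    by apply/seteqP; split=> xi /=; rewrite in_itv.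
  by apply: mf => //; exact: measurable_itv.
have me j : measurable_fun setT (fun xi => sqn (e j xi)).
  by apply: (measurable_sqn_section fe); exact: measurable_section_e.
have mB j K : measurable (B j K).
  apply: measurableI; last exact: (mle _ _ (measurable_defect_density fe VU b)).
  apply: measurableI; last exact: (mle _ _ (me j)).
  apply: measurableI => //.
  have -> : [set xi | 0 < sqn (e j xi)] = ~` [set xi | sqn (e j xi) <= 0].
    by apply/seteqP; split=> xi /=; rewrite ltNge => /negP.
  by apply: measurableC; exact: mle.
have [[j [K BjK]]|B0] := pselect (exists j K, mu (B j K) <> 0%E).
  exists j, K, (B j K); split => //.
  - by move=> xi [[[]]].
  - by rewrite lt0e measure_ge0 andbT; apply/eqP.
  - move=> xi [[[_ h1] h2] h3]; split => //.
    by rewrite -sqn_eq0 gt_eqF.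
exfalso; suff : mu.-negligible P.
  by move=> /(measure_negligible mP) h; move: P0; rewrite h ltxx.
apply: (@negligibleS _ _ _ mu ((~` [set xi | exists x : E xi, x <> 0]) `|`
    \bigcup_j \bigcup_K B j K)).
  move=> xi Pxi; have [[x x0]|nx] := pselect (exists x : E xi, x <> 0); last by left.
  right; have [j ej] := fundamental_neq0 x0.
  pose M := Num.max (sqn (e j xi)) (w xi).
  have M0 : 0 <= M by rewrite le_max sqn_ge0.
  have /ltW hM := archi_boundP M0.
  exists j => //; exists (Num.bound M) => //.
  split; first split; first split => //=.
  - by rewrite lt_neqAle sqn_ge0 andbT eq_sym sqn_eq0.
  - by apply: le_trans hM; rewrite le_max lexx.
  - by apply: le_trans hM; rewrite le_max lexx orbT.
apply: negligibleU; first exact: E_neq0.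
apply: negligible_bigcup => j; apply: negligible_bigcup => K.
exists (B j K); split => //; apply: contrapT => h; apply: B0; by exists j, K.
Qed.

Lemma dominated_vector P : measurable P -> (0 < mu P)%E -> exists x (K : R) B,
  [/\ x != 0, 0 <= K, measurable B, B `<=` P &
    {ae mu, forall xi, (B xi -> sqn (V x xi) <= K /\ w xi <= K) /\
      (~ B xi -> V x xi = 0)}].
Proof.
move=> mP P0; have [j [K [B [mB BP B0 hB]]]] := truncated_section mP P0.
pose f xi := (\1_B xi)%:C%C *: e j xi.
have fin xi : B xi -> f xi = e j xi by move=> h; rewrite /f indicE mem_set // scale1r.
have fout xi : ~ B xi -> f xi = 0.
  by move=> h; rewrite /f indicE memNset // (rmorph0 (real_complex R)) scale0r.
have mf : measurable_section e f.
  apply: measurable_sectionZ; last exact: measurable_section_e.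
  by split; [exact: measurable_indic|exact: measurable_cst].
have msf := measurable_sqn_section fe mf.
have Lf : L2_section e mu f.
  split => //; rewrite sqnormE.
  apply: (@le_lt_trans _ _ (\int[mu]_xi (cst K%:R%:E) xi)%E).
    apply: ge0_le_integral => //.
    - by move=> xi _; rewrite lee_fin sqn_ge0.
    - exact/measurable_EFinP.
    - move=> xi _; rewrite lee_fin; have [/[dup] /fin -> /hB[]//|/fout ->] := pselect (B xi).
      by rewrite sqn0.
  rewrite integral_cst //; apply: lte_mul_pinfty; rewrite ?lee_fin //.
  by rewrite -ge0_fin_numE // fin_num_measure.
have [_ _ _ /(_ f Lf)[x xf]] := VU.
exists x, K%:R, B; split => //.
(* If [x] were 0, [f] would vanish almost everywhere, but it is nonzero on [B], which has positive
   measure. *)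
- apply/eqP => x0; have := integral_sqn_V VU x; rewrite x0 sqn0 => i0.
  have : (\int[mu]_xi `|(sqn (V 0 xi))%:E| = 0)%E.
    by apply: etrans i0; apply: eq_integral => xi _; rewrite gee0_abs // lee_fin sqn_ge0.
  have mV : measurable_fun setT (fun xi => (sqn (V 0 xi))%:E).
    by apply/measurable_EFinP; exact: (measurable_sqn_V fe VU).
  move=> /(ae_eq_integral_abs mu measurableT mV) V0.
  have nB : {ae mu, forall xi, ~ B xi}.
    apply: filterS2 V0 xf => xi /(_ I) [Vxi]; rewrite x0 => Vf Bxi.
    have [/negP ej _ _] := hB xi Bxi; apply: ej.
    by rewrite -sqn_eq0 -(fin xi Bxi) -Vf Vxi.
  have : mu.-negligible B by apply: negligibleS nB => xi Bxi /= h; exact: h.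
  by move=> /(measure_negligible mB) h; move: B0; rewrite h ltxx.
- apply: filterS xf => xi ->; split; last exact: fout.
  by move=> Bxi; rewrite fin //; have [] := hB xi Bxi.
Qed.

Variables U W D Wi : {linear H -> H}.
Hypothesis UW : perturbation_of U W D Wi.
Hypothesis VW : forall x, {ae mu, forall xi, V (W x) xi = circle_val xi *: V x xi}.
Hypothesis ob : orthonormal_basis (defect U) b.

Lemma V_iter k x : {ae mu, forall xi, V (iter k W x) xi = circle_val xi ^+ k *: V x xi}.
Proof.
elim: k => [|k IH]; first by apply: aeW => xi; rewrite expr0 scale1r.
by apply: filterS2 IH (VW (iter k W x)) => xi h1; rewrite iterS => ->; rewrite h1 scalerA exprS.
Qed.

Lemma sqn_orthonormal d : D d = d -> sqn d = \sum_i csq (inner d (b i)).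
Proof.
move=> Dd; have [_ oe bE] := ob.
have dE : d = \sum_i inner d (b i) *: b i by apply: bE; rewrite (defectE UW).
apply: complexI; rewrite -inner_sqn {1}dE inner_suml rmorph_sum; apply: eq_bigr => i _.
by transitivity ((csq (inner d (b i)))%:C%C); rewrite // csqE sqr_normc (innerJ (b i)).
Qed.

Section bound.
Variables (x : H) (k K : R) (B : set T).
Hypotheses (k0 : 0 <= k) (K0 : 0 <= K) (mB : measurable B)
  (dom : forall S, measurable S -> S `<=` B -> (mu S <= k%:E * arc S)%E)
  (xB : {ae mu, forall xi, (B xi -> sqn (V x xi) <= K /\ w xi <= K) /\
      (~ B xi -> V x xi = 0)}).

(** The left side is [|x + Y|^2 - |x - Y|^2], with [Y] the sum, so only the norm identity of [V] is
    used. Fibrewise the difference lives on [B], where Young's inequality, the domination by arc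
    length and Parseval bound it. *)
Lemma rip_shift_le (y : nat -> H) N (s : R) : 0 < s -> (forall j, D (y j) = y j) ->
  4 * rip x (\sum_(j < N) iter j W (y j)) <=
  k * (2 * s * K * fine (arc setT) + 2 * K / s * (2 * pi * \sum_(j < N) sqn (y j))).
Proof.
move=> s0 Dy; set Y := \sum_(j < N) _.
have [bM oe bE] := ob.
pose c i j := inner (y j) (b i).
pose q i xi := csq (\sum_(j < N) circle_val xi ^+ j * c i j).
pose Q xi := \sum_i q i xi.
have iterWP j (a : C) u v : iter j W (a *: u + v) = a *: iter j W u + iter j W v.
  by elim: j => // j IH; rewrite !iterS IH linearP.
have iterW_sum j (a : 'I_m -> C) : iter j W (\sum_i a i *: b i) = \sum_i a i *: iter j W (b i).
  elim/big_rec2 : _ => [|i u v _ IH]; last by rewrite iterWP IH.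
  by elim: j => // j IH; rewrite iterS IH linear0.
have YE : Y = \sum_(p : 'I_N * 'I_m) c p.2 p.1 *: iter p.1 W (b p.2).
  rewrite -(pair_bigA _ (fun (j : 'I_N) i => c i j *: iter j W (b i))).
  apply: eq_bigr => j _; rewrite -iterW_sum; congr iter.
  by apply: bE; rewrite (defectE UW).
have VY : {ae mu, forall xi, V Y xi = \sum_i (\sum_(j < N) circle_val xi ^+ j * c i j) *: V (b i) xi}.
  have h1 := V_lincomb VU (index_enum ('I_N * 'I_m)%type) (fun p => c p.2 p.1) (fun p => iter p.1 W (b p.2)).
  have h2 : {ae mu, forall xi, forall p : 'I_N * 'I_m, V (iter p.1 W (b p.2)) xi = circle_val xi ^+ p.1 *: V (b p.2) xi}.
    by apply: filter_forall => p; exact: V_iter.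
  apply: filterS2 h1 h2 => xi; rewrite -YE => -> h2.
  transitivity (\sum_(j < N) \sum_i (circle_val xi ^+ j * c i j) *: V (b i) xi).
    rewrite (pair_bigA _ (fun (j : 'I_N) i => (circle_val xi ^+ j * c i j) *: V (b i) xi)).
    by apply: eq_bigr => p _; rewrite h2 scalerA mulrC.
  by rewrite exchange_big; apply: eq_bigr => i _; rewrite scaler_suml.
pose g xi := 2 * s * K + 2 * K / s * Q xi.
have q0 i xi : 0 <= q i xi by exact: csq_ge0.
have Q0 xi : 0 <= Q xi by exact: sumr_ge0.
have c0 : 0 <= 2 * K / s by rewrite divr_ge0 ?mulr_ge0 // ltW.
have sK0 : 0 <= 2 * s * K by rewrite !mulr_ge0 // ltW.
have g0 xi : 0 <= g xi by rewrite addr_ge0 // mulr_ge0.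
have mq i : measurable_fun setT (q i) by exact: measurable_csq_poly.
have mQ : measurable_fun setT Q by apply: measurable_sum.
have mg : measurable_fun setT g.
  by apply: measurable_funD => //; exact: measurable_funM.
have pw : {ae mu, forall xi, (sqn (V (x + Y) xi) <= sqn (V (x - Y) xi) + \1_B xi * g xi)}.
  have h1 := V_linear VU 1 Y x; have h2 := V_linear VU (- 1) Y x.
  rewrite scale1r addrC in h1; rewrite scaleN1r addrC in h2.
  apply: filterS2 (filterI h1 h2) (filterI xB VY) => xi [-> ->] [[hB hN] vy].
  rewrite scale1r scaleN1r addrC [- _ + _]addrC sqnD sqnB.
  have [Bxi|nB] := pselect (B xi); last first.
    by rewrite hN // !rip0l indicE memNset // mul0r; lra.
  have [x1 w1] := hB Bxi; rewrite indicE mem_set // mul1r.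
  have := rip_le (V x xi) (V Y xi) s0.
  have h3 : sqn (V Y xi) <= K * Q xi.
    rewrite vy; apply: le_trans (sqn_lincomb_le _ _) _; rewrite mulrC.
    by apply: ler_wpM2r; [exact: Q0|exact: w1].
  have h4 : s * sqn (V x xi) <= s * K by rewrite ler_pM2l.
  have h5 : sqn (V Y xi) / s <= K * Q xi / s by rewrite ler_pM2r ?invr_gt0.
  have -> : g xi = 2 * (s * K) + 2 * (K * Q xi / s) by rewrite /g; ring.
  lra.
have int1 : ((sqn (x + Y))%:E <= (sqn (x - Y))%:E + \int[mu]_(xi in B) (g xi)%:E)%E.
  have mVx u : measurable_fun setT (fun xi => (sqn (V u xi))%:E).
    by apply/measurable_EFinP; exact: (measurable_sqn_V fe VU).
  rewrite -!(integral_sqn_V VU).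
  have -> : (\int[mu]_(xi in B) (g xi)%:E = \int[mu]_xi (\1_B xi * g xi)%:E)%E.
    rewrite integral_mkcond; apply: eq_integral => xi _; rewrite patchE indicE.
    by case: ifP => _; rewrite ?mul1r ?mul0r.
  have mBg : measurable_fun setT (fun xi => (\1_B xi * g xi)%:E).
    by apply/measurable_EFinP; apply: measurable_funM => //; exact: measurable_indic.
  rewrite -ge0_integralD //; first last.
  - by move=> xi _; rewrite lee_fin mulr_ge0.
  - by move=> xi _; rewrite lee_fin sqn_ge0.
  apply: ae_ge0_le_integral => //.
  - by move=> xi _; rewrite lee_fin sqn_ge0.
  - by move=> xi _; rewrite adde_ge0 ?lee_fin ?sqn_ge0 ?mulr_ge0.
  - by exact: emeasurable_funD.
  - by apply: filterS pw => xi h _; rewrite -EFinD lee_fin.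
have int2 : (\int[mu]_(xi in B) (g xi)%:E <= (k * (2 * s * K * fine (arc setT) +
    2 * K / s * (2 * pi * \sum_(j < N) sqn (y j))))%:E)%E.
  apply: le_trans (ge0_integral_dominated k0 mB dom mg g0) _.
  rewrite EFinM; apply: lee_wpmul2l; first by rewrite lee_fin.
  have -> : (\int[arc]_xi (g xi)%:E = \int[arc]_xi (cst (2 * s * K)%:E) xi + \int[arc]_xi (2 * K / s * Q xi)%:E)%E.
    rewrite -ge0_integralD //.
    - by move=> xi _; rewrite lee_fin mulr_ge0.
    - by apply/measurable_EFinP; exact: measurable_funM.
  rewrite integral_cst // ge0_integralZ_fin //.
  rewrite EFinD; apply: leeD.
    by rewrite [leRHS]EFinM fineK // circle_lebesgue_fin.
  rewrite [leRHS]EFinM; apply: lee_wpmul2l; first by rewrite lee_fin.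
  have -> : (\int[arc]_xi (Q xi)%:E = \sum_i \int[arc]_xi (q i xi)%:E)%E.
    under eq_integral do rewrite -sumEFin.
    rewrite ge0_integral_sum //; first by move=> i; apply/measurable_EFinP; exact: mq.
    by move=> i xi _; rewrite lee_fin.
  apply: (@le_trans _ _ (\sum_i (2 * pi * \sum_(j < N) csq (c i j))%:E)%E).
    apply: lee_sum => i _; apply: (circle_parseval_le (u := b i)).
    by rewrite /sqn /rip oe eqxx.
  rewrite sumEFin lee_fin -mulr_sumr exchange_big /=.
  by under eq_bigr do rewrite -sqn_orthonormal //.
have := le_trans int1 (leeD2l _ int2).
rewrite -EFinD lee_fin sqnD sqnB; lra.
Qed.

(** For [y j = D (W^-j x)] the product with [x] is the sum itself, and the weight [s = B' + 1] lets
    the left side absorb the sum on the right. *)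
Lemma bessel_bound : exists c, forall N, \sum_(j < N) sqn (D (iter j Wi x)) <= c.
Proof.
pose A := k * (2 * K * fine (arc setT)); pose B' := k * (2 * K * (2 * pi)).
have A0 : 0 <= A by rewrite !mulr_ge0 // fine_ge0.
have B0 : 0 <= B' by rewrite !mulr_ge0 // pi_ge0.
have s0 : 0 < B' + 1 by rewrite ltr_wpDl.
exists (A * (B' + 1)) => N; set S := \sum_(j < N) _.
have S0 : 0 <= S by apply: sumr_ge0 => j _; exact: sqn_ge0.
have := @rip_shift_le (fun j => D (iter j Wi x)) N (B' + 1) s0 (fun j => proj_idem UW _).
have -> : rip x (\sum_(j < N) iter j W (D (iter j Wi x))) = S.
  rewrite ripC rip_suml; apply: eq_bigr => j _.
  by rewrite -(rip_iter_Wi UW j) (iter_WiK UW) ripC (rip_proj_sqn UW).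
rewrite -/S.
have -> : k * (2 * (B' + 1) * K * fine (arc setT) + 2 * K / (B' + 1) * (2 * pi * S)) =
  A * (B' + 1) + B' / (B' + 1) * S by rewrite /A /B'; ring.
have : B' / (B' + 1) * S <= S.
  by rewrite ler_piMl // ler_pdivrMr // mul1r lerDl.
lra.
Qed.

End bound.

End dominated_vectors.

Lemma inner_singular (R : realType) (H : hilbertType R)
    (mu : {finite_measure set (borel_circle R) -> \bar R}) (E : borel_circle R -> hilbertType R)
    (e : nat -> forall xi, E xi) (V : H -> forall xi, E xi)
    (U W D Wi : {linear H -> H}) (m : nat) (b : 'I_m -> H) :
  fundamental_sequence e -> {ae mu, forall xi, exists x : E xi, x <> 0} ->
  direct_integral_unitary mu e V ->
  (forall x, {ae mu, forall xi, V (W x) xi = circle_val xi *: V x xi}) ->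
  perturbation_of U W D Wi -> completely_non_unitary U ->
  orthonormal_basis (defect U) b -> Theta_inner U ->
  mutually_singular mu (@circle_lebesgue R).
Proof.
move=> fe E0 VU VW UW U_cnu ob inn; apply: contrapT => nsing.
have [k [P [mP P0 dom]]] := dominated_subset nsing.
have [x [K [B [x0 K0 mB BP xB]]]] := dominated_vector fe E0 VU b mP P0.
have domB S : measurable S -> S `<=` B -> (mu S <= k%:R%:E * circle_lebesgue S)%E.
  by move=> mS SB; apply: dom => //; exact: subset_trans BP.
have [c hc] := bessel_bound fe VU UW VW ob (ler0n R k) K0 mB domB xB.
move/eqP: x0; apply; apply: (summable_defect_eq0 UW U_cnu _ hc).
by move=> d Dd; exact: (Theta_inner_stable UW ob).
Qed.

Theorem corollary3p2 (R : realType) (H : hilbertType R) (n : nat)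
    (U : {linear H -> H}) (A : H -> H) (UA : {linear H -> H})
    (mu : {finite_measure set (borel_circle R) -> \bar R})
    (n_gt0 : (0 < n)%N)
    (H_separable : separable H)
    (U_contraction : contraction_op U)
    (U_cnu : completely_non_unitary U)
    (dim_defect : has_dim (defect U) n)
    (dim_defect_star : has_dim (defect_star U) n)
    (Theta0 : forall x, defect U x -> Theta U 0 x = 0)
    (A_unitary : unitary_on (defect U) (defect_star U) A)
    (UA_orthogonal : forall f, orthogonal_in setT (defect U) f -> UA f = U f)
    (UA_defect : forall f, defect U f -> UA f = A f)
    (mu_spectral : scalar_spectral_measure UA mu) :
  [<-> mutually_singular mu (@circle_lebesgue R);
       {ae @circle_lebesgue R, forall xi, has_dim (Xspace U xi) 0};
       Theta_inner U].
Proof.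
have [D [Wi UW]] := perturbation_exists n_gt0 dim_defect dim_defect_star Theta0
  A_unitary UA_orthogonal UA_defect.
have [m [b ob]] := has_dim_orthonormal dim_defect.
have [v _ v0] := has_dim_neq0 n_gt0 dim_defect.
have [E [e [V [fe E0 VU VW]]]] := mu_spectral.
have bd := Theta_bd_ae UW ob.
split; last split.
- move=> sing; have iso := singular_isometric_ae UW ob v0 fe VU VW sing.
  apply: filterS2 bd iso => xi [oS _] iS.
  by apply/has_dim0; exact: (isometric_Xspace dim_defect ob).
- move=> X0; apply: filterS2 bd X0 => xi [oS lim] /has_dim0 Xxi.
  apply: (Xspace0_isometric dim_defect dim_defect_star ob oS) => // d dd.
  exact: (nontangential_sqn_le UW dd lim).
- exact: (inner_singular fe E0 VU VW UW U_cnu ob).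
Qed.
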